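(* Let $\mathcal A$ be an injective operator ideal with the $\ell_\infty$-extension property and let $X$ be a Banach space. Then: (a) $X$ has the $\mathcal A$-approximation property if and only if $$(\mathcal A^{min})^{inj}(Y,X)=\mathcal A^{min}(Y,X)$$ for all Banach spaces $Y$. (b) The dual space $X^*$ has the $\mathcal A$-approximation property if and only if $$((\mathcal A^{dual})^{min})^{sur}(X,Y)=(\mathcal A^{dual})^{min}(X,Y)$$ for all Banach spaces $Y$.
   Context: Operator ideals are quasi-normed operator ideals $(\mathcal A,\alpha)$ between Banach spaces in the sense of Pietsch (with complete components). $\mathcal B,\mathcal K,\overline{\mathcal F},\mathcal F$ denote the bounded, compact, approximable (operator-norm limits of finite rank) and finite rank operators. $B_X$ is the closed unit ball of $X$. Composition: $T\in\mathcal A_1\circ\mathcal A_2(X,Y)$ iff $T=U\circ V$ with $V\in\mathcal A_2(X,Z)$, $U\in\mathcal A_1(Z,Y)$ for some Banach space $Z$. $\mathcal A^{min}=\overline{\mathcal F}\circ\mathcal A\circ\overline{\mathcal F}$. Dual: $T\in\mathcal A^{dual}(X,Y)$ iff $T^*\in\mathcal A(Y^*,X^* )$, with $\alpha^{dual}(T)=\alpha(T^* )$. Injective hull: let $i_Y:Y\hookrightarrow\ell_\infty(B_{Y^*})$, $i_Y(y)=(y^*(y))_{y^*\in B_{Y^*}}$. Then $T\in\mathcal A^{inj}(X,Y)$ iff $i_Y\circ T\in\mathcal A$, with $\alpha^{inj}(T)=\alpha(i_Y\circ T)$; $\mathcal A$ is injective if $\mathcal A^{inj}=\mathcal A$. Surjective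 hull: let $q_X:\ell_1(B_X)\to X$, $q_X((\lambda_b)_b)=\sum_b\lambda_b b$. Then $T\in\mathcal A^{sur}(X,Y)$ iff $T\circ q_X\in\mathcal A$, with $\alpha^{sur}(T)=\alpha(T\circ q_X)$. $\ell_\infty$-extension property of $(\mathcal A,\alpha)$: for every Banach space $X$, set $\Gamma$ and $T\in\mathcal A(X,\ell_\infty(\Gamma))$ there is $\tilde T\in\mathcal A(\ell_\infty(B_{X^*}),\ell_\infty(\Gamma))$ with $T=\tilde T\circ i_X$ and $\alpha(\tilde T)=\alpha(T)$. $\mathcal A$-approximation property: the composition norm on $\mathcal A\circ\mathcal K$ is $\alpha_\kappa(T)=\inf\{\alpha(T_1)\|T_2\|: T=T_1\circ T_2,\ T_1\in\mathcal A,\ T_2\in\mathcal K\}$. For a compact subset $K$ of a Banach space $E$, call a Banach space $Z$ admissible for $(E,K)$ if $Z$ is a linear subspace of $E$ with its own complete norm such that the formal inclusion $i_Z:Z\to E$ is a compact operator, $K\subset i_Z(B_Z)$, and for every $g\in Z^*$ and $\epsilon>0$ there is $f\in E^*$ with $|f(z)-g(z)|<\epsilon$ for all $z\in B_Z$ (such $Z$ always exist). For $T\in\mathcal A(E,G)$ put $\|T\|_K=\inf\{\alpha_\kappa(T\circ i_Z): Z\text{ admissible for }(E,K)\}$. The family $\{\|\cdot\|_K: K\subset E\text{ compact}\}$ defines the topology $\lambda_{\mathcal A}$ on $\mathcal A(E,G)$. A Banach space $X$ has the $\mathcal A$-approximation property if for every Banach space $Y$, $\mathcal F(Y,X)$ is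 dense in $\mathcal A(Y,X)$ in the topology $\lambda_{\mathcal A}$. *)

(* Defs.v *)
From HB Require Import structures.
From mathcomp Require Import all_boot all_order all_algebra finmap.
From mathcomp Require Import complex.
From mathcomp Require Import all_classical all_reals.
From mathcomp Require Import topology normedtype sequences summability.

Set Implicit Arguments.
Unset Strict Implicit.
Unset Printing Implicit Defensive.
Import Order.TTheory GRing.Theory Num.Theory.
Import numFieldNormedType.Exports.
Local Open Scope classical_set_scope.
Local Open Scope ring_scope.

Variant scalar_kind := RealScalars | ComplexScalars.

Definition scalar_field (R : realType) (k : scalar_kind) : numFieldType :=
  match k with
  | RealScalars => R
  | ComplexScalars => R[i]
  end.

Section Scalars.
Variables (R : realType) (k : scalar_kind).
Local Notation K := (scalar_field R k).

Definition scalar_re : K -> R :=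
  match k return scalar_field R k -> R with
  | RealScalars => id
  | ComplexScalars => @complex.Re R
  end.

Definition scalar_of_real : R -> K :=
  match k return R -> scalar_field R k with
  | RealScalars => id
  | ComplexScalars => fun r => Complex r 0
  end.

Lemma scalar_of_realK : cancel scalar_of_real scalar_re.
Proof. by rewrite /scalar_of_real /scalar_re; case: k. Qed.

Lemma scalar_reK z : 0 <= z -> scalar_of_real (scalar_re z) = z.
Proof.
rewrite /scalar_of_real /scalar_re; case: k z => //= -[a b].
by rewrite lecE /= => /andP[/eqP -> _].
Qed.

Lemma scalar_of_realD a b :
  scalar_of_real (a + b) = scalar_of_real a + scalar_of_real b.
Proof.
rewrite /scalar_of_real; case: k => //=.
by apply/eqP; rewrite eq_complex /= addr0 !eqxx.
Qed.

Lemma scalar_of_realM a b :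
  scalar_of_real (a * b) = scalar_of_real a * scalar_of_real b.
Proof.
rewrite /scalar_of_real; case: k => //=.
by apply/eqP; rewrite eq_complex /= !mulr0 !mul0r subr0 addr0 !eqxx.
Qed.

Lemma scalar_of_real_le a b :
  (scalar_of_real a <= scalar_of_real b) = (a <= b).
Proof. by rewrite /scalar_of_real; case: k => //=; rewrite lecE /= eqxx. Qed.

Lemma scalar_of_real0 : scalar_of_real 0 = 0.
Proof. by rewrite /scalar_of_real; case: k. Qed.

Lemma scalar_of_real1 : scalar_of_real 1 = 1.
Proof. by rewrite /scalar_of_real; case: k. Qed.

Lemma scalar_of_real_lt a b :
  (scalar_of_real a < scalar_of_real b) = (a < b).
Proof.
by rewrite !lt_def scalar_of_real_le (can_eq scalar_of_realK).
Qed.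

Lemma scalar_re_ge0 z : 0 <= z -> 0 <= scalar_re z.
Proof.
by move=> z0; rewrite -scalar_of_real_le scalar_reK// scalar_of_real0.
Qed.

Lemma scalar_re_gt0 z : 0 < z -> 0 < scalar_re z.
Proof.
by move=> z0; rewrite -scalar_of_real_lt scalar_reK ?ltW// scalar_of_real0.
Qed.

Definition rnorm (V : normedModType K) (x : V) : R := scalar_re `|x|.

Section rnorm_theory.
Variable V : normedModType K.
Implicit Types x y : V.

Lemma rnormE x : scalar_of_real (rnorm x) = `|x|.
Proof. exact: scalar_reK. Qed.

Lemma rnorm_ge0 x : 0 <= rnorm x.
Proof. exact: scalar_re_ge0. Qed.

Lemma rnorm_le r x : (rnorm x <= r) = (`|x| <= scalar_of_real r).
Proof. by rewrite -rnormE scalar_of_real_le. Qed.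

Lemma rnorm_lt r x : (rnorm x < r) = (`|x| < scalar_of_real r).
Proof. by rewrite -rnormE scalar_of_real_lt. Qed.

Lemma rnormD x y : rnorm (x + y) <= rnorm x + rnorm y.
Proof.
by rewrite -scalar_of_real_le scalar_of_realD !rnormE ler_normD.
Qed.

Lemma rnormZ (a : K) x : rnorm (a *: x) = scalar_re `|a| * rnorm x.
Proof.
apply: (can_inj scalar_of_realK).
by rewrite scalar_of_realM !rnormE scalar_reK// normrZ.
Qed.

Lemma rnorm0 : rnorm (0 : V) = 0.
Proof.
by apply: (can_inj scalar_of_realK); rewrite rnormE normr0 scalar_of_real0.
Qed.

Lemma rnorm0_eq0 x : rnorm x = 0 -> x = 0.
Proof.
by move=> x0; apply/eqP; rewrite -normr_eq0 -rnormE x0 scalar_of_real0.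
Qed.

Lemma rnormB x y : rnorm (x - y) = rnorm (y - x).
Proof. by rewrite /rnorm distrC. Qed.

Lemma rnorm_dist x y z : rnorm (x - z) <= rnorm (x - y) + rnorm (y - z).
Proof. by rewrite (le_trans _ (rnormD _ _))// addrA subrK. Qed.

Lemma rcvgP (F : set_system V) (FF : Filter F) (y : V) :
  (F --> y) <-> forall e : R, 0 < e -> \forall x \near F, rnorm (y - x) <= e.
Proof.
split=> [/cvgrPdist_le Fy e e0|Fy].
  have e0' : 0 < scalar_of_real e by rewrite -scalar_of_real0 scalar_of_real_lt.
  by have := Fy _ e0'; apply: filterS => x; rewrite -rnorm_le.
apply/cvgrPdist_le => e e0.
have := Fy _ (scalar_re_gt0 e0); apply: filterS => x.
by rewrite rnorm_le scalar_reK; last exact: ltW.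
Qed.

Lemma rcauchyP (F : set_system V) (FF : ProperFilter F) :
  cauchy F <->
  forall e : R, 0 < e -> exists2 A, F A &
    forall x y, A x -> A y -> rnorm (x - y) <= e.
Proof.
rewrite (@cauchyP K V F FF); split=> [Fc e e0|Fc e e0].
  have e20 : 0 < scalar_of_real (e / 2).
    by rewrite -scalar_of_real0 scalar_of_real_lt divr_gt0.
  have [x Fx] := Fc _ e20; exists (ball x (scalar_of_real (e / 2))) => //.
  move=> y z; rewrite -!ball_normE /= => xy xz.
  rewrite (le_trans (rnorm_dist y x z))// (splitr e) lerD//.
    by rewrite rnormB rnorm_le ltW.
  by rewrite rnorm_le ltW.
have [|A FA A2] := Fc (scalar_re e / 2); first by rewrite divr_gt0 ?scalar_re_gt0.
have [x Ax] := filter_ex FA; exists x; apply: filterS FA => y Ay.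
rewrite -ball_normE /= -[ltRHS](scalar_reK (ltW e0)) -rnorm_lt.
by rewrite (le_lt_trans (A2 _ _ Ax Ay))// ltr_pdivrMr// ltr_pMr ?ltr1n// scalar_re_gt0.
Qed.

End rnorm_theory.

(* A space [V] of [W]-valued families whose norm dominates every coordinate is
   complete as soon as coordinatewise limits of Cauchy filters stay in [V] and
   closed balls are closed under coordinatewise limits. *)
Lemma coordinatewise_complete (V : normedModType K) (I : Type)
    (W : completeNormedModType K) (ev : V -> I -> W) :
  (forall i, exists2 M : R, 0 < M &
    forall f g, rnorm (ev f i - ev g i) <= M * rnorm (f - g)) ->
  (forall (F : set_system V) (g : I -> W), ProperFilter F -> cauchy F ->
    (forall i, ev f i @[f --> F] --> g i) -> exists h, ev h = g) ->
  (forall (F : set_system V) (f g : V) (r : R), ProperFilter F ->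
    (forall i, ev f' i @[f' --> F] --> ev g i) ->
    (\forall f' \near F, rnorm (f - f') <= r) -> rnorm (f - g) <= r) ->
  forall F : set_system V, ProperFilter F -> cauchy F -> cvg F.
Proof.
move=> evM evlim evball F FF Fc.
have Fi i : cvg (ev f i @[f --> F]).
  apply/cauchy_cvgP/rcauchyP => e e0; have [M M0 Mi] := evM i.
  have [A FA A2] := (rcauchyP FF).1 Fc _ (divr_gt0 e0 M0).
  exists (ev^~ i @` A); first by apply: (filterS (F := F)) FA => f Af; exists f.
  move=> _ _ [f Af <-] [g Ag <-]; rewrite (le_trans (Mi _ _))//.
  by rewrite mulrC -ler_pdivlMr// A2.
have [h hE] := evlim F (fun i => lim (ev f i @[f --> F])) FF Fc Fi.
apply/cvg_ex; exists h; apply/rcvgP => e e0.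
have [A FA A2] := (rcauchyP FF).1 Fc _ e0.
apply: (filterS _ FA) => f Af; rewrite rnormB.
apply: (evball F) => [i|]; first by rewrite hE; exact: Fi.
by apply: (filterS _ FA) => f1; exact: A2.
Qed.

End Scalars.

(* The scalar field as a one-dimensional Banach space over itself. *)
Definition scalar_line (R : realType) (k : scalar_kind) : Type :=
  (scalar_field R k)^o.

HB.instance Definition _ (R : realType) (k : scalar_kind) :=
  NormedModule.copy (scalar_line R k) (scalar_field R k)^o.

Lemma scalar_line_complete (R : realType) (k : scalar_kind)
  (F : set_system (scalar_line R k)) : ProperFilter F -> cauchy F -> cvg F.
Proof.
move=> FF Fc.
case: k F FF Fc => F FF Fc.
  exact: (@R_complete R F FF Fc).
have normRe (z : R[i]) : `|complex.Re z| <= complex.Re `|z|.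
  case: z => a b /=; rewrite -sqrtr_sqr ler_sqrt ?addr_ge0 ?sqr_ge0//.
  by rewrite lerDl sqr_ge0.
have normIm (z : R[i]) : `|complex.Im z| <= complex.Re `|z|.
  case: z => a b /=; rewrite -sqrtr_sqr ler_sqrt ?addr_ge0 ?sqr_ge0//.
  by rewrite lerDr sqr_ge0.
have normRI (z : R[i]) :
    complex.Re `|z| <= `|complex.Re z| + `|complex.Im z|.
  case: z => a b /=; rewrite -[leRHS]ger0_norm ?addr_ge0//.
  rewrite -sqrtr_sqr ler_sqrt ?sqr_ge0// sqrrD !real_normK ?num_real//.
  by rewrite lerD2r lerDl mulrn_wge0// mulr_ge0.
have cv (p : R[i] -> R) : (forall x y, p (x - y) = p x - p y) ->
    (forall z, `|p z| <= complex.Re `|z|) -> cvg (p z @[z --> F]).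
  move=> pB pn; apply: R_complete; apply: (rcauchyP (k := RealScalars) _).2.
  move=> e e0; have [A FA A2] := (rcauchyP FF).1 Fc _ e0.
  exists (p @` A); first by apply: (filterS (F := F)) FA => f Af; exists f.
  move=> _ _ [f Af <-] [g Ag <-]; rewrite /rnorm /= -pB.
  exact: le_trans (pn _) (A2 _ _ Af Ag).
have ReB (x y : R[i]) : complex.Re (x - y) = complex.Re x - complex.Re y.
  by case: x y => ? ? [].
have ImB (x y : R[i]) : complex.Im (x - y) = complex.Im x - complex.Im y.
  by case: x y => ? ? [].
have /cvg_ex[a Fa] := cv _ ReB normRe.
have /cvg_ex[b Fb] := cv _ ImB normIm.
apply/cvg_ex; exists (Complex a b : scalar_line R ComplexScalars).
apply/rcvgP => e e0; near=> z.
rewrite (le_trans (normRI _))// (splitr e) lerD//.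
- rewrite ReB /=; near: z.
  have /cvgrPdist_le/(_ (e / 2)) := Fa; apply; exact: divr_gt0.
- rewrite ImB /=; near: z.
  have /cvgrPdist_le/(_ (e / 2)) := Fb; apply; exact: divr_gt0.
Unshelve. all: by end_near. Qed.

HB.instance Definition _ (R : realType) (k : scalar_kind) :=
  Uniform_isComplete.Build (scalar_line R k) (@scalar_line_complete R k).

Section BoundedOperators.
Variables (R : realType) (k : scalar_kind).
Local Notation K := (scalar_field R k).

Lemma sup_le_ge0 (A : set R) M : 0 <= M -> ubound A M -> sup A <= M.
Proof.
move=> M0 AM; have [->|/set0P A0] := eqVneq A set0; first by rewrite sup0.
exact: ge_sup.
Qed.

Lemma sup_ge0 (A : set R) : lbound A 0 -> 0 <= sup A.
Proof.
move=> A0; have [[[x Ax] Aub]|/sup_out->//] := pselect (has_sup A).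
by rewrite (le_trans (A0 _ Ax))// ub_le_sup.
Qed.

Lemma normZ_of_le (V : lmodType K) (N : V -> R) :
  (forall f, 0 <= N f) ->
  (forall a f, N (a *: f) <= scalar_re `|a| * N f) ->
  forall a f, N (a *: f) = scalar_re `|a| * N f.
Proof.
move=> N0 NZ a f; apply/le_anti; rewrite NZ /=.
have [->|a0] := eqVneq a 0.
  have -> : scalar_re `|0 : K| = 0.
    by apply: (can_inj (@scalar_of_realK R k)); rewrite scalar_reK// normr0 scalar_of_real0.
  by rewrite mul0r.
have a0' : 0 < scalar_re `|a| by rewrite scalar_re_gt0// normr_gt0.
rewrite -ler_pdivlMl//.
have := NZ a^-1 (a *: f); rewrite scalerK// => /le_trans; apply.
rewrite ler_wpM2r// le_eqVlt; apply/orP; left; apply/eqP.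
apply: (mulfI (lt0r_neq0 a0')); rewrite mulfV ?lt0r_neq0//.
apply: (can_inj (@scalar_of_realK R k)).
rewrite scalar_of_realM !scalar_reK// -normrM mulfV// normr1.
by rewrite scalar_of_real1.
Qed.

Definition closed_unit_ball (X : normedModType K) : set X :=
  [set x | `|x| <= 1].
Arguments closed_unit_ball : clear implicits.

Lemma closed_unit_ballE (X : normedModType K) (x : X) :
  closed_unit_ball _ x <-> rnorm x <= 1.
Proof. by rewrite rnorm_le scalar_of_real1. Qed.

Lemma linear_le_of_ball (X Y : normedModType K) (f : X -> Y) (M : R) :
  0 <= M -> linear f ->
  (forall x, closed_unit_ball _ x -> rnorm (f x) <= M) ->
  forall x, rnorm (f x) <= M * rnorm x.
Proof.
move=> M0 fl fM x; have [->|x0] := eqVneq x 0.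
  have := fl 1 0 0; rewrite scaler0 addr0 scale1r => f0.
  have -> : f 0 = 0 by apply: (addrI (f 0)); rewrite addr0 -f0.
  by rewrite !rnorm0 mulr0.
have nx0 : 0 < rnorm x by rewrite scalar_re_gt0// normr_gt0.
have f0 : f 0 = 0.
  have := fl 1 0 0; rewrite scaler0 addr0 scale1r => f0.
  by apply: (addrI (f 0)); rewrite addr0 -f0.
have fZ a y : f (a *: y) = a *: f y by have := fl a y 0; rewrite f0 !addr0.
have c0 : `|x| != 0 by rewrite normr_eq0.
have := fM (`|x|^-1 *: x); rewrite closed_unit_ballE fZ.
rewrite !rnormZ.
have E : scalar_re `| `|x|^-1 | * rnorm x = 1.
  apply: (can_inj (@scalar_of_realK R k)).
  by rewrite scalar_of_realM rnormE scalar_reK// normfV normr_id mulVf// scalar_of_real1.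
rewrite E => /(_ (lexx _)) H.
have c1 : scalar_re `| `|x|^-1 | = (rnorm x)^-1.
  by apply: (mulIf (lt0r_neq0 nx0)); rewrite E mulVf// lt0r_neq0.
by rewrite c1 mulrC ler_pdivrMr// in H.
Qed.

Definition bounded_linear (X Y : normedModType K) : {pred X -> Y} :=
  mem [set f | linear f /\ continuous f].
Arguments bounded_linear : clear implicits.

Lemma bounded_linearP (X Y : normedModType K) (f : X -> Y) :
  reflect (linear f /\ exists2 M : R, 0 <= M & forall x, rnorm (f x) <= M * rnorm x)
          (f \in bounded_linear X Y).
Proof.
apply: (iffP idP) => [|[fl [M M0 fM]]].
  rewrite inE => -[fl fc]; split => //.
  pose g : {linear X -> Y} := HB.pack f (GRing.isLinear.Build K X Y _ f fl).
  have /linear_boundedP/pinfty_ex_gt0[r r0 rP] := (linear_bounded_continuous g).2 fc.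
  exists (scalar_re r); first by rewrite scalar_re_ge0 ?ltW.
  by move=> x; rewrite rnorm_le scalar_of_realM rnormE (scalar_reK (ltW r0)); exact: (rP x).
rewrite inE; split => // x; apply/rcvgP => e e0.
have fB y z : f (y - z) = f y - f z.
  by have := fl (- 1) z y; rewrite !scaleN1r ![- _ + _]addrC.
have M1 : 0 < M + 1 by rewrite ltr_wpDl.
have /rcvgP/(_ _ (divr_gt0 e0 M1)) : nbhs x --> x by [].
apply: (filterS (F := nbhs x)) => y /=.
rewrite ler_pdivlMr// -fB => H; rewrite (le_trans (fM _))//.
by rewrite (le_trans _ H)// mulrC ler_wpM2l ?rnorm_ge0// lerDl.
Qed.

Record bop (X Y : completeNormedModType K) := Bop {
  bop_fun :> X -> Y;
  bop_subproof : bop_fun \in bounded_linear X Y }.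

Section bop_structure.
Variables X Y : completeNormedModType K.
Implicit Types S T : bop X Y.

HB.instance Definition _ := [isSub of bop X Y for @bop_fun X Y].
HB.instance Definition _ := [Choice of bop X Y by <:].

Lemma bopP (T : bop X Y) : linear T /\ exists2 M : R, 0 <= M &
  forall x, rnorm (T x) <= M * rnorm x.
Proof. exact/bounded_linearP/bop_subproof. Qed.

Lemma bounded_linear_submod_closed : submod_closed (bounded_linear X Y).
Proof.
split=> [|a f g].
  have -> : (0 : X -> Y) = (fun=> 0) by [].
  apply/bounded_linearP; split=> [b x y|]; first by rewrite scaler0 addr0.
  by exists 0 => // x; rewrite mul0r rnorm0.
move=> /bounded_linearP[fl [M M0 fM]] /bounded_linearP[gl [N N0 gN]].
apply/bounded_linearP; split=> [b x y|].
  by rewrite !fctE fl gl !scalerDr !scalerA [b * a]mulrC addrACA.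
exists (scalar_re `|a| * M + N).
  by rewrite addr_ge0// mulr_ge0// scalar_re_ge0.
move=> x; rewrite !fctE (le_trans (rnormD _ _))// mulrDl lerD//.
by rewrite rnormZ -mulrA ler_wpM2l// scalar_re_ge0.
Qed.

HB.instance Definition _ := GRing.isSubmodClosed.Build K (X -> Y)
  (bounded_linear X Y) bounded_linear_submod_closed.
HB.instance Definition _ := [SubChoice_isSubLmodule of bop X Y by <:].

Definition opnorm (T : bop X Y) : R :=
  sup [set rnorm (T x) | x in closed_unit_ball X].

Lemma bopD (S T : bop X Y) x : (S + T) x = S x + T x. Proof. by []. Qed.
Lemma bopZ a (T : bop X Y) x : (a *: T) x = a *: T x. Proof. by []. Qed.
Lemma bop0 x : (0 : bop X Y) x = 0. Proof. by []. Qed.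
Lemma bopB (S T : bop X Y) x : (S - T) x = S x - T x. Proof. by []. Qed.

Lemma bop_ext (S T : bop X Y) : (forall x, S x = T x) -> S = T.
Proof. by move=> ST; apply/val_inj/funext. Qed.

Lemma opnorm_ge0 T : 0 <= opnorm T.
Proof. by apply: sup_ge0 => _ [x _ <-]; exact: rnorm_ge0. Qed.

Lemma opnorm_leP T M : 0 <= M ->
  opnorm T <= M <-> forall x, rnorm (T x) <= M * rnorm x.
Proof.
move=> M0; split=> [TM|TM].
  apply: linear_le_of_ball => //; first by case: (bopP T).
  move=> x xB; rewrite (le_trans _ TM)//; apply: ub_le_sup; last by exists x.
  have [_ [N N0 TN]] := bopP T; exists N => _ [y /closed_unit_ballE yB <-].
  by rewrite (le_trans (TN _))// ler_piMr.
apply: sup_le_ge0 => // _ [x /closed_unit_ballE xB <-].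
by rewrite (le_trans (TM _))// ler_piMr.
Qed.

Lemma opnormP T x : rnorm (T x) <= opnorm T * rnorm x.
Proof. exact: ((opnorm_leP T (opnorm_ge0 T)).1 (lexx _) x). Qed.

Definition bop_norm (T : bop X Y) : K := scalar_of_real k (opnorm T).

Lemma bop_normD S T : bop_norm (S + T) <= bop_norm S + bop_norm T.
Proof.
rewrite -scalar_of_realD scalar_of_real_le.
apply/opnorm_leP => [|x]; first by rewrite addr_ge0// opnorm_ge0.
by rewrite bopD (le_trans (rnormD _ _))// mulrDl lerD// opnormP.
Qed.

Lemma bop_normZ a T : bop_norm (a *: T) = `|a| * bop_norm T.
Proof.
rewrite -(scalar_reK (normr_ge0 a)) -scalar_of_realM; congr scalar_of_real.
apply: (normZ_of_le opnorm_ge0) => {}a {}T.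
apply/opnorm_leP => [|x]; first by rewrite mulr_ge0 ?scalar_re_ge0 ?opnorm_ge0.
by rewrite bopZ rnormZ -mulrA ler_wpM2l ?scalar_re_ge0 ?opnormP.
Qed.

Lemma bop_norm0_eq0 T : bop_norm T = 0 -> T = 0.
Proof.
rewrite -(scalar_of_real0 R k) => /(can_inj (@scalar_of_realK R k)) T0.
apply: bop_ext => x; apply: rnorm0_eq0; apply/le_anti.
by rewrite rnorm_ge0 andbT (le_trans (opnormP _ _))// T0 mul0r.
Qed.

HB.instance Definition _ := Lmodule_isNormed.Build K (bop X Y)
  bop_normD bop_normZ bop_norm0_eq0.

Lemma rnorm_bop (T : bop X Y) : rnorm T = opnorm T.
Proof. exact: scalar_of_realK. Qed.

Lemma bop_complete (F : set_system (bop X Y)) :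
  ProperFilter F -> cauchy F -> cvg F.
Proof.
apply: (coordinatewise_complete (ev := fun (T : bop X Y) x => T x)).
- move=> x; exists (rnorm x + 1); first by rewrite ltr_wpDl ?rnorm_ge0.
  move=> S T; rewrite -bopB rnorm_bop (le_trans (opnormP _ _))// mulrC.
  by rewrite ler_wpM2r ?opnorm_ge0// lerDl.
- move=> {}F g FF Fc Fg.
  have gl : linear g.
    move=> a x y.
    have Fxy : (fun T : bop X Y => a *: T x + T y) @ F --> a *: g x + g y.
      by apply: cvgD (Fg y); apply: cvgZl_tmp (Fg x).
    have E : (fun T : bop X Y => T (a *: x + y)) = (fun T => a *: T x + T y).
      by apply/funext => T; rewrite (bopP _).1.
    rewrite -E in Fxy.
    exact: (cvg_unique (@norm_hausdorff _ Y) (Fg (a *: x + y)) Fxy).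
  have [A FA A1] := (rcauchyP FF).1 Fc 1 ltr01.
  have [T AT] := filter_ex FA.
  have M0 : 0 <= opnorm T + 1 by rewrite addr_ge0 ?opnorm_ge0.
  have gb : g \in bounded_linear X Y.
    apply/bounded_linearP; split => //; exists (opnorm T + 1) => // x.
    apply/ler_addgt0Pr => e e0.
    have /rcvgP/(_ e e0) Fe := Fg x.
    have [S [AS Se]] := filter_ex (filterI (F := F) FA Fe).
    rewrite addrC -[g x](subrK (S x)) (le_trans (rnormD _ _))// lerD//.
    rewrite -[S](subrK T) (le_trans (opnormP _ _))// ler_wpM2r ?rnorm_ge0//.
    rewrite -rnorm_bop (le_trans (rnormD _ _))// addrC !rnorm_bop lerD2l.
    by rewrite -rnorm_bop A1.
  by exists (Bop gb).
- move=> {}F S T r FF FT FS.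
  have r0 : 0 <= r by have [S' /=] := filter_ex FS; apply: le_trans (rnorm_ge0 _).
  rewrite rnorm_bop; apply/opnorm_leP => // x; apply/ler_addgt0Pr => e e0.
  have /rcvgP/(_ e e0) Fe := FT x.
  have [S' [S'e S'S]] := filter_ex (filterI (F := F) Fe FS).
  rewrite bopB (le_trans (rnorm_dist _ (S' x) _))// lerD//; last by rewrite rnormB.
  rewrite -bopB (le_trans (opnormP _ _))// ler_wpM2r ?rnorm_ge0//.
  by rewrite -rnorm_bop.
Qed.

HB.instance Definition _ := Uniform_isComplete.Build (bop X Y) bop_complete.

End bop_structure.
End BoundedOperators.
Arguments closed_unit_ball {R k} X.
Arguments bounded_linear {R k} X Y.

Section SequenceSpaces.
Variables (R : realType) (k : scalar_kind).
Local Notation K := (scalar_field R k).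
Local Notation Kline := (scalar_line R k).

Section linf.
Variable G : Type.

Definition bounded_family : {pred G -> Kline} :=
  mem [set f | exists M : R, forall g, rnorm (f g) <= M].

Record linf := Linf {
  linf_fun :> G -> Kline;
  linf_subproof : linf_fun \in bounded_family }.

HB.instance Definition _ := [isSub of linf for linf_fun].
HB.instance Definition _ := [Choice of linf by <:].

Lemma bounded_familyP (f : G -> Kline) :
  reflect (exists M : R, forall g, rnorm (f g) <= M) (f \in bounded_family).
Proof. by apply: (iffP idP); rewrite inE. Qed.

Lemma bounded_family_submod_closed : submod_closed bounded_family.
Proof.
split=> [|a f g].
  by apply/bounded_familyP; exists 0 => x; rewrite rnorm0.
move=> /bounded_familyP[M fM] /bounded_familyP[N gN].
apply/bounded_familyP; exists (scalar_re `|a| * M + N) => x.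
rewrite (le_trans (rnormD _ _))// lerD// rnormZ ler_wpM2l//.
exact: scalar_re_ge0.
Qed.

HB.instance Definition _ := GRing.isSubmodClosed.Build K (G -> Kline)
  bounded_family bounded_family_submod_closed.
HB.instance Definition _ := [SubChoice_isSubLmodule of linf by <:].

Implicit Types f : linf.

Definition linf_rnorm f : R := sup (range (fun g => rnorm (f g))).

Lemma linf_rnorm_ge0 f : 0 <= linf_rnorm f.
Proof. by apply: sup_ge0 => _ [x _ <-]; exact: rnorm_ge0. Qed.

Lemma linf_rnormP f g : rnorm (f g) <= linf_rnorm f.
Proof.
have /bounded_familyP[M fM] := linf_subproof f.
by apply: ub_le_sup; [exists M => _ [x _ <-] | exists g].
Qed.

Lemma linf_rnorm_le f M :
  0 <= M -> (forall g, rnorm (f g) <= M) -> linf_rnorm f <= M.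
Proof. by move=> M0 fM; apply: sup_le_ge0 => // _ [x _ <-]. Qed.

Definition linf_norm f : K := scalar_of_real k (linf_rnorm f).

Lemma linf_normD f1 f2 : linf_norm (f1 + f2) <= linf_norm f1 + linf_norm f2.
Proof.
rewrite -scalar_of_realD scalar_of_real_le.
apply: linf_rnorm_le => [|g]; first by rewrite addr_ge0 ?linf_rnorm_ge0.
by rewrite (le_trans (rnormD (f1 g) (f2 g)))// lerD ?linf_rnormP.
Qed.

Lemma linf_normZ a f : linf_norm (a *: f) = `|a| * linf_norm f.
Proof.
rewrite -(scalar_reK (normr_ge0 a)) -scalar_of_realM; congr scalar_of_real.
apply: (normZ_of_le linf_rnorm_ge0) => {}a {}f.
apply: linf_rnorm_le => [|g].
  by rewrite mulr_ge0 ?scalar_re_ge0 ?linf_rnorm_ge0.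
by rewrite [leLHS](rnormZ a (f g)) ler_wpM2l ?scalar_re_ge0 ?linf_rnormP.
Qed.

Lemma linf_norm0_eq0 f : linf_norm f = 0 -> f = 0.
Proof.
rewrite -(scalar_of_real0 R k) => /(can_inj (@scalar_of_realK R k)) f0.
apply/val_inj/funext => g; apply: rnorm0_eq0; apply/le_anti.
by rewrite rnorm_ge0 andbT (le_trans (linf_rnormP _ _))// f0.
Qed.

HB.instance Definition _ := Lmodule_isNormed.Build K linf
  linf_normD linf_normZ linf_norm0_eq0.

Lemma rnorm_linf f : rnorm f = linf_rnorm f.
Proof. exact: scalar_of_realK. Qed.

Lemma linf_complete (F : set_system linf) : ProperFilter F -> cauchy F -> cvg F.
Proof.
apply: (coordinatewise_complete (ev := fun (f : linf) g => f g)).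
- move=> g; exists 1 => // f1 f2; rewrite mul1r rnorm_linf.
  exact: (linf_rnormP (f1 - f2)).
- move=> {}F h FF Fc Fh.
  have [A FA A1] := (rcauchyP FF).1 Fc 1 ltr01.
  have [f Af] := filter_ex FA.
  have hb : h \in bounded_family.
    apply/bounded_familyP; exists (linf_rnorm f + 1 + 1) => g.
    have /rcvgP/(_ 1 ltr01) Fe := Fh g.
    have [f' [Af' f'e]] := filter_ex (filterI (F := F) FA Fe).
    rewrite addrC -[h g](subrK (f' g)) (le_trans (rnormD _ _))// lerD//.
    rewrite -[f'](subrK f) (le_trans (linf_rnormP _ _))//.
    rewrite -rnorm_linf (le_trans (rnormD _ _))// addrC !rnorm_linf lerD2l.
    by rewrite -rnorm_linf A1.
  by exists (Linf hb).
- move=> {}F f h r FF Fh Ff.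
  have r0 : 0 <= r by have [f' /=] := filter_ex Ff; apply: le_trans (rnorm_ge0 _).
  rewrite rnorm_linf; apply: linf_rnorm_le => // g; apply/ler_addgt0Pr => e e0.
  have /rcvgP/(_ e e0) Fe := Fh g.
  have [f' [f'e f'f]] := filter_ex (filterI (F := F) Fe Ff).
  rewrite (le_trans (rnorm_dist (f g) (f' g) (h g)))// lerD//; last by rewrite rnormB.
  by rewrite (le_trans (linf_rnormP (f - f') g))// -rnorm_linf.
Qed.

HB.instance Definition _ := Uniform_isComplete.Build linf linf_complete.

End linf.

Section l1.
Variable I : choiceType.

Definition absolutely_summable : {pred I -> Kline} :=
  mem [set f | exists M : R, forall A : {fset I},
    partial_sum (fun i => rnorm (f i)) A <= M].

Record l1 := L1 {
  l1_fun :> I -> Kline;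
  l1_subproof : l1_fun \in absolutely_summable }.

HB.instance Definition _ := [isSub of l1 for l1_fun].
HB.instance Definition _ := [Choice of l1 by <:].

Lemma absolutely_summableP (f : I -> Kline) :
  reflect (exists M : R, forall A : {fset I},
             partial_sum (fun i => rnorm (f i)) A <= M)
          (f \in absolutely_summable).
Proof. by apply: (iffP idP); rewrite inE. Qed.

Lemma partial_sum_rnorm_ge0 (V : normedModType K) (f : I -> V) (A : {fset I}) :
  0 <= partial_sum (fun i => rnorm (f i)) A.
Proof. by apply: sumr_ge0 => i _; exact: rnorm_ge0. Qed.

Lemma partial_sum_rnormD (V : normedModType K) (f g : I -> V) (A : {fset I}) :
  partial_sum (fun i => rnorm (f i + g i)) A <=
  partial_sum (fun i => rnorm (f i)) A + partial_sum (fun i => rnorm (g i)) A.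
Proof. by rewrite -big_split; apply: ler_sum => i _; exact: rnormD. Qed.

Lemma partial_sum_rnormZ (V : normedModType K) a (f : I -> V) (A : {fset I}) :
  partial_sum (fun i => rnorm (a *: f i)) A =
  scalar_re `|a| * partial_sum (fun i => rnorm (f i)) A.
Proof. by rewrite mulr_sumr; apply: eq_bigr => i _; exact: rnormZ. Qed.

Lemma rnorm_le_partial_sum (V : normedModType K) (f : I -> V) i :
  rnorm (f i) = partial_sum (fun i => rnorm (f i)) [fset i]%fset.
Proof. by rewrite /partial_sum -(big_seq_fsetE _ _ xpredT (fun i => rnorm (f i))) big_seq_fset1. Qed.

Lemma absolutely_summable_submod_closed : submod_closed absolutely_summable.
Proof.
split=> [|a f g].
  apply/absolutely_summableP; exists 0 => A.
  by rewrite /partial_sum big1// => i _; rewrite rnorm0.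
move=> /absolutely_summableP[M fM] /absolutely_summableP[N gN].
apply/absolutely_summableP; exists (scalar_re `|a| * M + N) => A.
rewrite (le_trans (partial_sum_rnormD (fun i => a *: f i) g A))// lerD//.
by rewrite partial_sum_rnormZ ler_wpM2l// scalar_re_ge0.
Qed.

HB.instance Definition _ := GRing.isSubmodClosed.Build K (I -> Kline)
  absolutely_summable absolutely_summable_submod_closed.
HB.instance Definition _ := [SubChoice_isSubLmodule of l1 by <:].

Implicit Types f : l1.

Definition l1_rnorm f : R :=
  sup (range (fun A : {fset I} => partial_sum (fun i => rnorm (f i)) A)).

Lemma l1_rnorm_ge0 f : 0 <= l1_rnorm f.
Proof. by apply: sup_ge0 => _ [x _ <-]; exact: partial_sum_rnorm_ge0. Qed.

Lemma l1_rnormP f (A : {fset I}) :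
  partial_sum (fun i => rnorm (f i)) A <= l1_rnorm f.
Proof.
have /absolutely_summableP[M fM] := l1_subproof f.
by apply: ub_le_sup; [exists M => _ [x _ <-] | exists A].
Qed.

Lemma l1_rnorm_le f M :
  (forall A : {fset I}, partial_sum (fun i => rnorm (f i)) A <= M) ->
  l1_rnorm f <= M.
Proof.
move=> fM; apply: sup_le_ge0 => [|_ [x _ <-]//].
by rewrite (le_trans _ (fM fset0))// partial_sum_rnorm_ge0.
Qed.

Definition l1_norm f : K := scalar_of_real k (l1_rnorm f).

Lemma l1_normD f1 f2 : l1_norm (f1 + f2) <= l1_norm f1 + l1_norm f2.
Proof.
rewrite -scalar_of_realD scalar_of_real_le; apply: l1_rnorm_le => A.
by rewrite (le_trans (partial_sum_rnormD f1 f2 A))// lerD ?l1_rnormP.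
Qed.

Lemma l1_normZ a f : l1_norm (a *: f) = `|a| * l1_norm f.
Proof.
rewrite -(scalar_reK (normr_ge0 a)) -scalar_of_realM; congr scalar_of_real.
apply: (normZ_of_le l1_rnorm_ge0) => {}a {}f; apply: l1_rnorm_le => A.
by rewrite [leLHS](partial_sum_rnormZ a f) ler_wpM2l ?scalar_re_ge0 ?l1_rnormP.
Qed.

Lemma rnorm_le_l1_rnorm f i : rnorm (f i) <= l1_rnorm f.
Proof. by rewrite (rnorm_le_partial_sum f) l1_rnormP. Qed.

Lemma l1_norm0_eq0 f : l1_norm f = 0 -> f = 0.
Proof.
rewrite -(scalar_of_real0 R k) => /(can_inj (@scalar_of_realK R k)) f0.
apply/val_inj/funext => i; apply: rnorm0_eq0; apply/le_anti.
by rewrite rnorm_ge0 andbT (le_trans (rnorm_le_l1_rnorm _ _))// f0.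
Qed.

HB.instance Definition _ := Lmodule_isNormed.Build K l1
  l1_normD l1_normZ l1_norm0_eq0.

Lemma rnorm_l1 f : rnorm f = l1_rnorm f.
Proof. exact: scalar_of_realK. Qed.

Lemma l1_partial_sum_lim (F : set_system l1) (h : I -> Kline) (A : {fset I}) :
  ProperFilter F -> (forall i, (f' : l1) i @[f' --> F] --> h i) ->
  forall e : R, 0 < e ->
  \forall f' \near F,
    partial_sum (fun i => rnorm ((f' : l1) i - h i)) A <= e.
Proof.
move=> FF Fh e e0.
pose N : R := (#|` A|).+1%:R.
have N0 : 0 < N by [].
have : \forall f' \near F, forall i : A, rnorm ((f' : l1) (val i) - h (val i)) <= e / N.
  apply: filter_forall => i.
  by have /rcvgP/(_ _ (divr_gt0 e0 N0)) := Fh (val i); apply: (filterS (F := F)) => f'; rewrite /= rnormB.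
apply: filterS => f' f'e; rewrite /partial_sum.
rewrite (le_trans (ler_sum _ (fun i _ => f'e i)))// sumr_const -cardfE.
by rewrite -mulr_natr mulrAC ler_pdivrMr// ler_pM2l// ler_nat.
Qed.

Lemma l1_complete (F : set_system l1) : ProperFilter F -> cauchy F -> cvg F.
Proof.
apply: (coordinatewise_complete (ev := fun (f : l1) i => f i)).
- move=> i; exists 1 => // f1 f2; rewrite mul1r rnorm_l1.
  exact: (rnorm_le_l1_rnorm (f1 - f2)).
- move=> {}F h FF Fc Fh.
  have [A FA A1] := (rcauchyP FF).1 Fc 1 ltr01.
  have [f Af] := filter_ex FA.
  have hb : h \in absolutely_summable.
    apply/absolutely_summableP; exists (1 + (1 + l1_rnorm f)) => B.
    have [f' [Af' f'e]] := filter_ex (filterI FA (l1_partial_sum_lim B FF Fh ltr01)).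
    have -> : h = (fun i => (h i - f' i) + ((f' i - f i) + f i)).
      by apply/funext => i; rewrite !subrK.
    rewrite (le_trans (partial_sum_rnormD _ _ _))// lerD//.
      by under [leLHS]eq_bigr do rewrite rnormB.
    rewrite (le_trans (partial_sum_rnormD _ _ _))// lerD ?l1_rnormP//.
    by rewrite (le_trans (l1_rnormP (f' - f) B))// -rnorm_l1 A1.
  by exists (L1 hb).
- move=> {}F f h r FF Fh Ff.
  rewrite rnorm_l1; apply: l1_rnorm_le => B; apply/ler_addgt0Pr => e e0.
  have [f' [f'e f'f]] := filter_ex (filterI (l1_partial_sum_lim B FF Fh e0) Ff).
  have -> : (f - h : l1) = (fun i => (f i - f' i) + (f' i - h i)) :> (I -> Kline).
    by apply/funext => i; rewrite addrA subrK.
  rewrite (le_trans (partial_sum_rnormD _ _ _))// lerD//.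
  by rewrite (le_trans (l1_rnormP (f - f') B))// -rnorm_l1.
Qed.

HB.instance Definition _ := Uniform_isComplete.Build l1 l1_complete.

End l1.
End SequenceSpaces.

Notation dual X := (bop X (scalar_line _ _)).

Section OperatorConstructions.
Variables (R : realType) (k : scalar_kind).
Local Notation K := (scalar_field R k).
Local Notation Kline := (scalar_line R k).
Local Notation banach := (completeNormedModType K).

Lemma bop_id_subproof (X : banach) : id \in bounded_linear X X.
Proof.
apply/bounded_linearP; split=> //.
by exists 1 => // x; rewrite mul1r.
Qed.
Definition bop_id X := Bop (bop_id_subproof X).

Lemma bop_comp_subproof (X Y Z : banach) (S : bop Y Z) (T : bop X Y) :
  S \o T \in bounded_linear X Z.
Proof.
have [[Sl [M M0 SM]] [Tl [N N0 TN]]] := (bopP S, bopP T).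
apply/bounded_linearP; split=> [a x y|]; first by rewrite /= Tl Sl.
exists (M * N); first exact: mulr_ge0.
move=> x; apply: le_trans (SM (T x)) _; rewrite -mulrA.
exact: ler_wpM2l.
Qed.
Definition bop_comp (X Y Z : banach) (S : bop Y Z) (T : bop X Y) : bop X Z :=
  Bop (bop_comp_subproof S T).
Local Notation "S \bo T" := (bop_comp S T) (at level 40, left associativity).

Lemma adjoint_subproof (X Y : banach) (T : bop X Y) :
  (fun f : dual Y => f \bo T) \in bounded_linear (dual Y) (dual X).
Proof.
apply/bounded_linearP; split=> [a f g|]; first exact: bop_ext.
exists (opnorm T); first exact: opnorm_ge0.
move=> f; rewrite !rnorm_bop; apply/opnorm_leP => [|x].
  by rewrite mulr_ge0 ?opnorm_ge0.
apply: le_trans (opnormP f (T x)) _; rewrite [opnorm T * _]mulrC -mulrA.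
by apply: ler_wpM2l (opnormP T x); exact: opnorm_ge0.
Qed.
Definition adjoint (X Y : banach) (T : bop X Y) : bop (dual Y) (dual X) :=
  Bop (adjoint_subproof T).

Lemma linf_embedding_bounded (Y : banach) (y : Y) :
  (fun g : closed_unit_ball (dual Y) => (\val g : dual Y) y)
    \in @bounded_family R k (closed_unit_ball (dual Y)).
Proof.
apply/bounded_familyP; exists (rnorm y) => g.
have /closed_unit_ballE := set_valP g; rewrite rnorm_bop => g1.
by rewrite (le_trans (opnormP _ _))// ler_piMl ?rnorm_ge0.
Qed.

Lemma linf_embedding_subproof (Y : banach) :
  (fun y : Y => Linf (linf_embedding_bounded y))
    \in bounded_linear Y (linf R k (closed_unit_ball (dual Y))).
Proof.
apply/bounded_linearP; split=> [a x y|].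
  by apply/val_inj/funext => g /=; rewrite (bopP (\val g)).1.
exists 1 => // y; rewrite mul1r rnorm_linf; apply: linf_rnorm_le => [|g].
  exact: rnorm_ge0.
have /closed_unit_ballE := set_valP g; rewrite rnorm_bop => g1.
by rewrite (le_trans (opnormP _ _))// ler_piMl ?rnorm_ge0.
Qed.
Definition linf_embedding (Y : banach) :
    bop Y (linf R k (closed_unit_ball (dual Y))) :=
  Bop (linf_embedding_subproof Y).

Section UnorderedSums.
Variables (I : choiceType) (X : banach).

Lemma partial_sum_fset (V : zmodType) (x : I -> V) (A : {fset I}) :
  partial_sum x A = \sum_(i <- A) x i.
Proof. by rewrite /partial_sum -(big_seq_fsetE _ _ xpredT x). Qed.

Lemma partial_sum_split (V : zmodType) (x : I -> V) (A B : {fset I}) :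
  (A `<=` B)%fset ->
  partial_sum x B = partial_sum x A + partial_sum x (B `\` A)%fset.
Proof.
move=> AB; rewrite !partial_sum_fset (big_fsetID _ (mem A)) /=.
congr (_ + _); apply: eq_fbigl => i; rewrite !inE /=.
  by rewrite -in_fsetI (fsetIidPr AB).
by rewrite andbC.
Qed.

Lemma rnorm_partial_sum (x : I -> X) (A : {fset I}) :
  rnorm (partial_sum x A) <= partial_sum (fun i => rnorm (x i)) A.
Proof.
rewrite !partial_sum_fset; apply: (big_ind2 (fun a b => rnorm a <= b)) => //.
  by rewrite rnorm0.
by move=> a1 b1 a2 b2 h1 h2; rewrite (le_trans (rnormD _ _))// lerD.
Qed.

Lemma absolute_sum (x : I -> X) (M : R) :
  (forall A : {fset I}, partial_sum (fun i => rnorm (x i)) A <= M) ->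
  cvg (partial_sum x @ totally) /\ rnorm (sum x) <= M.
Proof.
move=> xM; pose p A := partial_sum (fun i => rnorm (x i)) A.
have FF : ProperFilter (@totally I) := totally_filter.
have cx : cvg (partial_sum x @ totally).
  apply/cauchy_cvgP/rcauchyP => e e0.
  have hs : has_sup (range p).
    by split; [exists (p fset0), fset0 | exists M => _ [A _ <-]; exact: xM].
  have [_ [A _ <-] Ae] := sup_adherent (divr_gt0 e0 (ltr0Sn R 1)) hs.
  exists (partial_sum x @` [set B | (A `<=` B)%fset]).
    by exists A => // B AB; exists B.
  have H B : (A `<=` B)%fset -> rnorm (partial_sum x B - partial_sum x A) <= e / 2.
    move=> AB; rewrite (partial_sum_split _ AB) addrC addKr.
    rewrite (le_trans (rnorm_partial_sum _ _))//.
    have : p B <= sup (range p) by apply: ub_le_sup; [exact: hs.2 | exists B].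
    rewrite /p (partial_sum_split _ AB) => pB.
    rewrite -(lerD2l (p A)) (le_trans pB)// ltW//.
    by rewrite -ltrBlDr.
  move=> _ _ [B AB <-] [C AC <-].
  rewrite (le_trans (rnorm_dist _ (partial_sum x A) _))// (splitr e) lerD ?H//.
  by rewrite rnormB H.
split=> //; apply/ler_addgt0Pr => e e0.
have /rcvgP/(_ e e0) Fe := cx.
have [A [/= Ae _]] := filter_ex (filterI (F := totally) Fe filterT).
rewrite addrC -[sum x](subrK (partial_sum x A)) (le_trans (rnormD _ _))//.
by apply: lerD => //; exact: le_trans (rnorm_partial_sum _ _) (xM A).
Qed.

End UnorderedSums.

Section l1_quotient.
Variable X : banach.
Local Notation B := (closed_unit_ball X).

Definition l1_sum (f : l1 R k B) : X := sum (fun b : B => (f b : K) *: \val b).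

Lemma l1_sum_bound (f : l1 R k B) (A : {fset B}) :
  partial_sum (fun b : B => rnorm ((f b : K) *: (\val b : X))) A <= l1_rnorm f.
Proof.
apply: le_trans (l1_rnormP f A); apply: ler_sum => b _.
rewrite rnormZ ler_piMr ?rnorm_ge0//.
by have /closed_unit_ballE := set_valP (val b).
Qed.

Lemma l1_sum_subproof : l1_sum \in bounded_linear (l1 R k B) X.
Proof.
apply/bounded_linearP; split=> [a f g|].
  have [cf _] := absolute_sum (l1_sum_bound f).
  have [cg _] := absolute_sum (l1_sum_bound g).
  have Ffg : a *: partial_sum (fun b : B => (f b : K) *: (\val b : X)) A
      + partial_sum (fun b : B => (g b : K) *: (\val b : X)) A @[A --> totally]
      --> a *: l1_sum f + l1_sum g.
    have FF : ProperFilter (@totally B) := totally_filter.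
    by apply: cvgD; [apply: cvgZl_tmp; exact: cf | exact: cg].
  have E : partial_sum (fun b : B => ((a *: f + g : l1 R k B) b : K) *: (\val b : X)) =
      (fun A => a *: partial_sum (fun b : B => (f b : K) *: (\val b : X)) A +
         partial_sum (fun b : B => (g b : K) *: (\val b : X)) A).
    apply/funext => A; rewrite /partial_sum scaler_sumr -big_split /=.
    by apply: eq_bigr => b _; rewrite scalerA -scalerDl.
  rewrite -E in Ffg.
  have FF : ProperFilter (@totally B) := totally_filter.
  exact: (cvg_lim (@norm_hausdorff _ X) Ffg).
exists 1 => // f; rewrite mul1r rnorm_l1.
by have [] := absolute_sum (l1_sum_bound f).
Qed.

Definition l1_quotient : bop (l1 R k B) X := Bop l1_sum_subproof.

End l1_quotient.
End OperatorConstructions.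

Notation "S \bo T" := (bop_comp S T) (at level 40, left associativity).

Section OperatorIdeals.
Variables (R : realType) (k : scalar_kind).
Local Notation K := (scalar_field R k).
Local Notation Kline := (scalar_line R k).
Local Notation banach := (completeNormedModType K).

Definition operator_class := forall X Y : banach, set (bop X Y).

Definition finite_rank : operator_class := fun X Y =>
  [set T | exists (n : nat) (v : 'I_n -> Y),
     forall x, exists c : 'I_n -> K, T x = \sum_(i < n) c i *: v i].
Arguments finite_rank : clear implicits.

Definition approximable : operator_class := fun X Y =>
  closure (finite_rank X Y).
Arguments approximable : clear implicits.

Definition compact_operator : operator_class := fun X Y =>
  [set T | precompact (T @` closed_unit_ball X)].
Arguments compact_operator : clear implicits.

Definition class_comp (A1 A2 : operator_class) : operator_class := fun X Y =>
  [set T | exists (Z : banach) (U : bop Z Y) (V : bop X Z),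
     [/\ A1 Z Y U, A2 X Z V & T = U \bo V]].
Arguments class_comp : clear implicits.

Definition class_min (A : operator_class) : operator_class :=
  class_comp approximable (class_comp A approximable).
Arguments class_min : clear implicits.

Definition class_dual (A : operator_class) : operator_class := fun X Y =>
  [set T | A (dual Y) (dual X) (adjoint T)].
Arguments class_dual : clear implicits.

Definition class_inj (A : operator_class) : operator_class := fun X Y =>
  [set T | A X (linf R k (closed_unit_ball (dual Y))) (linf_embedding Y \bo T)].
Arguments class_inj : clear implicits.

Definition class_sur (A : operator_class) : operator_class := fun X Y =>
  [set T | A (l1 R k (closed_unit_ball X)) Y (T \bo l1_quotient X)].
Arguments class_sur : clear implicits.

(* [ideal_norm] is a total function whose values outside [ideal_class] are
   unconstrained and never used. Positive homogeneity and definiteness follow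
   from the other axioms. *)
Record operator_ideal := OperatorIdeal {
  ideal_class :> operator_class;
  ideal_norm : forall X Y : banach, bop X Y -> R;
  ideal_id : ideal_class (bop_id Kline);
  idealD : forall (X Y : banach) (S T : bop X Y),
    ideal_class S -> ideal_class T -> ideal_class (S + T);
  idealM : forall (W X Y Z : banach) (U : bop Y Z) (T : bop X Y) (V : bop W X),
    ideal_class T -> ideal_class (U \bo T \bo V);
  ideal_norm_ge0 : forall (X Y : banach) (T : bop X Y),
    ideal_class T -> 0 <= ideal_norm T;
  ideal_norm_id : ideal_norm (bop_id Kline) = 1;
  ideal_normD : exists2 kappa : R, 1 <= kappa &
    forall (X Y : banach) (S T : bop X Y), ideal_class S -> ideal_class T ->
      ideal_norm (S + T) <= kappa * (ideal_norm S + ideal_norm T);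
  ideal_normM : forall (W X Y Z : banach)
      (U : bop Y Z) (T : bop X Y) (V : bop W X), ideal_class T ->
    ideal_norm (U \bo T \bo V) <= opnorm U * ideal_norm T * opnorm V;
  ideal_complete : forall (X Y : banach) (T_ : nat -> bop X Y),
    (forall n, ideal_class (T_ n)) ->
    (forall e : R, 0 < e -> exists N, forall m n, (N <= m)%N -> (N <= n)%N ->
       ideal_norm (T_ m - T_ n) < e) ->
    exists2 T : bop X Y, ideal_class T &
      forall e : R, 0 < e -> exists N, forall n, (N <= n)%N ->
        ideal_norm (T_ n - T) < e
}.

Definition injective_ideal (A : operator_ideal) : Prop :=
  forall X Y : banach, class_inj A X Y = ideal_class A (X := X) (Y := Y).

Definition linf_extension_property (A : operator_ideal) : Prop :=
  forall (X : banach) (G : Type) (T : bop X (linf R k G)),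
    ideal_class A T ->
    exists T' : bop (linf R k (closed_unit_ball (dual X))) (linf R k G),
      [/\ ideal_class A T', T = T' \bo linf_embedding X &
          ideal_norm A T' = ideal_norm A T].

Definition comp_compact_norm (A : operator_ideal) (X Y : banach)
    (T : bop X Y) : R :=
  inf [set r | exists (Z : banach) (T1 : bop Z Y) (T2 : bop X Z),
         [/\ ideal_class A T1, compact_operator X Z T2, T = T1 \bo T2 &
             r = ideal_norm A T1 * opnorm T2]].

(* A subspace of [E] with its own complete norm is given by a Banach space [Z]
   together with the injective linear inclusion map [i]. *)
Definition admissible (E : banach) (C : set E) (Z : banach) (i : bop Z E) :=
  [/\ injective i, compact_operator Z E i, C `<=` i @` closed_unit_ball Z &
      forall (g : dual Z) (e : R), 0 < e -> exists f : dual E,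
        forall z, closed_unit_ball Z z -> rnorm (f (i z) - g z) < e].

Definition lambda_seminorm (A : operator_ideal) (E G : banach) (C : set E)
    (T : bop E G) : R :=
  inf [set r | exists (Z : banach) (i : bop Z E),
         admissible C i /\ r = comp_compact_norm A (T \bo i)].

(* Neighbourhoods of [T] in [A(E, G)] for the topology lambda_A. *)
Definition lambda_nbhs (A : operator_ideal) (E G : banach) (T : bop E G) :
    set_system (bop E G) :=
  filter_from
    [set p : seq (set E) * R | {in p.1, forall C, compact C} /\ 0 < p.2]
    (fun p => [set S | ideal_class A S /\
       {in p.1, forall C, lambda_seminorm A C (S - T) < p.2}]).

Definition approximation_property (A : operator_ideal) (X : banach) : Prop :=
  forall (Y : banach) (T : bop Y X), ideal_class A T ->
    forall U, lambda_nbhs A T U -> finite_rank Y X `&` U !=set0.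

End OperatorIdeals.

Arguments finite_rank {R k} X Y.
Arguments approximable {R k} X Y.
Arguments compact_operator {R k} X Y.
Arguments class_comp {R k} A1 A2 X Y.
Arguments class_min {R k} A X Y.
Arguments class_dual {R k} A X Y.
Arguments class_inj {R k} A X Y.
Arguments class_sur {R k} A X Y.

(* Main.v *)
Require Import Defs.
From HB Require Import structures.
From mathcomp Require Import all_boot all_order all_algebra finmap.
From mathcomp Require Import complex.
From mathcomp Require Import all_classical all_reals.
From mathcomp Require Import topology normedtype sequences summability.
From mathcomp Require Import ring lra.
Set Implicit Arguments.
Unset Strict Implicit.
Unset Printing Implicit Defensive.
Import Order.TTheory GRing.Theory Num.Theory.
Import numFieldNormedType.Exports.
Local Open Scope classical_set_scope.
Local Open Scope ring_scope.

(** Let [T : Y -> X] be such that [i_X T] lies in the minimal kernel of [A].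
    Then [T = S W] with [S] in [A] (injectivity) and [W] compact, and the
    approximation property applied to [S] makes [T] a limit of finite rank
    operators in the composition norm of [A o K]. The factors in [A] of the
    errors extend to operators between spaces of bounded families, in which
    compact operators are approximable and finite dimensional subspaces are
    fixed by finite rank operators of norm at most [2]; hence every increment
    factors through some finite dimensional [linf] space, with control of the
    ideal norm of one factor and of the norm of the other. Stacking these
    factorizations side by side exhibits [T] as approximable o [A] o
    approximable.

    Conversely, if [i : Z -> Y] is the inclusion of an admissible space and [T]
    is in [A], then [i_X T i] is the composition of an operator of [A] between
    spaces of bounded families with a compact operator, so it always lies in the
    minimal kernel. When the hull adds nothing, [T i] itself lies in the minimal
    kernel; approximating its last factor by finite rank operators, and the
    functionals on [Z] by functionals on [Y], gives the approximation property.

    Part (b) is the same argument for adjoints. The density condition in the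
    definition of admissible spaces guarantees that all functionals on [Y*]
    occurring in the factorizations are evaluations at points of [Y], so that
    everything can be transposed back, with quotients of [l1] sums in place of
    subspaces of [linf] sums. *)

(** * Bounded operators *)

(** The minimal kernel asks for one factorization, while a limit in the composition norm only
    provides a series of increments. The obstacle to stacking their factorizations is the outer
    factor: the finite rank maps that bring an increment back from a space of bounded families to
    [X] have no common norm bound. Each of them is isometric on the vectors that it recovers
    exactly, so the stacked middle operator is restricted to the subspaces of such vectors, and
    injectivity keeps the restriction in the ideal. Transposed, the subspaces become quotients, and
    injectivity is applied to an adjoint that is bounded below.

    The three factors need different kinds of smallness. The middle series has to converge for a
    quasi-norm with constant [kappa], which the powers of [(2 * kappa)^-1] ensure; the outer series
    only need geometric operator norms. A composition norm bounds a product, so scaling can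
    distribute its smallness over the two factors at will.

    The space [linf nat] contains all finite dimensional [linf] spaces as its first coordinates, so
    factorizations through different dimensions can be added and stacked without changing the
    type. *)

Section BoundedOperatorTheory.
Variables (R : realType) (k : scalar_kind).
Local Notation K := (scalar_field R k).
Local Notation Kline := (scalar_line R k).
Local Notation banach := (completeNormedModType K).
Local Notation sre := (@scalar_re R k).
Local Notation sor := (@scalar_of_real R k).
Implicit Types X Y Z : banach.

Lemma rnorm_eq0 (V : normedModType K) (x : V) : (rnorm x == 0) = (x == 0).
Proof.
by apply/eqP/eqP => [/rnorm0_eq0|->] //; rewrite rnorm0.
Qed.

Lemma rnorm_gt0 (V : normedModType K) (x : V) : (0 < rnorm x) = (x != 0).
Proof. by rewrite lt_def rnorm_eq0 rnorm_ge0 andbT. Qed.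

Lemma rnormN (V : normedModType K) (x : V) : rnorm (- x) = rnorm x.
Proof. by rewrite /rnorm normrN. Qed.

Lemma rnorm_sum (V : normedModType K) (I : Type) (r : seq I) (P : pred I) (f : I -> V) :
  rnorm (\sum_(i <- r | P i) f i) <= \sum_(i <- r | P i) rnorm (f i).
Proof.
elim/big_ind2: _ => [|x1 x2 y1 y2 h1 h2|//]; first by rewrite rnorm0.
by rewrite (le_trans (rnormD _ _))// lerD.
Qed.

Lemma scalar_re_normM (a b : K) : sre `|a * b| = sre `|a| * sre `|b|.
Proof. exact: (rnormZ (V := K^o) a b). Qed.

Lemma rnorm_line (a : Kline) : rnorm a = sre `|a : K|.
Proof. by []. Qed.

Lemma rnorm_scale (V : normedModType K) (a : Kline) (x : V) :
  rnorm ((a : K) *: x) = rnorm a * rnorm x.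
Proof. exact: rnormZ. Qed.

Lemma norm_sor (r : R) : 0 <= r -> `|sor r| = sor r.
Proof. by move=> r0; rewrite ger0_norm// -scalar_of_real0 scalar_of_real_le. Qed.

Lemma sorN (r : R) : sor (- r) = - sor r.
Proof. by apply/eqP; rewrite -addr_eq0 -scalar_of_realD addNr scalar_of_real0. Qed.

Lemma sre_norm_sor (r : R) : sre `|sor r| = `|r|.
Proof.
have [r0|/ltW r0] := leP 0 r; first by rewrite norm_sor// scalar_of_realK ger0_norm.
rewrite -normrN -sorN norm_sor ?oppr_ge0// scalar_of_realK ler0_norm//.
Qed.

Lemma rnormZr (V : normedModType K) (r : R) (x : V) : rnorm (sor r *: x) = `|r| * rnorm x.
Proof. by rewrite rnormZ sre_norm_sor. Qed.

Lemma sre_norm_eq0 (a : K) : (sre `|a| == 0) = (a == 0).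
Proof. exact: (rnorm_eq0 (V := K^o)). Qed.

Lemma sre_normV (a : K) : sre `|a^-1| = (sre `|a|)^-1.
Proof.
have [->|a0] := eqVneq a 0.
  by rewrite invr0 (_ : sre _ = 0) ?invr0//; apply/eqP; rewrite sre_norm_eq0.
have b0 : sre `|a| != 0 by rewrite sre_norm_eq0.
apply: (mulfI b0); rewrite -scalar_re_normM mulfV// mulfV//.
by rewrite normr1 -(scalar_of_real1 R k) scalar_of_realK.
Qed.

Section linear.
Variables X Y : banach.
Implicit Types T : bop X Y.

Lemma bop0r T : T 0 = 0.
Proof.
have := (bopP T).1 1 0 0; rewrite scaler0 addr0 scale1r => h.
by apply: (addrI (T 0)); rewrite addr0 -h.
Qed.
Lemma bopDr T x y : T (x + y) = T x + T y.
Proof. by have := (bopP T).1 1 x y; rewrite !scale1r. Qed.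
Lemma bopZr T a x : T (a *: x) = a *: T x.
Proof. by have := (bopP T).1 a x 0; rewrite bop0r !addr0. Qed.
Lemma bopNr T x : T (- x) = - T x.
Proof. by rewrite -scaleN1r bopZr scaleN1r. Qed.
Lemma bopBr T x y : T (x - y) = T x - T y.
Proof. by rewrite bopDr bopNr. Qed.
Lemma bop_sumr T (I : Type) (r : seq I) (P : pred I) (f : I -> X) :
  T (\sum_(i <- r | P i) f i) = \sum_(i <- r | P i) T (f i).
Proof. by elim/big_ind2: _ => [|x1 x2 y1 y2 <- <-|//]; rewrite ?bop0r ?bopDr. Qed.
Lemma bopNl T x : (- T) x = - T x. Proof. by []. Qed.
Lemma bop_suml (I : Type) (r : seq I) (P : pred I) (f : I -> bop X Y) x :
  (\sum_(i <- r | P i) f i) x = \sum_(i <- r | P i) f i x.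
Proof. by elim/big_ind2: _ => [|x1 x2 y1 y2 <- <-|//]. Qed.

Lemma opnorm_le T M : 0 <= M -> (forall x, rnorm (T x) <= M * rnorm x) -> opnorm T <= M.
Proof. by move=> M0 h; apply/opnorm_leP. Qed.

Lemma rnorm_bop_le T M x : opnorm T <= M -> rnorm (T x) <= M * rnorm x.
Proof.
by move=> TM; rewrite (le_trans (opnormP _ _))// ler_wpM2r// rnorm_ge0.
Qed.

Lemma bop_exists (f : X -> Y) M : linear f -> 0 <= M ->
  (forall x, rnorm (f x) <= M * rnorm x) ->
  exists2 T : bop X Y, (forall x, T x = f x) & opnorm T <= M.
Proof.
move=> fl M0 fM; have fb : f \in bounded_linear X Y.
  by apply/bounded_linearP; split => //; exists M.
by exists (Bop fb) => //; apply: opnorm_le.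
Qed.

Lemma opnorm0 : opnorm (0 : bop X Y) = 0.
Proof. by rewrite -rnorm_bop rnorm0. Qed.
Lemma opnormN T : opnorm (- T) = opnorm T.
Proof. by rewrite -!rnorm_bop rnormN. Qed.
Lemma opnormD S T : opnorm (S + T : bop X Y) <= opnorm S + opnorm T.
Proof. by rewrite -!rnorm_bop rnormD. Qed.
Lemma opnormZ a T : opnorm (a *: T) = sre `|a| * opnorm T.
Proof. by rewrite -!rnorm_bop rnormZ. Qed.
End linear.

Lemma bop_compE X Y Z (S : bop Y Z) (T : bop X Y) x : (S \bo T) x = S (T x).
Proof. by []. Qed.
Lemma bop_idE X x : bop_id X x = x. Proof. by []. Qed.
Lemma bop_compA W X Y Z (U : bop Y Z) (S : bop X Y) (T : bop W X) :
  U \bo (S \bo T) = U \bo S \bo T.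
Proof. exact: bop_ext. Qed.
Lemma bop_comp1l X Y (T : bop X Y) : bop_id Y \bo T = T.
Proof. exact: bop_ext. Qed.
Lemma bop_comp1r X Y (T : bop X Y) : T \bo bop_id X = T.
Proof. exact: bop_ext. Qed.
Lemma bop_compDr X Y Z (S : bop Y Z) (T U : bop X Y) : S \bo (T + U) = S \bo T + S \bo U.
Proof. by apply: bop_ext => x; rewrite bop_compE !bopD bopDr. Qed.
Lemma bop_compDl X Y Z (S U : bop Y Z) (T : bop X Y) : (S + U) \bo T = S \bo T + U \bo T.
Proof. exact: bop_ext. Qed.
Lemma bop_compNr X Y Z (S : bop Y Z) (T : bop X Y) : S \bo (- T) = - (S \bo T).
Proof. by apply: bop_ext => x; rewrite bop_compE !bopNl bopNr. Qed.
Lemma bop_compBr X Y Z (S : bop Y Z) (T U : bop X Y) : S \bo (T - U) = S \bo T - S \bo U.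
Proof. by rewrite bop_compDr bop_compNr. Qed.
Lemma bop_compBl X Y Z (S U : bop Y Z) (T : bop X Y) : (S - U) \bo T = S \bo T - U \bo T.
Proof. exact: bop_ext. Qed.
Lemma bop_compZr X Y Z (S : bop Y Z) a (T : bop X Y) : S \bo (a *: T) = a *: (S \bo T).
Proof. by apply: bop_ext => x; rewrite bop_compE !bopZ bopZr. Qed.
Lemma bop_compZl X Y Z (S : bop Y Z) a (T : bop X Y) : (a *: S) \bo T = a *: (S \bo T).
Proof. exact: bop_ext. Qed.

Lemma opnorm_comp X Y Z (S : bop Y Z) (T : bop X Y) : opnorm (S \bo T) <= opnorm S * opnorm T.
Proof.
apply: opnorm_le => [|x]; first by rewrite mulr_ge0 ?opnorm_ge0.
by rewrite (le_trans (opnormP S _))// -mulrA ler_wpM2l ?opnorm_ge0 ?opnormP.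
Qed.

Lemma opnorm_id X : opnorm (bop_id X) <= 1.
Proof. by apply: opnorm_le => // x; rewrite mul1r. Qed.

Lemma rank1_subproof X Y (f : dual X) (y : Y) :
  (fun x => (f x : K) *: y) \in bounded_linear X Y.
Proof.
apply/bounded_linearP; split=> [a u v|].
  by rewrite (bopP f).1 scalerDl -scalerA.
exists (opnorm f * rnorm y) => [|x]; first by rewrite mulr_ge0 ?opnorm_ge0 ?rnorm_ge0.
by rewrite rnorm_scale mulrAC ler_wpM2r ?rnorm_ge0 ?opnormP.
Qed.
Definition rank1 X Y (f : dual X) (y : Y) : bop X Y := Bop (rank1_subproof f y).
Lemma rank1E X Y (f : dual X) (y : Y) x : rank1 f y x = (f x : K) *: y.
Proof. by []. Qed.

Lemma line_map Y (y : Y) : exists2 j : bop Kline Y,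
  (forall c, j c = (c : K) *: y) & opnorm j <= rnorm y.
Proof.
apply: bop_exists; [by move=> a c d; rewrite scalerDl -scalerA | exact: rnorm_ge0|].
by move=> c; rewrite rnorm_scale mulrC.
Qed.

End BoundedOperatorTheory.

(** * The Hahn-Banach theorem *)

Section HahnBanach.
Variables (R : realType) (k : scalar_kind).
Local Notation K := (scalar_field R k).
Local Notation sor := (@scalar_of_real R k).

Section RealHahnBanach.
Variables (X : normedModType K) (M : R).
Hypothesis M0 : 0 <= M.

(** Partial functionals are kept as graphs, so that the union of a chain is again of the same kind.
    Single-valuedness is not part of the definition: for a linear dominated graph it follows from
    the bound at the vector 0. *)
Definition real_linear_graph (G : set (X * R)) := forall p q r,
  G p -> G q -> G (sor r *: p.1 + q.1, r * p.2 + q.2).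
Definition dominated (G : set (X * R)) := forall p, G p -> p.2 <= M * rnorm p.1.

(** By the triangle inequality every [q.2 - M * rnorm (q.1 - x0)] lies below every
    [M * rnorm (q.1 + x0) - q.2]; any number separating the two families is an admissible value at
    [x0], and [c] is the supremum of the first. *)
Lemma graph_extend (G : set (X * R)) (x0 : X) :
  real_linear_graph G -> dominated G -> G !=set0 ->
  exists c : R, let G' := [set p | exists q r, G q /\ p = (q.1 + sor r *: x0, q.2 + r * c)] in
    real_linear_graph G' /\ dominated G'.
Proof.
move=> Gl Gd [g0 Gg0].
have GB p q : G p -> G q -> G (q.1 - p.1, q.2 - p.2).
  move=> Gp Gq; have := Gl p q (-1) Gp Gq.
  by rewrite sorN scalar_of_real1 scaleN1r mulN1r ![- _ + _]addrC.
have GZ p r : G p -> G (sor r *: p.1, r * p.2).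
  move=> Gp; have := Gl p (0, 0) r Gp.
  by rewrite /= !addr0; apply; have := GB _ _ Gp Gp; rewrite !subrr.
pose S := [set s | exists2 q, G q & s = q.2 - M * rnorm (q.1 - x0)].
have Sub q : G q -> ubound S (M * rnorm (q.1 + x0) - q.2).
  move=> Gq _ [p Gp ->]; rewrite lerBrDr addrAC lerBlDr.
  have := Gl p q 1 Gp Gq; rewrite scalar_of_real1 scale1r mul1r => /Gd/= h.
  rewrite (le_trans h)// -mulrDr ler_wpM2l//.
  have -> : p.1 + q.1 = (p.1 - x0) + (q.1 + x0) by rewrite addrACA addNr addr0.
  by rewrite addrC (le_trans (rnormD _ _))// addrC.
have S0 : S !=set0 by exists (g0.2 - M * rnorm (g0.1 - x0)); exists g0.
exists (sup S) => G'; split.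
  move=> p q r [p1 [rp [Gp1 ->]]] [q1 [rq [Gq1 ->]]] /=.
  exists (sor r *: p1.1 + q1.1, r * p1.2 + q1.2), (r * rp + rq); split; first exact: Gl.
  congr (_, _) => /=; first by rewrite scalar_of_realD scalar_of_realM scalerDl -scalerA scalerDr addrACA.
  by rewrite mulrDl mulrDr -mulrA addrACA.
move=> _ [q [r [Gq ->]]] /=.
have [r0|r0|->] := ltgtP r 0; last by rewrite scalar_of_real0 scale0r mul0r !addr0; exact: Gd.
- pose t := - r; have t0 : 0 < t by rewrite oppr_gt0.
  have Gt := GZ q t^-1 Gq.
  have : t^-1 * q.2 - M * rnorm (sor t^-1 *: q.1 - x0) <= sup S.
    by apply: ub_le_sup; [exists (M * rnorm (g0.1 + x0) - g0.2); exact: Sub|exists (sor t^-1 *: q.1, t^-1 * q.2)].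
  rewrite -(ler_pM2l t0) mulrBr mulVKf ?gt_eqF// => h.
  have E : q.1 + sor r *: x0 = sor t *: (sor t^-1 *: q.1 - x0).
    rewrite scalerBr scalerA -scalar_of_realM mulfV ?gt_eqF// scalar_of_real1 scale1r.
    congr (_ + _); rewrite -scaleNr; congr (_ *: _).
    by apply/eqP; rewrite -addr_eq0 -scalar_of_realD subrr scalar_of_real0.
  rewrite E rnormZr gtr0_norm// -[r]opprK -/t mulNr.
  by rewrite lerBlDr -lerBlDl (le_trans _ h)// mulrCA.
- have Gt := GZ q r^-1 Gq.
  have : sup S <= M * rnorm (sor r^-1 *: q.1 + x0) - r^-1 * q.2.
    by apply: ge_sup => //; exact: (Sub _ Gt).
  rewrite -(ler_pM2l r0) mulrBr mulVKf ?gt_eqF// => h.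
  have E : q.1 + sor r *: x0 = sor r *: (sor r^-1 *: q.1 + x0).
    by rewrite scalerDr scalerA -scalar_of_realM mulfV ?gt_eqF// scalar_of_real1 scale1r.
  by rewrite E rnormZr gtr0_norm// -lerBrDl (le_trans h)// mulrCA.
Qed.

Lemma real_hahn_banach (G0 : set (X * R)) :
  real_linear_graph G0 -> dominated G0 -> G0 !=set0 ->
  exists u : X -> R, [/\ forall r x y, u (sor r *: x + y) = r * u x + u y,
    forall x, u x <= M * rnorm x & forall p, G0 p -> u p.1 = p.2].
Proof.
move=> Gl Gd G0ne.
(* Uniting with [G0] makes the empty chain harmless: its union is the empty set, which still stands
   for [G0]. *)
pose P (G : set (X * R)) := real_linear_graph (G `|` G0) /\ dominated (G `|` G0).
have [|A [[Al Ad] Amax]] := @Zorn_bigcup _ P.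
  move=> F FP Ft; split.
    move=> p q r; have [G [[FG|->]]] : exists G, (F G \/ G = set0) /\
      (((\bigcup_(H in F) H) `|` G0) p -> ((\bigcup_(H in F) H) `|` G0) q -> (G `|` G0) p /\ (G `|` G0) q).
    - have [[[G FG Gp]|Gp]|Gp] := pselect (((\bigcup_(H in F) H) `|` G0) p); last 1 first.
      + by exists set0; split; [right | move=> /Gp].
      + have [[[H FH Hq]|Hq]|Hq] := pselect (((\bigcup_(H in F) H) `|` G0) q); last 1 first.
        * by exists set0; split; [right | move=> _ /Hq].
        * have [GH|HG] := Ft _ _ FG FH.
            by exists H; split; [left | move=> _ _; split; left=> //; exact: GH].
          by exists G; split; [left | move=> _ _; split; left=> //; exact: HG].
        * by exists G; split; [left | move=> _ _; split; [left|right]].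
      + have [[[H FH Hq]|Hq]|Hq] := pselect (((\bigcup_(H in F) H) `|` G0) q); last 1 first.
        * by exists set0; split; [right | move=> _ /Hq].
        * by exists H; split; [left | move=> _ _; split; [right|left]].
        * by exists set0; split; [right | move=> _ _; split; right].
    - move=> h hp hq; have [Gp Gq] := h hp hq.
      have [Hl _] := FP _ FG.
      by have [|] := Hl p q r Gp Gq; [left; exists G | right].
    - move=> h hp hq; have [[//|Gp] [//|Gq]] := h hp hq.
      by right; exact: Gl.
  move=> p [[G FG Gp]|]; last exact: Gd.
  by have [_ /(_ p)] := FP _ FG; apply; left.
set B := A `|` G0 in Al Ad.
have Bne : B !=set0 by have [p Gp] := G0ne; exists p; right.
have B00 : B (0, 0).
  have [p Bp] := Bne; have := Al p p (-1) Bp Bp.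
  by rewrite sorN scalar_of_real1 scaleN1r mulN1r !addNr.
have Bfun x a b : B (x, a) -> B (x, b) -> a <= b.
  move=> Ba Bb; have := Al (x, b) (x, a) (-1) Bb Ba.
  by rewrite sorN scalar_of_real1 scaleN1r mulN1r /= addNr => /Ad/=; rewrite rnorm0 mulr0 addrC subr_le0.
have Btot x : exists a, B (x, a).
  have [c /= [Cl Cd]] := @graph_extend B x Al Ad Bne.
  set C := [set p | _] in Cl Cd.
  have BC : B `<=` C.
    by move=> p Bp; exists p, 0; rewrite scalar_of_real0 scale0r mul0r !addr0 -surjective_pairing.
  have CG : C `|` G0 = C.
    by apply/seteqP; split=> [p [//|Gp]|p]; [apply: BC; right | left].
  have Cx : C (x, c) by exists (0, 0), 1; rewrite /= scalar_of_real1 scale1r mul1r !add0r.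
  have [BxA|nA] := pselect (C `<=` A); first by exists c; left; apply: BxA.
  exfalso; apply: (Amax C); last by rewrite /P CG.
  by split => // p Ap; apply: BC; left.
have [u uP] := choice Btot.
exists u; split=> [r x y|x|p Gp].
- have h := Al _ _ r (uP x) (uP y).
  by apply/le_anti/andP; split; [exact: Bfun (uP _) h | exact: Bfun h (uP _)].
- exact: (Ad (x, u x)).
- have Bp : B (p.1, p.2) by right; rewrite -surjective_pairing.
  by apply/le_anti/andP; split; [exact: Bfun (uP _) Bp | exact: Bfun Bp (uP _)].
Qed.

End RealHahnBanach.
End HahnBanach.

(** A complex linear functional is determined by its real part [u] through
    [F x = u x - i * u (i * x)]; conversely this formula turns a real linear [u] into a complex
    linear map. *)
Lemma complexify (R : realType) (k : scalar_kind) (X : normedModType (scalar_field R k))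
    (u : X -> R) :
  (forall r x y, u (scalar_of_real k r *: x + y) = r * u x + u y) ->
  exists2 F : X -> scalar_line R k, linear F & forall x, scalar_re (F x) = u x.
Proof.
case: k X u => X u ul; first by exists u.
have u0 : u 0 = 0.
  by have := ul (-1) 0 0; rewrite scaler0 addr0 mulN1r addNr.
have uD x y : u (x + y) = u x + u y.
  by have := ul 1 x y; rewrite mul1r scalar_of_real1 scale1r.
have uZ r x : u (Complex r 0 *: x) = r * u x.
  by have := ul r x 0; rewrite u0 !addr0.
pose ii : R[i] := Complex 0 1.
exists (fun x => Complex (u x) (- u (ii *: x))) => // -[a b] x y.
have ab : Complex a b = Complex a 0 + Complex b 0 * ii.
  by congr Complex; rewrite /= !(mulr0, mul0r, mulr1, addr0, subr0, add0r).
have iab : ii * Complex a b = Complex a 0 * ii + Complex (- b) 0.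
  by congr Complex; rewrite /= !(mulr0, mul0r, mulr1, mul1r, addr0, subr0, oppr0, add0r, sub0r).
have E1 : u (Complex a b *: x + y) = a * u x + b * u (ii *: x) + u y.
  by rewrite uD {1}ab scalerDl uD uZ -scalerA uZ.
have E2 : u (ii *: (Complex a b *: x + y)) = a * u (ii *: x) - b * u x + u (ii *: y).
  by rewrite scalerDr uD scalerA iab scalerDl uD -scalerA !uZ mulNr.
apply/eqP; rewrite eq_complex /=; apply/andP; split; apply/eqP.
  by rewrite E1 mulrN opprK.
by rewrite E2 mulrN !opprD opprK [- (a * _) + _]addrC addrC -addrA addrC -addrA addrC.
Qed.

Section ScalarHahnBanach.
Variables (R : realType) (k : scalar_kind).
Local Notation K := (scalar_field R k).
Local Notation Kline := (scalar_line R k).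
Local Notation banach := (completeNormedModType K).
Local Notation sre := (@scalar_re R k).
Local Notation sor := (@scalar_of_real R k).

Lemma scalar_re_inj (z w : K) : (forall a : K, sre (a * z) = sre (a * w)) -> z = w.
Proof.
case: k z w => z w h; first by have := h 1; rewrite !mul1r.
case: z w h => a b [c d] h; congr Complex; first by have := h 1; rewrite !mul1r.
by have := h (Complex 0 1); rewrite /= !mul0r !mul1r !sub0r => /oppr_inj.
Qed.

(** Domination by [rnorm (j w)] forces [g] to vanish on the kernel of [j], which is why the values
    of [g] can be transported to the range of [j] and extended from there. *)
Lemma hahn_banach_dominated (W X : banach) (j : bop W X) (M : R) (g : dual W) :
  0 <= M -> (forall w, rnorm (g w) <= M * rnorm (j w)) ->
  exists2 G : dual X, (forall w, G (j w) = g w) & opnorm G <= M.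
Proof.
move=> M0 gM.
have reD (a b : K) : sre (a + b) = sre a + sre b by case: k a b => // -[? ?] [? ?].
have reZ r (a : K) : sre (sor r * a) = r * sre a.
  by case: k a => // -[? ?] /=; rewrite mul0r subr0.
have re_norm (a : K) : sre a <= sre `|a|.
  case: k a => [a|[a b]] /=; first exact: ler_norm.
  rewrite (le_trans (ler_norm _))// -sqrtr_sqr ler_sqrt ?addr_ge0 ?sqr_ge0//.
  by rewrite lerDl sqr_ge0.
pose G0 : set (X * R) := [set p | exists w, p = (j w, sre (g w))].
have [|||u [ul uM ug]] := @real_hahn_banach R k X M M0 G0.
- move=> _ _ r [w1 ->] [w2 ->] /=; exists (sor r *: w1 + w2).
  rewrite (bopP j).1 (bopP g).1; congr (_, _).
  by rewrite -reZ -reD.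
- by move=> _ [w ->] /=; rewrite (le_trans (re_norm _))//; exact: gM.
- by exists (j 0, sre (g 0)); exists 0.
have [F Fl Fu] := complexify ul.
have FM x : rnorm (F x) <= M * rnorm x.
  have [->|z0] := eqVneq (F x) 0; first by rewrite rnorm0 mulr_ge0 ?rnorm_ge0.
  have F0 : F 0 = 0 by apply: (addrI (F 0)); rewrite addr0 -[F 0 + _]/(F 0 + F 0) -{1}[F 0]scale1r -Fl scaler0 addr0.
  (* Multiplying [x] by the unimodular [a] makes the value of [F] real and nonnegative, so that the
     bound on the real part bounds the modulus. *)
  pose a : K := `|F x : K| / (F x : K).
  have na : `|a| = 1 by rewrite normrM normfV normr_id mulfV// normr_eq0.
  have E : F (a *: x) = `|F x : K|.
    have := Fl a x 0; rewrite F0 !addr0 => ->.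
    by rewrite -[_ *: _]/(a * _) mulfVK.
  have -> : rnorm (F x) = u (a *: x) by rewrite -Fu E.
  rewrite (le_trans (uM _))// rnormZ na.
  by rewrite -(scalar_of_real1 R k) scalar_of_realK mul1r.
have [G GF GM] := bop_exists Fl M0 FM.
exists G => // w; rewrite GF; apply: scalar_re_inj => a.
have F0 : F 0 = 0 by apply: (addrI (F 0)); rewrite addr0 -[F 0 + _]/(F 0 + F 0) -{1}[F 0]scale1r -Fl scaler0 addr0.
have := Fl a (j w) 0; rewrite F0 !addr0 => h.
rewrite -[a * _]/(a *: F (j w)) -h Fu -bopZr.
rewrite (ug (j (a *: w), sre (g (a *: w)))); last by exists (a *: w).
by rewrite /= bopZr.
Qed.

Lemma hahn_banach (W X : banach) (j : bop W X) (C : R) (g : dual W) :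
  0 <= C -> (forall w, rnorm w <= C * rnorm (j w)) ->
  exists2 G : dual X, (forall w, G (j w) = g w) & opnorm G <= C * opnorm g.
Proof.
move=> C0 jC; apply: hahn_banach_dominated => [|w]; first by rewrite mulr_ge0 ?opnorm_ge0.
rewrite (le_trans (opnormP _ _))// mulrAC [leLHS]mulrC.
by rewrite ler_wpM2r ?opnorm_ge0.
Qed.

Lemma norming_functional (X : banach) (x : X) :
  exists2 f : dual X, f x = sor (rnorm x) & opnorm f <= 1.
Proof.
have [->|x0] := eqVneq x 0.
  by exists 0; rewrite ?opnorm0// rnorm0 scalar_of_real0.
have xp : 0 < rnorm x by rewrite rnorm_gt0.
have [j jE _] := line_map x.
have [|w|G Gj Gn] := @hahn_banach Kline X j (rnorm x)^-1 (sor (rnorm x) *: bop_id Kline).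
- by rewrite invr_ge0 rnorm_ge0.
- by rewrite jE rnorm_scale mulrCA mulVf ?gt_eqF// mulr1.
exists G.
  have := Gj (1 : K); rewrite jE scale1r => ->.
  by rewrite bopZ bop_idE -[_ *: _]/(_ * _) mulr1.
rewrite (le_trans Gn)// opnormZ sre_norm_sor gtr0_norm// mulKf ?gt_eqF//.
exact: opnorm_id.
Qed.

Lemma dual_separates (X : banach) (x y : X) : (forall f : dual X, f x = f y) -> x = y.
Proof.
move=> h; apply/eqP; rewrite -subr_eq0 -rnorm_eq0.
have [f fx _] := norming_functional (x - y).
move: fx; rewrite bopBr h subrr -(scalar_of_real0 R k).
by move/(can_inj (@scalar_of_realK R k)) => <-.
Qed.

Lemma rnorm_le_dual (X : banach) (x : X) (M : R) :
  (forall f : dual X, opnorm f <= 1 -> rnorm (f x) <= M) -> rnorm x <= M.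
Proof.
move=> h; have [f fx f1] := norming_functional x.
have := h f f1; rewrite fx rnorm_line sre_norm_sor.
by rewrite ger0_norm ?rnorm_ge0.
Qed.

End ScalarHahnBanach.

(** * Finite rank and approximable operators *)

Section FiniteRank.
Variables (R : realType) (k : scalar_kind).
Local Notation K := (scalar_field R k).
Local Notation banach := (completeNormedModType K).
Local Notation sre := (@scalar_re R k).
Local Notation sor := (@scalar_of_real R k).
Implicit Types X Y Z : banach.

Lemma half_pow_small (M e : R) : 0 < e -> exists N, forall n, (N <= n)%N -> M * 2^-1 ^+ n <= e.
Proof.
move=> e0; exists (Num.bound `|M / e|) => n Nn.
have h : M / e <= 2 ^+ n.
  rewrite (le_trans (ler_norm _))//.
  rewrite (le_trans (ltW (archi_boundP (normr_ge0 _))))//.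
  by rewrite -natrX ler_nat (leq_trans _ (ltnW (ltn_expl n (ltnSn 1)))).
by rewrite exprVn ler_pdivrMr ?exprn_gt0// mulrC -ler_pdivrMr.
Qed.

Lemma fast_cauchy (V : banach) (u : nat -> V) (M : R) :
  (forall n, rnorm (u n.+1 - u n) <= M * 2^-1 ^+ n) ->
  exists l, forall n, rnorm (l - u n) <= 2 * M * 2^-1 ^+ n.
Proof.
move=> uM.
have M0 : 0 <= M by have := uM 0; rewrite expr0 mulr1; apply: le_trans; exact: rnorm_ge0.
have tail p : forall n, rnorm (u (n + p)%N - u n) <= 2 * M * 2^-1 ^+ n.
  elim: p => [|p IH] n; first by rewrite addn0 subrr rnorm0 !mulr_ge0// exprn_ge0// invr_ge0.
  rewrite (le_trans (rnorm_dist _ (u n.+1) _))// addnS -addSn.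
  rewrite (le_trans (lerD (IH n.+1) (uM n)))// exprS; lra.
have uc : cvg (u @ \oo).
  apply/cauchy_cvgP/rcauchyP => e e0.
  have [N Ne] := half_pow_small (4 * M) e0.
  exists (u @` [set n | (N <= n)%N]); first by exists N => // n /= Nn; exists n.
  move=> _ _ [n Nn <-] [m Nm <-].
  rewrite (le_trans (rnorm_dist _ (u N) _))// (le_trans _ (Ne N (leqnn N)))//.
  have -> : 4 * M * 2^-1 ^+ N = 2 * M * 2^-1 ^+ N + 2 * M * 2^-1 ^+ N.
    by lra.
  rewrite lerD//; first by have := tail (n - N)%N N; rewrite subnKC.
  by rewrite rnormB; have := tail (m - N)%N N; rewrite subnKC.
exists (lim (u @ \oo)) => n; apply/ler_addgt0Pr => e e0.
have /rcvgP/(_ e e0)[N _ Nu] := uc.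
rewrite (le_trans (rnorm_dist _ (u (n + N)%N) _))// addrC lerD ?tail//.
by apply: Nu => /=; rewrite leq_addl.
Qed.

Lemma fast_series (V : banach) (v : nat -> V) (M : R) :
  (forall n, rnorm (v n) <= M * 2^-1 ^+ n) ->
  exists l, forall n, rnorm (l - \sum_(i < n) v i) <= 2 * M * 2^-1 ^+ n.
Proof.
move=> vM; apply: fast_cauchy => n.
by rewrite big_ord_recr /= addrAC subrr add0r.
Qed.

Lemma limit_unique (V : banach) (x y : V) : (forall e, 0 < e -> rnorm (x - y) <= e) -> x = y.
Proof.
move=> h; apply/eqP; rewrite -subr_eq0 -rnorm_eq0; apply/eqP/le_anti.
rewrite rnorm_ge0 andbT; apply/ler_addgt0Pr => e e0; rewrite add0r; exact: h.
Qed.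

Lemma approximableP X Y (T : bop X Y) : approximable X Y T <->
  forall e, 0 < e -> exists2 S, finite_rank X Y S & opnorm (T - S) <= e.
Proof.
split=> [TA e e0|TA B].
  have /rcvgP/(_ e e0) h : nbhs T --> T by [].
  have [S [SF /= Se]] := TA _ h.
  by exists S => //; rewrite -rnorm_bop.
move=> /nbhs_ballP[e /= e0 eB].
have [|S SF Se] := TA (sre e / 2); first by rewrite divr_gt0// scalar_re_gt0.
exists S; split => //; apply: eB; rewrite -ball_normE /=.
rewrite -[ltRHS](scalar_reK (ltW e0)) -rnorm_lt rnorm_bop (le_lt_trans Se)//.
by rewrite ltr_pdivrMr// ltr_pMr ?ltr1n// scalar_re_gt0.
Qed.

Lemma finite_rank_approximable X Y (T : bop X Y) : finite_rank X Y T -> approximable X Y T.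
Proof.
by move=> TF; apply/approximableP => e e0; exists T => //; rewrite subrr opnorm0 ltW.
Qed.

Lemma finite_rank0 X Y : finite_rank X Y 0.
Proof. by exists 0, (fun=> 0) => x; exists (fun=> 0); rewrite big_ord0. Qed.

Lemma finite_rankD X Y (S T : bop X Y) :
  finite_rank X Y S -> finite_rank X Y T -> finite_rank X Y (S + T).
Proof.
move=> [n [v Sv]] [m [w Tw]].
exists (n + m)%N, (fun i : 'I_(n + m) => match fintype.split i with inl i => v i | inr i => w i end) => x.
have [c Sc] := Sv x; have [d Td] := Tw x.
exists (fun i : 'I_(n + m) => match fintype.split i with inl i => c i | inr i => d i end).
rewrite bopD Sc Td big_split_ord /=; congr (_ + _); apply: eq_bigr => i _.
  by rewrite -[lshift m i]/(unsplit (inl i)) unsplitK.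
by rewrite -[rshift n i]/(unsplit (inr i)) unsplitK.
Qed.

Lemma finite_rank_compl X Y Z (S : bop Y Z) (T : bop X Y) :
  finite_rank X Y T -> finite_rank X Z (S \bo T).
Proof.
move=> [n [v Tv]]; exists n, (fun i => S (v i)) => x.
have [c Tc] := Tv x; exists c.
by rewrite bop_compE Tc bop_sumr; apply: eq_bigr => i _; rewrite bopZr.
Qed.

Lemma finite_rank_compr X Y Z (S : bop Y Z) (T : bop X Y) :
  finite_rank Y Z S -> finite_rank X Z (S \bo T).
Proof. by move=> [n [v Sv]]; exists n, v => x; exact: Sv. Qed.

Lemma finite_rankZ X Y a (T : bop X Y) : finite_rank X Y T -> finite_rank X Y (a *: T).
Proof.
move=> [n [v Tv]]; exists n, v => x; have [c Tc] := Tv x.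
exists (fun i => a * c i); rewrite bopZ Tc scaler_sumr.
by apply: eq_bigr => i _; rewrite scalerA.
Qed.

Lemma finite_rankN X Y (T : bop X Y) : finite_rank X Y T -> finite_rank X Y (- T).
Proof. by move=> h; rewrite -scaleN1r; exact: finite_rankZ. Qed.

Lemma finite_rankB X Y (S T : bop X Y) :
  finite_rank X Y S -> finite_rank X Y T -> finite_rank X Y (S - T).
Proof. by move=> *; apply: finite_rankD => //; exact: finite_rankN. Qed.

Lemma finite_rank_rank1 X Y (f : dual X) (y : Y) : finite_rank X Y (rank1 f y).
Proof.
by exists 1, (fun=> y) => x; exists (fun=> f x); rewrite big_ord1.
Qed.

Lemma finite_rank_sum X Y (I : Type) (r : seq I) (P : pred I) (F : I -> bop X Y) :
  (forall i, P i -> finite_rank X Y (F i)) -> finite_rank X Y (\sum_(i <- r | P i) F i).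
Proof.
move=> h; elim/big_ind: _ => //; [exact: finite_rank0 | exact: finite_rankD].
Qed.

(* Splitting off [T x0 (x) f T], where [f (T x0) = 1], lowers the number of
   vectors spanning the range of [T]; the generalized inverse of [T] is rebuilt
   from that of the remaining operator. *)
Lemma finite_rank_decomp X Y (T : bop X Y) : finite_rank X Y T ->
  (exists n (g : 'I_n -> dual X) (v : 'I_n -> Y), T = \sum_(i < n) rank1 (g i) (v i)) /\
  (exists2 s : bop Y X, finite_rank Y X s & T \bo s \bo T = T).
Proof.
move=> [n [v Tv]]; elim: n T v Tv => [|n IH] T v Tv.
  have -> : T = 0.
    by apply: bop_ext => x; have [c ->] := Tv x; rewrite big_ord0.
  split; first by exists 0, (fun=> 0), (fun=> 0); rewrite big_ord0.
  by exists 0; [exact: finite_rank0 | apply: bop_ext => x; rewrite bop_compE].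
have [T0|/eqP T0] := pselect (T = 0).
  apply: (IH _ (fun=> 0)) => x; exists (fun=> 0).
  by rewrite T0 big1// => i _; rewrite scale0r.
have [x0 Tx0] : exists x0, T x0 <> 0.
  apply/existsNP => h; move/eqP: T0; apply; exact: bop_ext.
pose w := T x0; have w0 : sor (rnorm w) != 0.
  by rewrite -(scalar_of_real0 R k) (inj_eq (can_inj (@scalar_of_realK R k))) rnorm_eq0; apply/eqP.
have [f0 f0w _] := norming_functional w.
have [f fw] : exists f : dual Y, f w = (1 : K).
  by exists ((sor (rnorm w))^-1 *: f0); rewrite bopZ f0w -[_ *: _]/(_ * _) mulVf.
pose T' := T - rank1 (f \bo T) w.
have [c0 Ec0] := Tv x0.
have [i0 fi0] : exists i0, f (v i0) <> 0.
  apply/existsNP => h; have /eqP := fw; rewrite {1}/w Ec0 bop_sumr big1 ?(eq_sym 0) ?oner_eq0//.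
  by move=> i _; rewrite bopZr h scaler0.
(* [T'] takes its values in the kernel of [f], hence in the span of the projections of the remaining
   [n] vectors to that kernel along [v i0]. *)
have [|[m [g [u T'E]]] [s sF sE]] := IH T' (fun j => v (lift i0 j) - ((f (v (lift i0 j)) : K) / (f (v i0) : K)) *: v i0).
  move=> x; have [c Ec] := Tv x.
  pose d i := c i - (f (T x) : K) * c0 i.
  have T'd : T' x = \sum_i d i *: v i.
    rewrite /T' bopB rank1E {1}Ec {1}/w Ec0 scaler_sumr -sumrB.
    by apply: eq_bigr => i _; rewrite scalerA -scalerBl.
  have fT' : f (T' x) = 0 by rewrite /T' bopB bopBr rank1E bopZr fw -[_ *: _]/(_ * _) mulr1 subrr.
  exists (fun j => d (lift i0 j)).
  under eq_bigr do rewrite scalerBr scalerA mulrA.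
  rewrite T'd (bigD1_ord i0) //= sumrB addrC; congr (_ + _).
  rewrite -scaler_suml -scaleNr -mulr_suml -mulNr; congr (_ *: _).
  apply: (mulIf (x := f (v i0) : K)); first exact/eqP.
  rewrite mulfVK//; last exact/eqP.
  have := fT'; rewrite T'd (bigD1_ord i0)//= bopDr bopZr bop_sumr.
  rewrite (eq_bigr (fun i => d (lift i0 i) *: f (v (lift i0 i)))) => [|i _]; last exact: bopZr.
  by move/eqP; rewrite addr_eq0 => /eqP.
have TE : T = T' + rank1 (f \bo T) w by rewrite subrK.
split.
  exists m.+1, (fun i => if unlift ord0 i is Some j then g j else f \bo T),
    (fun i => if unlift ord0 i is Some j then u j else w).
  rewrite big_ord_recl unlift_none {1}TE addrC T'E; congr (_ + _).
  by apply: eq_bigr => i _; rewrite liftK.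
(* Both corrections turn [T] into [T']: composing [T] with [bop_id X - rank1 (f \bo T) x0] on the
   right, or with [bop_id Y - rank1 f w] on the left. *)
exists (rank1 f x0 + (bop_id X - rank1 (f \bo T) x0) \bo s \bo (bop_id Y - rank1 f w)).
  apply: finite_rankD; first exact: finite_rank_rank1.
  by apply: finite_rank_compr; exact: finite_rank_compl.
apply: bop_ext => x; rewrite !bop_compE bopD rank1E bop_compE bop_compE.
have -> : (bop_id Y - rank1 f w) (T x) = T' x by [].
set z := s (T' x); rewrite bopDr bopZr -/w bopB rank1E bopBr bopZr -/w !bop_compE bop_idE.
have -> : T z - (f (T z) : K) *: w = T' z by [].
have -> : T' z = T' x by rewrite -[in RHS]sE.
by rewrite /T' bopB rank1E addrC subrK.
Qed.

Lemma approximable0 X Y : approximable X Y 0.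
Proof. exact/finite_rank_approximable/finite_rank0. Qed.

Lemma approximable_comp W X Y Z (U : bop Y Z) (T : bop X Y) (V : bop W X) :
  approximable X Y T -> approximable W Z (U \bo T \bo V).
Proof.
move=> /approximableP TA; apply/approximableP => e e0.
pose M := opnorm U * opnorm V + 1.
have M0 : 0 < M by rewrite ltr_wpDl// mulr_ge0 ?opnorm_ge0.
have [S SF Se] := TA _ (divr_gt0 e0 M0).
exists (U \bo S \bo V); first by apply: finite_rank_compr; exact: finite_rank_compl.
rewrite -bop_compBl -bop_compBr (le_trans (opnorm_comp _ _))//.
rewrite (le_trans (ler_wpM2r (opnorm_ge0 _) (opnorm_comp _ _)))//.
rewrite mulrAC (le_trans (ler_wpM2l _ Se)) ?mulr_ge0 ?opnorm_ge0//.
by rewrite mulrCA ler_piMr ?(ltW e0)// ler_pdivrMr// mul1r lerDl.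
Qed.

Lemma approximable_compl X Y Z (U : bop Y Z) (T : bop X Y) :
  approximable X Y T -> approximable X Z (U \bo T).
Proof. by move=> h; rewrite -(bop_comp1r (U \bo T)); exact: approximable_comp. Qed.

Lemma approximable_compr X Y Z (U : bop Y Z) (T : bop X Y) :
  approximable Y Z U -> approximable X Z (U \bo T).
Proof. by move=> h; rewrite -(bop_comp1l U); exact: approximable_comp. Qed.

Lemma approximableD X Y (S T : bop X Y) :
  approximable X Y S -> approximable X Y T -> approximable X Y (S + T).
Proof.
move=> /approximableP SA /approximableP TA; apply/approximableP => e e0.
have e2 : 0 < e / 2 by rewrite divr_gt0.
have [S' SF Se] := SA _ e2; have [T' TF Te] := TA _ e2.
exists (S' + T'); first exact: finite_rankD.
by rewrite opprD addrACA (le_trans (opnormD _ _))// (splitr e) lerD.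
Qed.

Lemma approximable_limit X Y (T : bop X Y) :
  (forall e, 0 < e -> exists2 S, approximable X Y S & opnorm (T - S) <= e) ->
  approximable X Y T.
Proof.
move=> h; apply/approximableP => e e0.
have e2 : 0 < e / 2 by rewrite divr_gt0.
have [S /approximableP SA Se] := h _ e2; have [S' SF Se'] := SA _ e2.
exists S' => //; rewrite -rnorm_bop (le_trans (rnorm_dist _ S _))// !rnorm_bop.
by rewrite (splitr e) lerD.
Qed.

Lemma approximable_series X Y (T_ : nat -> bop X Y) M :
  (forall n, approximable X Y (T_ n)) -> (forall n, opnorm (T_ n) <= M * 2^-1 ^+ n) ->
  exists2 T, approximable X Y T &
    forall n, opnorm (T - \sum_(i < n) T_ i) <= 2 * M * 2^-1 ^+ n.
Proof.
move=> TA TM; have [|T Tn] := @fast_series (bop X Y) T_ M.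
  by move=> n; rewrite rnorm_bop.
have Tn' n : opnorm (T - \sum_(i < n) T_ i) <= 2 * M * 2^-1 ^+ n by rewrite -rnorm_bop.
exists T => //; apply: approximable_limit => e e0.
have [N /(_ N (leqnn N)) Ne] := half_pow_small (2 * M) e0.
exists (\sum_(i < N) T_ i); last exact: le_trans Ne.
elim/big_ind: _ => [|S U SA UA|i _]; [exact: approximable0 | exact: approximableD | exact: TA].
Qed.

Lemma closed_range (X Y : banach) (j : bop X Y) (y : Y) :
  (forall x, rnorm (j x) = rnorm x) ->
  (forall e, 0 < e -> exists x, rnorm (y - j x) <= e) -> exists x, j x = y.
Proof.
move=> ji h.
have h0 n : exists x, rnorm (y - j x) <= 2^-1 ^+ n by apply: h; rewrite exprn_gt0// invr_gt0.
have [x xn] := choice h0.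
have [|l ln] := @fast_cauchy X x 2.
  move=> n; rewrite -ji bopBr (le_trans (rnorm_dist _ y _))//.
  rewrite mulr_natl mulr2n lerD//.
  rewrite rnormB (le_trans (xn _))// exprS ler_piMl// ?exprn_ge0 ?invr_ge0//.
  by rewrite invf_le1// ler1n.
exists l; apply: limit_unique => e e0.
have [N /(_ N (leqnn N)) Ne] := half_pow_small 5 e0.
rewrite (le_trans _ Ne)// (le_trans (rnorm_dist _ (j (x N)) _))//.
rewrite -bopBr ji rnormB; have -> : (5 : R) = 2 * 2 + 1 by rewrite -natrM natr1.
by rewrite mulrDl mul1r lerD.
Qed.

End FiniteRank.

(** * Compact operators *)

Section TotallyBounded.
Variables (R : realType) (k : scalar_kind).
Local Notation K := (scalar_field R k).
Local Notation banach := (completeNormedModType K).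
Local Notation sor := (@scalar_of_real R k).
Implicit Types X Y Z : banach.

Definition totally_bounded (V : normedModType K) (S : set V) := forall e : R, 0 < e ->
  exists s : seq V, forall x, S x -> exists2 y, y \in s & rnorm (x - y) <= e.

Lemma precompact_totally_bounded X (S : set X) : precompact S -> totally_bounded S.
Proof.
rewrite precompactE => Sc e e0.
have := Sc; rewrite compact_cover => /(_ X setT (fun y => [set x | rnorm (x - y) < e]))[].
- move=> y _; rewrite openE => x /= xy.
  have d0 : 0 < e - rnorm (x - y) by rewrite subr_gt0.
  have /rcvgP/(_ ((e - rnorm (x - y)) / 2)) : nbhs x --> x by [].
  rewrite divr_gt0// => /(_ isT); apply: (filterS (F := nbhs x)) => z /= xz.
  rewrite (le_lt_trans (rnorm_dist _ x _))// -ltrBrDr rnormB (le_lt_trans xz)//.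
  by rewrite ltr_pdivrMr// ltr_pMr ?ltr1n.
- by move=> x _; exists x => //=; rewrite subrr rnorm0.
move=> D _ DS; exists (enum_fset D) => x Sx.
by have [y yD /ltW xy] := DS x (subset_closure Sx); exists y.
Qed.

Lemma totally_bounded_precompact X (S : set X) : totally_bounded S -> precompact S.
Proof.
move=> St; rewrite precompactE compact_ultra => F FU FS.
have FP : ProperFilter F := ultra_proper.
have : cvg F.
  apply/cauchy_cvgP/rcauchyP => e e0.
  have e3 : 0 < e / 3 by rewrite divr_gt0.
  have [s sS] := St _ e3.
  pose b y : set X := [set x | rnorm (x - y) <= e / 2].
  have cS : closure S `<=` [set x | exists2 y, y \in s & b y x].
    move=> x cx; have /rcvgP/(_ (e / 6)) : nbhs x --> x by [].
    rewrite divr_gt0// => /(_ isT) h; have [z [Sz /= xz]] := cx _ h.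
    have [y ys zy] := sS z Sz; exists y => //; rewrite /b /=.
    rewrite (le_trans (rnorm_dist _ z _))// (le_trans (lerD xz zy))//; lra.
  have [y Fy] : exists y, F (b y).
    have : F [set x | exists2 y, y \in s & b y x] by exact: filterS FS.
    elim: {sS cS} s => [|y s IH] h.
      exfalso; apply: (@filter_not_empty _ F).
      by apply: filterS h => x [].
    have [|nFy] := in_ultra_setVsetC (b y) FU; first by exists y.
    apply: IH; apply: filterS (filterI h nFy) => x [[z]].
    by rewrite inE => /orP[/eqP-> //|zs bz _]; exists z.
  exists (b y) => // u v bu bv; rewrite (le_trans (rnorm_dist _ y _))//.
  by rewrite (splitr e) lerD// rnormB.
move=> /cvg_ex[p Fp]; exists p; split => //.
have := @closed_cvg _ _ F _ id (closure S) (@closed_closure _ S).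
by apply.
Qed.

Lemma totally_bounded_sub (V : normedModType K) (S S' : set V) :
  S `<=` S' -> totally_bounded S' -> totally_bounded S.
Proof. by move=> SS' h e e0; have [s sS] := h e e0; exists s => x /SS'/sS. Qed.

Lemma totally_bounded_approx (V : normedModType K) (S : set V) :
  (forall e, 0 < e -> exists2 S', totally_bounded S' &
     forall x, S x -> exists2 y, S' y & rnorm (x - y) <= e) -> totally_bounded S.
Proof.
move=> h e e0; have e2 : 0 < e / 2 by rewrite divr_gt0.
have [S' S't SS'] := h _ e2; have [s sS'] := S't _ e2.
exists s => x /SS'[y /sS'[z zs yz] xy]; exists z => //.
by rewrite (le_trans (rnorm_dist _ y _))// (splitr e) lerD.
Qed.

Lemma totally_bounded_image X Y (T : bop X Y) (S : set X) :
  totally_bounded S -> totally_bounded (T @` S).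
Proof.
move=> h e e0; have M0 : 0 < opnorm T + 1 by rewrite ltr_wpDl ?opnorm_ge0.
have [s sS] := h _ (divr_gt0 e0 M0); exists [seq T x | x <- s] => _ [x Sx <-].
have [y ys xy] := sS x Sx; exists (T y); first exact: map_f.
rewrite -bopBr (le_trans (opnormP _ _))// (le_trans (ler_wpM2l (opnorm_ge0 _) xy))//.
by rewrite mulrCA ler_piMr ?(ltW e0)// ler_pdivrMr// mul1r lerDl.
Qed.

Lemma totally_bounded_isometry X Y (j : bop X Y) (S : set X) :
  (forall x, rnorm (j x) = rnorm x) -> totally_bounded (j @` S) -> totally_bounded S.
Proof.
move=> ji h e e0; have e2 : 0 < e / 2 by rewrite divr_gt0.
have [s sS] := h _ e2.
(* The points of the net need not lie in the range of [j]. Each one close to the image of [S] is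
   replaced by a point of [S] whose image is within [e / 2], the others by 0. *)
have : forall y, exists x, (exists2 x', S x' & rnorm (j x' - y) <= e / 2) -> rnorm (j x - y) <= e / 2.
  move=> y; have [[x' _ xy]|nx] := pselect (exists2 x', S x' & rnorm (j x' - y) <= e / 2).
    by exists x'.
  by exists 0.
move=> /choice[c cP]; exists (map c s) => x Sx.
have [|y ys xy] := sS (j x); first by exists x.
exists (c y); first exact: map_f.
rewrite -ji bopBr (le_trans (rnorm_dist _ y _))// (splitr e) lerD//.
by rewrite rnormB cP//; exists x.
Qed.

Lemma totally_boundedD (V : normedModType K) (S S' : set V) :
  totally_bounded S -> totally_bounded S' ->
  totally_bounded [set z | exists x y, [/\ S x, S' y & z = x + y]].
Proof.
move=> h h' e e0; have e2 : 0 < e / 2 by rewrite divr_gt0.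
have [s sS] := h _ e2; have [s' sS'] := h' _ e2.
exists [seq x + y | x <- s, y <- s'] => _ [x [y [Sx Sy ->]]].
have [u us xu] := sS x Sx; have [v vs yv] := sS' y Sy.
exists (u + v); first by apply/allpairsP; exists (u, v).
by rewrite opprD addrACA (le_trans (rnormD _ _))// (splitr e) lerD.
Qed.

Lemma compact_operatorP X Y (T : bop X Y) : compact_operator X Y T <->
  totally_bounded (T @` closed_unit_ball X).
Proof.
split=> [|]; [exact: precompact_totally_bounded | exact: totally_bounded_precompact].
Qed.

Lemma compact_operator_compl X Y Z (S : bop Y Z) (T : bop X Y) :
  compact_operator X Y T -> compact_operator X Z (S \bo T).
Proof.
move=> /compact_operatorP h; apply/compact_operatorP.
by apply: totally_bounded_sub (totally_bounded_image S h) => _ [x Bx <-]; exists (T x) => //; exists x.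
Qed.

Lemma scale_unit (V : normedModType K) (x : V) (M : R) : 0 < M -> rnorm x <= M ->
  exists2 y, rnorm y <= 1 & x = sor M *: y.
Proof.
move=> M0 xM; exists (sor M^-1 *: x).
  by rewrite rnormZr gtr0_norm ?invr_gt0// ler_pdivrMl// mulr1.
by rewrite scalerA -scalar_of_realM mulfV ?gt_eqF// scalar_of_real1 scale1r.
Qed.

Lemma compact_operator_ball X Y (T : bop X Y) M :
  compact_operator X Y T -> totally_bounded [set T x | x in [set x | rnorm x <= M]].
Proof.
move=> /compact_operatorP h; pose M' := `|M| + 1.
have M0 : 0 < M' by rewrite ltr_wpDl.
apply: totally_bounded_sub (totally_bounded_image (sor M' *: bop_id Y) h).
move=> _ [x /= xM <-]; have [|y y1 ->] := scale_unit M0 (x := x).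
  by rewrite (le_trans xM)// (le_trans (ler_norm _))// lerDl.
by exists (T y); [exists y => //; apply/closed_unit_ballE | rewrite bopZr].
Qed.

Lemma compact_operator_compr X Y Z (S : bop Y Z) (T : bop X Y) :
  compact_operator Y Z S -> compact_operator X Z (S \bo T).
Proof.
move=> /(@compact_operator_ball _ _ _ (opnorm T)) h; apply/compact_operatorP.
apply: totally_bounded_sub h => _ [x /closed_unit_ballE x1 <-]; exists (T x) => //=.
by rewrite (le_trans (opnormP _ _))// ler_piMr ?opnorm_ge0.
Qed.

Lemma compact_operatorD X Y (S T : bop X Y) :
  compact_operator X Y S -> compact_operator X Y T -> compact_operator X Y (S + T).
Proof.
move=> /compact_operatorP hS /compact_operatorP hT; apply/compact_operatorP.
apply: totally_bounded_sub (totally_boundedD hS hT) => _ [x Bx <-].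
by exists (S x), (T x); split => //; exists x.
Qed.

Lemma compact_operatorN X Y (T : bop X Y) :
  compact_operator X Y T -> compact_operator X Y (- T).
Proof.
move=> h; have -> : - T = (- bop_id Y) \bo T by apply: bop_ext.
exact: compact_operator_compl.
Qed.

Lemma compact_operatorZ X Y a (T : bop X Y) :
  compact_operator X Y T -> compact_operator X Y (a *: T).
Proof.
move=> h; have -> : a *: T = (a *: bop_id Y) \bo T by apply: bop_ext.
exact: compact_operator_compl.
Qed.

Lemma compact_operator_limit X Y (T : bop X Y) :
  (forall e, 0 < e -> exists2 S, compact_operator X Y S & opnorm (T - S) <= e) ->
  compact_operator X Y T.
Proof.
move=> h; apply/compact_operatorP/totally_bounded_approx => e e0.
have [S /compact_operatorP Sc Se] := h _ e0; exists (S @` closed_unit_ball X) => //.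
move=> _ [x Bx <-]; exists (S x); first by exists x.
rewrite -bopB (le_trans (opnormP _ _))// (le_trans _ Se)// ler_piMr ?opnorm_ge0//.
exact/closed_unit_ballE.
Qed.

End TotallyBounded.

Lemma real_net (R : realType) (M e : R) : 0 < e ->
  exists s : seq R, forall a, `|a| <= M -> exists2 y, y \in s & `|a - y| <= e.
Proof.
move=> e0; pose N := Num.bound (2 * M / e).
exists [seq - M + i%:R * e | i <- iota 0 N] => a aM.
have aM0 : 0 <= (a + M) / e.
  by rewrite divr_ge0 ?(ltW e0)// -lerBlDr sub0r; move: aM; rewrite ler_norml => /andP[].
have /andP[h1 h2] := Num.Theory.truncn_itv aM0.
exists (- M + (Num.truncn ((a + M) / e))%:R * e).
  apply/mapP; exists (Num.truncn ((a + M) / e)) => //.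
  rewrite mem_iota add0n /= -(ltr_nat R) (le_lt_trans h1)//.
  rewrite (le_lt_trans _ (archi_boundP _)) ?ler_pM2r ?invr_gt0//.
    by move: aM; rewrite ler_norml => /andP[_]; lra.
  by rewrite (le_trans aM0)// ler_pM2r ?invr_gt0//; move: aM; rewrite ler_norml => /andP[_]; lra.
rewrite ler_pdivlMr// in h1; rewrite ltr_pdivrMr// -natr1 mulrDl mul1r in h2.
by rewrite ger0_norm; lra.
Qed.

Section ScalarNets.
Variables (R : realType) (k : scalar_kind).
Local Notation K := (scalar_field R k).
Local Notation Kline := (scalar_line R k).
Local Notation banach := (completeNormedModType K).

Lemma scalar_totally_bounded (M : R) : totally_bounded [set a : Kline | rnorm a <= M].
Proof.
case: k => e e0; first exact: real_net.
have e2 : 0 < e / 2 by rewrite divr_gt0.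
have [s sP] := real_net M e2.
exists [seq Complex x y | x <- s, y <- s] => -[a b] /= abM.
have bound c d : `|c| <= Num.sqrt (c ^+ 2 + d ^+ 2) :> R.
  by rewrite -sqrtr_sqr ler_sqrt ?addr_ge0 ?sqr_ge0// lerDl sqr_ge0.
have [|x xs ax] := sP a; first exact: le_trans (bound _ _) abM.
have [|y ys bY] := sP b; first by rewrite (le_trans (bound _ a))// addrC.
exists (Complex x y); first by apply/allpairsP; exists (x, y).
change (is_true (Num.sqrt ((a - x) ^+ 2 + (b - y) ^+ 2) <= e)).
rewrite (le_trans (y := `|a - x| + `|b - y|))//; last by rewrite (splitr e) lerD.
rewrite -[leRHS]ger0_norm ?addr_ge0// -[leRHS]sqrtr_sqr ler_sqrt ?sqr_ge0//.
by rewrite [leRHS]sqrrD !real_normK ?num_real// lerD2r lerDl mulrn_wge0// mulr_ge0.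
Qed.

Lemma finite_rank_compact (X Y : banach) (T : bop X Y) :
  finite_rank X Y T -> compact_operator X Y T.
Proof.
move=> /finite_rank_decomp[[n [g [v ->]]] _].
have C0 : compact_operator X Y 0.
  apply/compact_operatorP => e e0; exists [:: 0] => _ [x _ <-]; exists 0; first by rewrite inE.
  by rewrite subrr rnorm0 ltW.
elim/big_ind: _ => [//|S U|i _]; first exact: compact_operatorD.
have [j jE _] := line_map (v i).
apply/compact_operatorP.
apply: totally_bounded_sub (totally_bounded_image j (@scalar_totally_bounded (opnorm (g i)))).
move=> _ [x /closed_unit_ballE x1 <-]; exists (g i x); last by rewrite jE.
by rewrite /= (le_trans (opnormP _ _))// ler_piMr ?opnorm_ge0.
Qed.

Lemma approximable_compact (X Y : banach) (T : bop X Y) :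
  approximable X Y T -> compact_operator X Y T.
Proof.
move=> /approximableP h; apply: compact_operator_limit => e e0.
by have [S SF Se] := h e e0; exists S => //; exact: finite_rank_compact.
Qed.

End ScalarNets.

(** * Spaces of bounded families *)

Section LinfTools.
Variables (R : realType) (k : scalar_kind).
Local Notation K := (scalar_field R k).
Local Notation Kline := (scalar_line R k).
Local Notation banach := (completeNormedModType K).
Implicit Types X Y Z : banach.
Local Notation linf := (linf R k).

Lemma opnorm_le_ball X Y (T : bop X Y) M : 0 <= M ->
  (forall x, rnorm x <= 1 -> rnorm (T x) <= M) -> opnorm T <= M.
Proof.
move=> M0 h; apply: opnorm_le => //; apply: linear_le_of_ball => //; first exact: (bopP T).1.
by move=> x /closed_unit_ballE; exact: h.
Qed.

Lemma linf_le (G : Type) (v : linf G) M : 0 <= M -> (forall g, rnorm (v g) <= M) -> rnorm v <= M.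
Proof. by move=> M0 h; rewrite rnorm_linf; exact: linf_rnorm_le. Qed.

Lemma linf_coord_le (G : Type) (v : linf G) g : rnorm (v g) <= rnorm v.
Proof. by rewrite rnorm_linf; exact: linf_rnormP. Qed.

Lemma linf_ext (G : Type) (v w : linf G) : (forall g, v g = w g) -> v = w.
Proof. by move=> h; apply/val_inj/funext. Qed.

Lemma linfD (G : Type) (v w : linf G) g : (v + w) g = v g + w g. Proof. by []. Qed.
Lemma linfN (G : Type) (v : linf G) g : (- v) g = - v g. Proof. by []. Qed.
Lemma linfZ (G : Type) a (v : linf G) g : (a *: v) g = a *: v g. Proof. by []. Qed.
Lemma linf_sum (G I : Type) (r : seq I) (P : pred I) (f : I -> linf G) g :
  (\sum_(i <- r | P i) f i) g = \sum_(i <- r | P i) f i g.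
Proof. by elim/big_ind2: _ => [|x1 x2 y1 y2 <- <-|//]. Qed.

Lemma linf_ev_subproof (G : Type) (g : G) :
  (fun v : linf G => v g) \in bounded_linear (linf G) Kline.
Proof.
apply/bounded_linearP; split => //; exists 1 => // v; rewrite mul1r; exact: linf_coord_le.
Qed.
Definition linf_ev (G : Type) (g : G) : dual (linf G) := Bop (linf_ev_subproof g).
Lemma linf_evE (G : Type) (g : G) v : linf_ev g v = v g. Proof. by []. Qed.
Lemma opnorm_linf_ev (G : Type) (g : G) : opnorm (linf_ev g) <= 1.
Proof. by apply: opnorm_le => // v; rewrite mul1r; exact: linf_coord_le. Qed.

Lemma linf_family Y (G : Type) (f : G -> dual Y) M : 0 <= M -> (forall g, opnorm (f g) <= M) ->
  exists2 T : bop Y (linf G), (forall y g, T y g = f g y) & opnorm T <= M.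
Proof.
move=> M0 fM.
have fb y : (fun g => f g y) \in @bounded_family R k G.
  by apply/bounded_familyP; exists (M * rnorm y) => g; exact: rnorm_bop_le.
have [||y|T TE TM] := @bop_exists R k Y (linf G) (fun y => Linf (fb y)) M; last 1 first.
- by exists T => // y g; rewrite TE.
- by move=> a x y; apply: linf_ext => g /=; rewrite (bopP (f g)).1.
- by [].
- by apply: linf_le => [|g /=]; [rewrite mulr_ge0 ?rnorm_ge0 | exact: rnorm_bop_le].
Qed.

Lemma linf_reindex_subproof (G G' : Type) (h : G' -> option G) (v : linf G) :
  (fun g' => if h g' is Some g then v g else 0) \in @bounded_family R k G'.
Proof.
apply/bounded_familyP; exists (rnorm v) => g'; case: (h g') => [g|]; first exact: linf_coord_le.
by rewrite rnorm0 rnorm_ge0.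
Qed.

Lemma linf_reindex_bounded (G G' : Type) (h : G' -> option G) :
  (fun v => Linf (linf_reindex_subproof h v)) \in bounded_linear (linf G) (linf G').
Proof.
apply/bounded_linearP; split=> [a v w|].
  apply: linf_ext => g'; rewrite linfD linfZ /=; case: (h g') => //.
  by rewrite scaler0 addr0.
exists 1 => // v; rewrite mul1r; apply: linf_le => [|g' /=]; first exact: rnorm_ge0.
by case: (h g') => [g|]; [exact: linf_coord_le | rewrite rnorm0 rnorm_ge0].
Qed.

(** Allowing [h] to be undefined covers truncation, extension by zero, repetition of coordinates and
    the passage to one block of coordinates by a single contraction. *)
Definition linf_reindex (G G' : Type) (h : G' -> option G) : bop (linf G) (linf G') :=
  Bop (linf_reindex_bounded h).

Lemma linf_reindexE (G G' : Type) (h : G' -> option G) v g' :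
  linf_reindex h v g' = if h g' is Some g then v g else 0.
Proof. by []. Qed.

Lemma opnorm_reindex (G G' : Type) (h : G' -> option G) : opnorm (linf_reindex h) <= 1.
Proof.
apply: opnorm_le => // v; rewrite mul1r; apply: linf_le => [|g']; first exact: rnorm_ge0.
rewrite linf_reindexE; case: (h g') => [g|]; [exact: linf_coord_le | by rewrite rnorm0 rnorm_ge0].
Qed.

Lemma linf_delta_subproof (i : nat) :
  (fun j => if j == i then (1 : K) else 0) \in @bounded_family R k nat.
Proof.
apply/bounded_familyP; exists 1 => j; case: eqP => _; last by rewrite rnorm0.
by rewrite rnorm_line normr1 -(scalar_of_real1 R k) scalar_of_realK.
Qed.
Definition linf_delta (i : nat) : linf nat := Linf (linf_delta_subproof i).
Lemma linf_deltaE i j : linf_delta i j = if j == i then (1 : K) else 0. Proof. by []. Qed.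

Lemma rnorm1 : rnorm ((1 : K) : Kline) = 1.
Proof. by rewrite rnorm_line normr1 -(scalar_of_real1 R k) scalar_of_realK. Qed.

Lemma linf_truncE (w : linf nat) m : (forall i, (m <= i)%N -> w i = 0) ->
  w = \sum_(i < m) (w i : K) *: linf_delta i.
Proof.
move=> h; apply: linf_ext => j; rewrite linf_sum.
have [jm|mj] := ltnP j m; last first.
  rewrite h// big1// => i _; rewrite linfZ linf_deltaE; case: eqP => [ji|_]; last by rewrite scaler0.
  by move: mj; rewrite ji leqNgt ltn_ord.
rewrite (bigD1 (Ordinal jm))// linfZ linf_deltaE eqxx big1.
  by rewrite Monoid.mulm1 -[_ *: _]/(_ * _) mulr1.
move=> i /andP[_ /eqP ij]; rewrite linfZ linf_deltaE; case: eqP => [ji|_]; last by rewrite scaler0.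
by case: ij; apply/val_inj.
Qed.

Lemma linf_trunc_finite_rank Y (T : bop Y (linf nat)) m :
  (forall y i, (m <= i)%N -> T y i = 0) -> finite_rank Y (linf nat) T.
Proof.
move=> h; exists m, (fun i : 'I_m => linf_delta i) => y; exists (fun i : 'I_m => T y i).
by apply: linf_truncE; exact: h.
Qed.

(** Rounding the values of one family to a finite net of a scalar ball colours [G] by finitely many
    colours; for several families the colourings are combined in a product. *)
Lemma linf_coloring (G : Type) (s : seq (linf G)) (e : R) : 0 < e ->
  exists (F : finType) (c : G -> F), forall v, v \in s ->
    forall g g', c g = c g' -> rnorm (v g - v g') <= e.
Proof.
move=> e0; elim: s => [|v s [F [c cP]]]; first by exists unit, (fun=> tt).
have e2 : 0 < e / 2 by rewrite divr_gt0.
have [t tP] := @scalar_totally_bounded R k (rnorm v) _ e2.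
have near g : exists i : 'I_(size t), rnorm (v g - nth 0 t i) <= e / 2.
  have [y yt vy] := tP (v g) (linf_coord_le v g).
  have i : (index y t < size t)%N by rewrite index_mem.
  by exists (Ordinal i); rewrite /= nth_index.
have [d dP] := choice near.
exists (F * 'I_(size t))%type, (fun g => (c g, d g)) => u; rewrite inE => /orP[/eqP->|us] g g' [cg dg].
  rewrite (le_trans (rnorm_dist _ (nth 0 t (d g)) _))// (splitr e) lerD//.
  by rewrite rnormB dg.
exact: cP.
Qed.

(* [e \bo r] averages over a finite partition of [G] on which the compact set
   of values oscillates by little: this is the metric approximation property
   of [linf G]. *)
Lemma linf_approximation Y (G : Type) (B : bop Y (linf G)) (eps : R) :
  compact_operator Y (linf G) B -> 0 < eps ->
  exists m (r : bop (linf G) (linf nat)) (e : bop (linf nat) (linf G)),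
    [/\ opnorm r <= 1, opnorm e <= 1, forall v i, (m <= i)%N -> r v i = 0 &
        opnorm (B - e \bo r \bo B) <= eps].
Proof.
move=> /compact_operatorP Bc e0; have e3 : 0 < eps / 3 by rewrite divr_gt0.
have [s sP] := Bc _ e3; have [F [c cP]] := linf_coloring s e3.
have : forall f : F, exists o : option G, forall g, c g = f -> exists2 g', o = Some g' & c g' = f.
  move=> f; have [[g cg]|ng] := pselect (exists g, c g = f); first by exists (Some g) => _ _; exists g.
  by exists None => g cg; case: ng; exists g.
move=> /choice[rep repP].
(* Indices from [#|F|] on, and colours that are not attained, give the coordinate 0; this is why [r]
   ends in the first [#|F|] coordinates. *)
pose hr i := if insub i : option 'I_#|F| is Some j then rep (enum_val j) else None.
exists #|F|, (linf_reindex hr), (linf_reindex (fun g => Some (nat_of_ord (enum_rank (c g))))).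
split; [exact: opnorm_reindex|exact: opnorm_reindex| |].
  by move=> v i Fi; rewrite linf_reindexE /hr insubF// ltnNge Fi.
apply: opnorm_le_ball => [|x x1]; first exact: ltW.
have [|y ys Bxy] := sP (B x); first by exists x => //; apply/closed_unit_ballE.
apply: linf_le => [|g]; first exact: ltW.
rewrite bopB linfD linfN !bop_compE !linf_reindexE /hr valK enum_rankK.
have [g' -> cg] := repP (c g) g erefl.
rewrite (le_trans (rnorm_dist _ (y g) _))// (_ : eps = eps / 3 + (eps / 3 + eps / 3)); last by field.
apply: lerD; first by rewrite (le_trans _ Bxy)//; exact: (linf_coord_le (B x - y)).
rewrite (le_trans (rnorm_dist _ (y g') _))// lerD//; first exact: cP.
by rewrite rnormB (le_trans _ Bxy)//; exact: (linf_coord_le (B x - y)).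
Qed.

Lemma linf_embeddingE Y y g : linf_embedding Y y g = (\val g : dual Y) y.
Proof. by []. Qed.

Lemma opnorm_linf_embedding Y : opnorm (linf_embedding Y) <= 1.
Proof.
apply: opnorm_le => // y; rewrite mul1r; apply: linf_le => [|g]; first exact: rnorm_ge0.
have /closed_unit_ballE := set_valP g; rewrite rnorm_bop => g1.
by rewrite linf_embeddingE -[leRHS]mul1r; exact: rnorm_bop_le.
Qed.

Lemma rnorm_linf_embedding Y y : rnorm (linf_embedding Y y) = rnorm y.
Proof.
apply/le_anti/andP; split.
  by rewrite -[leRHS]mul1r; apply: rnorm_bop_le; exact: opnorm_linf_embedding.
have [f fy f1] := norming_functional y.
have fB : closed_unit_ball (dual Y) f by apply/closed_unit_ballE; rewrite rnorm_bop.
have fB' : f \in closed_unit_ball (dual Y) by rewrite inE.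
pose g : closed_unit_ball (dual Y) := SigSub fB'.
have := linf_coord_le (linf_embedding Y y) g.
by rewrite linf_embeddingE /= fy rnorm_line sre_norm_sor ger0_norm ?rnorm_ge0.
Qed.

(** Spaces of bounded families are injective Banach spaces: the Hahn-Banach theorem is applied to
    every coordinate with the same constant. *)
Lemma linf_extension W X (j : bop W X) (C : R) (G : Type) (T : bop W (linf G)) :
  0 <= C -> (forall w, rnorm w <= C * rnorm (j w)) ->
  exists2 T' : bop X (linf G), T' \bo j = T & opnorm T' <= C * opnorm T.
Proof.
move=> C0 jC.
have h g : exists F : dual X, (forall w, F (j w) = T w g) /\ opnorm F <= C * opnorm T.
  have [F FE Fn] := hahn_banach (linf_ev g \bo T) C0 jC.
  exists F; split; first by move=> w; rewrite FE.
  rewrite (le_trans Fn)// ler_wpM2l// (le_trans (opnorm_comp _ _))//.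
  by rewrite ler_piMl ?opnorm_ge0// opnorm_linf_ev.
have [F FP] := choice h.
have [||T' T'E T'n] := @linf_family X G F (C * opnorm T).
- by rewrite mulr_ge0 ?opnorm_ge0.
- by move=> g; have [] := FP g.
exists T' => //; apply: bop_ext => w; apply: linf_ext => g.
by rewrite bop_compE T'E (FP g).1.
Qed.

End LinfTools.

(** * Spaces of summable families and biduals *)

Section L1Tools.
Variables (R : realType) (k : scalar_kind).
Local Notation K := (scalar_field R k).
Local Notation Kline := (scalar_line R k).
Local Notation banach := (completeNormedModType K).
Local Notation sre := (@scalar_re R k).
Local Notation sor := (@scalar_of_real R k).
Implicit Types X Y Z : banach.
Local Notation linf := (linf R k).
Local Notation l1 := (l1 R k).

Section delta.
Variable I : choiceType.

Lemma partial_sum_single (V : zmodType) (i0 : I) (v : V) (A : {fset I}) :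
  partial_sum (fun i => if i == i0 then v else 0) A = if i0 \in A then v else 0.
Proof.
rewrite partial_sum_fset; case: ifPn => [iA|iA].
  rewrite (bigD1_seq i0) ?fset_uniq//= eqxx big1 ?addr0// => i /negbTE ii.
  by rewrite ii.
rewrite big_seq big1// => i ia; case: eqP => // ii; move: ia iA; rewrite ii => ->; by [].
Qed.

Lemma sum_single (X : banach) (i0 : I) (v : X) : sum (fun i => if i == i0 then v else 0) = v.
Proof.
have FF : ProperFilter (@totally I) := totally_filter.
apply: (cvg_lim (@norm_hausdorff _ X)); apply/rcvgP => e e0.
exists [fset i0]%fset => // A /= i0A; rewrite partial_sum_single.
by rewrite (fsubsetP i0A) ?inE// subrr rnorm0 ltW.
Qed.

Lemma l1_delta_subproof (i0 : I) :
  (fun i => if i == i0 then (1 : K) else 0) \in @absolutely_summable R k I.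
Proof.
apply/absolutely_summableP; exists 1 => A.
rewrite (_ : (fun i => _) = (fun i => if i == i0 then 1 else 0)).
  by rewrite partial_sum_single; case: ifP.
by apply/funext => i; case: eqP => _; rewrite ?rnorm0// rnorm1.
Qed.
Definition l1_delta (i : I) : l1 I := L1 (l1_delta_subproof i).
Lemma l1_deltaE i j : l1_delta i j = if j == i then (1 : K) else 0. Proof. by []. Qed.

Lemma rnorm_l1_le (w : l1 I) M : (forall A : {fset I}, \sum_(i <- A) rnorm (w i) <= M) -> rnorm w <= M.
Proof. by move=> h; rewrite rnorm_l1; apply: l1_rnorm_le => A; rewrite partial_sum_fset. Qed.

Lemma rnorm_l1_delta i : rnorm (l1_delta i) <= 1.
Proof.
rewrite rnorm_l1; apply: l1_rnorm_le => A.
rewrite (_ : (fun i => _) = (fun j => if j == i then 1 else 0)).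
  by rewrite partial_sum_single; case: ifP.
by apply/funext => j /=; case: eqP => _; rewrite ?rnorm0// rnorm1.
Qed.

Lemma l1_sumE (J : Type) (r : seq J) (P : pred J) (f : J -> l1 I) i :
  (\sum_(j <- r | P j) f j) i = \sum_(j <- r | P j) f j i.
Proof. by elim/big_ind2: _ => [|x1 x2 y1 y2 <- <-|//]. Qed.

Lemma l1_approx (w : l1 I) (e : R) : 0 < e ->
  exists A : {fset I}, rnorm (w - \sum_(i <- A) (w i : K) *: l1_delta i) <= e.
Proof.
move=> e0; pose p (A : {fset I}) := partial_sum (fun i => rnorm (w i)) A.
have hs : has_sup (range p).
  split; first by exists (p fset0), fset0.
  by exists (l1_rnorm w) => _ [A _ <-]; exact: l1_rnormP.
have [_ [A _ <-] Ae] := sup_adherent e0 hs.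
exists A; apply: rnorm_l1_le => B.
have E i : (w - \sum_(i <- A) (w i : K) *: l1_delta i) i = if i \in A then 0 else w i.
  have -> : (w - \sum_(i <- A) (w i : K) *: l1_delta i) i =
    w i - \sum_(j <- A) (w j : K) *: l1_delta j i by rewrite -(l1_sumE _ _ (fun j => _ *: _)).
  case: ifPn => [iA|iA].
    rewrite (bigD1_seq i) ?fset_uniq//= eqxx big1 ?addr0 => [|j /negbTE ji].
      by rewrite -[_ *: _]/(_ * _) mulr1 subrr.
    by rewrite eq_sym ji scaler0.
  rewrite big_seq big1 ?subr0// => j jA; rewrite l1_deltaE; case: eqP => [ij|_]; last by rewrite scaler0.
  by move: iA; rewrite ij jA.
under eq_bigr do rewrite E.
have : p (A `|` B)%fset <= sup (range p) by apply: ub_le_sup; [exact: hs.2 | exists (A `|` B)%fset].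
rewrite /p (partial_sum_split _ (fsubsetUl A B)) -/(p A) => h.
have h2 : partial_sum (fun i => rnorm (w i)) ((A `|` B) `\` A)%fset <= e.
  by move: h; rewrite -lerBrDl => /le_trans; apply; rewrite lerBlDl -lerBlDr ltW.
rewrite (le_trans _ h2)// partial_sum_fset.
rewrite (big_fsetID _ (fun i => i \in A)) /= big1_fset ?add0r => [|i]; last first.
  by rewrite !inE => /andP[_ iA] _; rewrite iA rnorm0.
have -> : [fset x | x in B & x \notin A]%fset = ((A `|` B) `\` A)%fset.
  by apply/fsetP => i; rewrite !inE; case: (i \in A); rewrite ?andbT ?andbF.
rewrite big_seq [leRHS]big_seq; apply: ler_sum => i; rewrite !inE => /andP[iA _].
by rewrite (negbTE iA).
Qed.

Lemma l1_ext (X : banach) (S T : bop (l1 I) X) : (forall i, S (l1_delta i) = T (l1_delta i)) -> S = T.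
Proof.
move=> h; apply: bop_ext => w; apply: limit_unique => e e0.
have M0 : 0 < opnorm (S - T) + 1 by rewrite ltr_wpDl ?opnorm_ge0.
have [A Ae] := l1_approx w (divr_gt0 e0 M0).
rewrite -bopB -[w](subrK (\sum_(i <- A) (w i : K) *: l1_delta i)) bopDr bop_sumr.
rewrite [X in _ + X]big1 ?addr0 => [|i _]; last by rewrite bopZr bopB h subrr scaler0.
rewrite (le_trans (opnormP _ _))// (le_trans (ler_wpM2l (opnorm_ge0 _) Ae))//.
by rewrite mulrCA ler_piMr ?(ltW e0)// ler_pdivrMr// mul1r lerDl.
Qed.

Lemma l1_family (X : banach) (x : I -> X) M : 0 <= M -> (forall i, rnorm (x i) <= M) ->
  exists2 T : bop (l1 I) X, (forall i, T (l1_delta i) = x i) & opnorm T <= M.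
Proof.
move=> M0 xM.
have FF : ProperFilter (@totally I) := totally_filter.
have bd (w : l1 I) (A : {fset I}) : partial_sum (fun i => rnorm ((w i : K) *: x i)) A <= M * l1_rnorm w.
  rewrite (le_trans (y := M * partial_sum (fun i => rnorm (w i)) A))//.
    rewrite /partial_sum mulr_sumr; apply: ler_sum => i _.
    by rewrite rnorm_scale mulrC ler_wpM2r ?rnorm_ge0.
  by rewrite ler_wpM2l// l1_rnormP.
pose f (w : l1 I) := sum (fun i => (w i : K) *: x i).
have fl : linear f.
  move=> a v w; have [cv _] := absolute_sum (bd v); have [cw _] := absolute_sum (bd w).
  apply: (cvg_lim (@norm_hausdorff _ X)).
  have -> : partial_sum (fun i => ((a *: v + w : l1 I) i : K) *: x i) =
      (fun A => a *: partial_sum (fun i => (v i : K) *: x i) A + partial_sum (fun i => (w i : K) *: x i) A).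
    apply/funext => A; rewrite /partial_sum scaler_sumr -big_split /=.
    by apply: eq_bigr => i _; rewrite scalerA -scalerDl.
  by apply: cvgD; [apply: cvgZl_tmp; exact: cv | exact: cw].
have [|T TE TM] := bop_exists fl M0.
  by move=> w; rewrite rnorm_l1; have [] := absolute_sum (bd w).
exists T => // i; rewrite TE /f -[RHS](sum_single i); congr sum; apply/funext => j.
by rewrite l1_deltaE; case: eqP => [->|_]; rewrite ?scale1r ?scale0r.
Qed.

Lemma l1_pairing : exists2 p : bop (linf I) (dual (l1 I)),
  (forall v i, p v (l1_delta i) = v i) & opnorm p <= 1.
Proof.
have h (v : linf I) : exists f : dual (l1 I), (forall i, f (l1_delta i) = v i) /\ opnorm f <= rnorm v.
  have [f fE fn] := @l1_family Kline (fun i => v i) (rnorm v) (rnorm_ge0 v) (linf_coord_le v).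
  by exists f.
have [f fP] := choice h.
have fl : linear f.
  move=> a v w; apply: l1_ext => i; rewrite bopD bopZ !(fP _).1.
  by [].
have [|p pE p1] := bop_exists fl ler01; last by exists p => // v i; rewrite pE (fP v).1.
by move=> v; rewrite mul1r rnorm_bop; have [] := fP v.
Qed.

End delta.

Lemma l1_quotient_delta X (b : closed_unit_ball X) : l1_quotient X (l1_delta b) = \val b.
Proof.
rewrite -[RHS](sum_single b); congr sum; apply/funext => j.
by rewrite l1_deltaE; case: eqP => [->|_]; rewrite ?scale1r ?scale0r.
Qed.

Lemma opnorm_l1_quotient X : opnorm (l1_quotient X) <= 1.
Proof.
apply: opnorm_le => // w; rewrite mul1r rnorm_l1.
by have [] := absolute_sum (@l1_sum_bound R k X w).
Qed.

Lemma bidual_subproof X :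
  exists j : bop X (dual (dual X)), forall x f, j x f = f x.
Proof.
have h (x : X) : exists e : dual (dual X), (forall f, e f = f x) /\ opnorm e <= rnorm x.
  have [||f|e eE en] := @bop_exists R k (dual X) Kline (fun f => f x) (rnorm x); last by exists e.
  - by [].
  - exact: rnorm_ge0.
  - by rewrite rnorm_bop mulrC; exact: opnormP.
have [e eP] := choice h.
have el : linear e.
  by move=> a x y; apply: bop_ext => f; rewrite bopD bopZ !(eP _).1 (bopP f).1.
have [|j jE _] := bop_exists el ler01; last by exists j => x f; rewrite jE (eP x).1.
by move=> x; rewrite mul1r rnorm_bop; have [] := eP x.
Qed.
Definition bidual_embedding X : bop X (dual (dual X)) := projT1 (cid (bidual_subproof X)).
Lemma bidual_embeddingE X (x : X) f : bidual_embedding X x f = f x.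
Proof. exact: (projT2 (cid (bidual_subproof X))). Qed.

Lemma rnorm_bidual X (x : X) : rnorm (bidual_embedding X x) = rnorm x.
Proof.
apply/le_anti/andP; split.
  rewrite rnorm_bop; apply: opnorm_le => [|f]; first exact: rnorm_ge0.
  by rewrite bidual_embeddingE rnorm_bop mulrC; exact: opnormP.
apply: rnorm_le_dual => f f1; rewrite -bidual_embeddingE.
rewrite (le_trans (opnormP _ f))// rnorm_bop -[leRHS]mulr1 [rnorm (bidual_embedding X x)]rnorm_bop.
by rewrite ler_wpM2l ?opnorm_ge0.
Qed.

End L1Tools.

(** * Closed subspaces and quotients *)

Section Renorming.
Variables (R : realType) (k : scalar_kind).
Local Notation K := (scalar_field R k).
Local Notation banach := (completeNormedModType K).
Local Notation sre := (@scalar_re R k).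
Local Notation sor := (@scalar_of_real R k).

(** One description covers closed subspaces with the inherited norm, ranges with a quotient norm and
    interpolation spaces. Completeness is asked along sequences with geometric steps, where
    increments can be lifted and summed. *)
Record renorming (E : banach) := Renorming {
  rn_set : set E;
  rn_norm : E -> R;
  rn_lin : forall a x y, rn_set x -> rn_set y -> rn_set (a *: x + y);
  rn_zero : rn_set 0;
  rn_norm_ge0 : forall x, 0 <= rn_norm x;
  rn_normD : forall x y, rn_set x -> rn_set y -> rn_norm (x + y) <= rn_norm x + rn_norm y;
  rn_normZ : forall a x, rn_set x -> rn_norm (a *: x) <= sre `|a| * rn_norm x;
  rn_dom : exists2 C, 0 <= C & forall x, rn_set x -> rnorm x <= C * rn_norm x;
  rn_complete : forall u : nat -> E, (forall n, rn_set (u n)) ->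
    (forall n, rn_norm (u n.+1 - u n) <= 2^-1 ^+ n) ->
    exists2 x, rn_set x & forall e, 0 < e -> exists N, forall n, (N <= n)%N ->
      rn_norm (x - u n) <= e
}.

Section renormed_space.
Variables (E : banach) (D : renorming E).

Definition rn_pred : {pred E} := mem [set x | rn_set D x].

Record renormed := Renormed { rn_val :> E; rn_subproof : rn_val \in rn_pred }.

HB.instance Definition _ := [isSub of renormed for rn_val].
HB.instance Definition _ := [Choice of renormed by <:].

Lemma rn_predP x : reflect (rn_set D x) (x \in rn_pred).
Proof. by apply: (iffP idP); rewrite inE. Qed.

Lemma rn_submod_closed : submod_closed rn_pred.
Proof.
split=> [|a x y /rn_predP Px /rn_predP Py]; apply/rn_predP; [exact: rn_zero | exact: rn_lin].
Qed.

HB.instance Definition _ := GRing.isSubmodClosed.Build K E rn_pred rn_submod_closed.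
HB.instance Definition _ := [SubChoice_isSubLmodule of renormed by <:].

Lemma rn_valP (x : renormed) : rn_set D x. Proof. exact/rn_predP/rn_subproof. Qed.

Definition rn_knorm (x : renormed) : K := sor (rn_norm D x).

Lemma rn_knormD (x y : renormed) : rn_knorm (x + y) <= rn_knorm x + rn_knorm y.
Proof. by rewrite -scalar_of_realD scalar_of_real_le; apply: rn_normD; exact: rn_valP. Qed.

Lemma rn_knormZ a (x : renormed) : rn_knorm (a *: x) = `|a| * rn_knorm x.
Proof.
rewrite -(scalar_reK (normr_ge0 a)) -scalar_of_realM; congr sor.
apply: (normZ_of_le (N := fun x : renormed => rn_norm D x)) => [y|{}a y].
  exact: rn_norm_ge0.
by apply: rn_normZ; exact: rn_valP.
Qed.

Lemma rn_knorm0_eq0 (x : renormed) : rn_knorm x = 0 -> x = 0.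
Proof.
rewrite -(scalar_of_real0 R k) => /(can_inj (@scalar_of_realK R k)) x0.
apply/val_inj/rnorm0_eq0/le_anti; rewrite rnorm_ge0 andbT.
have [C C0 h] := rn_dom D; have := h _ (rn_valP x).
by rewrite x0 mulr0.
Qed.

HB.instance Definition _ := Lmodule_isNormed.Build K renormed
  rn_knormD rn_knormZ rn_knorm0_eq0.

Lemma rnorm_renormed (x : renormed) : rnorm x = rn_norm D x.
Proof. exact: scalar_of_realK. Qed.

Lemma renormed_complete (F : set_system renormed) : ProperFilter F -> cauchy F -> cvg F.
Proof.
move=> FF /rcauchyP Fc.
have h n : exists A, F A /\ forall x y, A x -> A y -> rnorm (x - y) <= 2^-1 ^+ n.
  by have [|A FA A2] := Fc (2^-1 ^+ n); [rewrite exprn_gt0 ?invr_gt0 | exists A].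
have [A AP] := choice h.
have FB n : F [set x | forall i, (i <= n)%N -> A i x].
  elim: n => [|n IH]; first by apply: filterS (AP 0%N).1 => x Ax i; rewrite leqn0 => /eqP->.
  apply: filterS (filterI IH (AP n.+1).1) => x [xn xn1] i.
  by rewrite leq_eqVlt => /orP[/eqP->|/xn].
have [u uP] := choice (fun n => filter_ex (FB n)).
have [|n|x Dx xu] := @rn_complete _ D (fun n => rn_val (u n)).
- by move=> n; exact: rn_valP.
- have := (AP n).2 _ _ (uP n.+1 n (leqnSn n)) (uP n n (leqnn n)).
  by rewrite rnorm_renormed.
have xP : x \in rn_pred by apply/rn_predP.
apply/cvg_ex; exists (Renormed xP); apply/rcvgP => e e0.
have e2 : 0 < e / 2 by rewrite divr_gt0.
have [N xN] := xu _ e2; have [M /(_ (maxn N M)) Me] := half_pow_small 1 e2.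
rewrite leq_maxr mul1r in Me.
apply: filterS (AP (maxn N M)).1 => y Ay.
rewrite (le_trans (rnorm_dist _ (u (maxn N M)) _))// (splitr e) lerD//.
  by rewrite rnorm_renormed /= xN// leq_maxl.
by apply: le_trans (Me isT); apply: (AP _).2 => //; exact: (uP _ _ (leqnn _)).
Qed.

HB.instance Definition _ := Uniform_isComplete.Build renormed renormed_complete.

Lemma renormed_inclusion : exists j : bop renormed E, forall x, j x = rn_val x.
Proof.
have [C C0 h] := rn_dom D.
have [|||j jE _] := @bop_exists R k renormed E rn_val C; last by exists j.
- by [].
- by [].
- by move=> x; rewrite rnorm_renormed; apply: h; exact: rn_valP.
Qed.

End renormed_space.

Implicit Types X Y Z : banach.

Lemma closed_subspace X (P : set X) :
  P 0 -> (forall a x y, P x -> P y -> P (a *: x + y)) ->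
  (forall x, (forall e, 0 < e -> exists2 y, P y & rnorm (x - y) <= e) -> P x) ->
  exists (D : banach) (j : bop D X),
    (forall d, rnorm (j d) = rnorm d) /\ (forall x, P x <-> exists d, j d = x).
Proof.
move=> P0 Pl Pc.
have cmpl (u : nat -> X) : (forall n, P (u n)) -> (forall n, rnorm (u n.+1 - u n) <= 2^-1 ^+ n) ->
    exists2 x, P x & forall e, 0 < e -> exists N, forall n, (N <= n)%N -> rnorm (x - u n) <= e.
  move=> Pu un; have [|l ln] := @fast_cauchy R k X u 1; first by move=> n; rewrite mul1r.
  have lc e : 0 < e -> exists N, forall n, (N <= n)%N -> rnorm (l - u n) <= e.
    move=> e0; have [N Ne] := half_pow_small (2 * 1) e0.
    by exists N => n /Ne; exact: le_trans.
  exists l => //; apply: Pc => e /lc[N /(_ N (leqnn N)) Ne]; by exists (u N).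
have dom : exists2 C : R, 0 <= C & forall x, P x -> rnorm x <= C * rnorm x.
  by exists 1 => // x _; rewrite mul1r.
have NZ a (x : X) : P x -> rnorm (a *: x) <= sre `|a| * rnorm x by rewrite rnormZ.
pose D := @Renorming X P (@rnorm R k X) Pl P0 (@rnorm_ge0 R k X) (fun x y _ _ => rnormD x y)
  NZ dom cmpl.
have [j jE] := renormed_inclusion D.
exists (renormed D), j; split=> [d|x]; first by rewrite jE rnorm_renormed.
split=> [Px|[d <-]]; last by rewrite jE; exact: (rn_valP d).
have xP : x \in rn_pred D by apply/rn_predP.
by exists (Renormed xP); rewrite jE.
Qed.

(* The quotient of [E] by the kernel of [q] is realized as the range of [q]
   with the quotient norm. *)
Lemma quotient_space (E F : banach) (q : bop E F) :
  exists (Q : banach) (p : bop E Q),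
    [/\ opnorm p <= 1, forall x, p x = 0 <-> q x = 0 &
        forall z, exists2 x, p x = z & rnorm x <= 2 * rnorm z].
Proof.
pose P : set F := range q.
pose S z := [set rnorm x | x in [set x | q x = z]].
pose N z := inf (S z).
have Slb z : lbound (S z) 0 by move=> _ [x _ <-]; exact: rnorm_ge0.
have Sinf z : P z -> has_inf (S z).
  by move=> [x _ <-]; split; [exists (rnorm x), x | exists 0; exact: Slb].
have Nle x : N (q x) <= rnorm x by apply: ge_inf; [exists 0; exact: Slb | exists x].
have Nadh z e : P z -> 0 < e -> exists2 x, q x = z & rnorm x < N z + e.
  by move=> Pz e0; have [_ [x qx <-] xe] := inf_adherent e0 (Sinf z Pz); exists x.
have N0 z : 0 <= N z.
  have [Pz|nP] := pselect (P z); first by apply: lb_le_inf; [exact: (Sinf z Pz).1 | exact: Slb].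
  rewrite /N (_ : S z = set0) ?inf0// -subset0 => y [x qx _]; by apply: nP; exists x.
have Pl a x y : P x -> P y -> P (a *: x + y).
  by move=> [u _ <-] [v _ <-]; exists (a *: u + v) => //; rewrite bopDr bopZr.
have P0 : P 0 by exists 0 => //; rewrite bop0r.
have ND x y : P x -> P y -> N (x + y) <= N x + N y.
  move=> Px Py; apply/ler_addgt0Pr => e e0; have e2 : 0 < e / 2 by rewrite divr_gt0.
  have [u <- ux] := Nadh _ _ Px e2; have [v <- vy] := Nadh _ _ Py e2.
  rewrite -bopDr (le_trans (Nle _))// (le_trans (rnormD _ _))//.
  by rewrite [e]splitr addrACA lerD// ltW.
have NZ a x : P x -> N (a *: x) <= sre `|a| * N x.
  move=> Px; apply/ler_addgt0Pr => e e0.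
  have a0 : 0 < sre `|a| + 1 by rewrite ltr_wpDl ?scalar_re_ge0.
  have [u ux uN] := Nadh _ _ Px (divr_gt0 e0 a0).
  rewrite -ux -bopZr (le_trans (Nle _))// rnormZ ux.
  rewrite (le_trans (ler_wpM2l _ (ltW uN))) ?scalar_re_ge0// mulrDr lerD2l mulrCA.
  by rewrite ler_piMr ?(ltW e0)// ler_pdivrMr// mul1r lerDl.
have dom : exists2 C : R, 0 <= C & forall x, P x -> rnorm x <= C * N x.
  exists (opnorm q) => [|x Px]; first exact: opnorm_ge0.
  apply/ler_addgt0Pr => e e0; have a0 : 0 < opnorm q + 1 by rewrite ltr_wpDl ?opnorm_ge0.
  have [u ux uN] := Nadh _ _ Px (divr_gt0 e0 a0).
  rewrite -{1}ux (le_trans (opnormP _ _))//.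
  rewrite (le_trans (ler_wpM2l (opnorm_ge0 _) (ltW uN)))// mulrDr lerD2l mulrCA.
  by rewrite ler_piMr ?(ltW e0)// ler_pdivrMr// mul1r lerDl.
have cmpl (u : nat -> F) : (forall n, P (u n)) -> (forall n, N (u n.+1 - u n) <= 2^-1 ^+ n) ->
    exists2 x, P x & forall e, 0 < e -> exists N', forall n, (N' <= n)%N -> N (x - u n) <= e.
  move=> Pu un; have [x0 _ x0u] := Pu 0%N.
  (* The increments are lifted to [E] with geometric norms; the image of the sum of the lifts,
     shifted by a lift of the first term, is the limit. *)
  have hd n : exists d, q d = u n.+1 - u n /\ rnorm d <= 2 * 2^-1 ^+ n.
    have e0 : 0 < 2^-1 ^+ n :> R by rewrite exprn_gt0 ?invr_gt0.
    have Pd : P (u n.+1 - u n) by rewrite addrC -scaleN1r; exact: Pl.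
    have [d qd dn] := Nadh _ _ Pd e0; exists d; split => //.
    by rewrite (le_trans (ltW dn))// mulr_natl mulr2n lerD2r.
  have [d dP] := choice hd.
  have [|l ln] := @fast_series R k E d 2; first by move=> n; exact: (dP n).2.
  exists (q (x0 + l)); first by exists (x0 + l).
  have E1 n : q (x0 + l) - u n = q (l - \sum_(i < n) d i).
    rewrite bopBr bop_sumr bopDr x0u.
    have -> : \sum_(i < n) q (d i) = u n - u 0%N.
      elim: n => [|n IH]; first by rewrite big_ord0 subrr.
      by rewrite big_ord_recr /= IH (dP n).1 addrC addrA subrK.
    by rewrite opprB addrA [u 0%N + _]addrC.
  move=> e e0; have [N' Ne] := half_pow_small (2 * 2) e0.
  by exists N' => n /Ne; apply: le_trans; rewrite E1 (le_trans (Nle _)).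
pose D := @Renorming F P N Pl P0 N0 ND NZ dom cmpl.
have qP x : q x \in rn_pred D by apply/rn_predP; exists x.
have [|||p pE p1] := @bop_exists R k E (renormed D) (fun x => Renormed (qP x)) 1.
- by move=> a x y; apply/val_inj => /=; rewrite bopDr bopZr.
- by [].
- by move=> x; rewrite mul1r rnorm_renormed; exact: Nle.
exists (renormed D), p; split=> // [x|z].
  rewrite pE; split=> [/(congr1 val)//|qx]; exact/val_inj.
have [->|z0] := eqVneq z 0; first by exists 0; rewrite ?bop0r// !rnorm0 mulr0.
have z0' : 0 < rn_norm D z by rewrite -rnorm_renormed rnorm_gt0.
(* The infimum defining the quotient norm need not be attained; allowing an error equal to the norm
   itself explains the factor 2. *)
have [x qx xN] := Nadh _ _ (rn_valP z) z0'.
exists x; first by rewrite pE; exact/val_inj.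
by rewrite rnorm_renormed mulr_natl mulr2n ltW.
Qed.

End Renorming.

(** * Products *)

Definition banach_prod (R : realType) (k : scalar_kind)
  (X Y : completeNormedModType (scalar_field R k)) : Type := (X * Y)%type.

HB.instance Definition _ (R : realType) (k : scalar_kind)
  (X Y : completeNormedModType (scalar_field R k)) :=
  NormedModule.copy (banach_prod X Y) (X * Y)%type.

Section Products.
Variables (R : realType) (k : scalar_kind).
Local Notation K := (scalar_field R k).
Local Notation banach := (completeNormedModType K).
Variables X Y : banach.
Implicit Types z : banach_prod X Y.

Lemma rnorm_pair_le z M : rnorm z.1 <= M -> rnorm z.2 <= M -> rnorm z <= M.
Proof.
rewrite !rnorm_le prod_normE maxEle => h1 h2; by case: ifP.
Qed.

Lemma rnorm_pair1 z : rnorm z.1 <= rnorm z.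
Proof.
rewrite rnorm_le rnormE prod_normE comparable_le_max ?lexx//.
exact: real_comparable (normr_real _) (normr_real _).
Qed.

Lemma rnorm_pair2 z : rnorm z.2 <= rnorm z.
Proof.
rewrite rnorm_le rnormE prod_normE comparable_le_max ?lexx ?orbT//.
exact: real_comparable (normr_real _) (normr_real _).
Qed.

Lemma prod_complete (F : set_system (banach_prod X Y)) : ProperFilter F -> cauchy F -> cvg F.
Proof.
move=> FF /rcauchyP Fc.
have c1 : cvg (fst @ F).
  apply/cauchy_cvgP/rcauchyP => e /Fc[A FA A2]; exists (fst @` A).
    by apply: (filterS (F := F)) FA => z Az; exists z.
  move=> _ _ [x Ax <-] [y Ay <-]; apply: le_trans (A2 _ _ Ax Ay); exact: (rnorm_pair1 (x - y)).
have c2 : cvg (snd @ F).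
  apply/cauchy_cvgP/rcauchyP => e /Fc[A FA A2]; exists (snd @` A).
    by apply: (filterS (F := F)) FA => z Az; exists z.
  move=> _ _ [x Ax <-] [y Ay <-]; apply: le_trans (A2 _ _ Ax Ay); exact: (rnorm_pair2 (x - y)).
apply/cvg_ex; exists ((lim (fst @ F), lim (snd @ F)) : banach_prod X Y); apply/rcvgP => e e0.
have /rcvgP/(_ e e0) h1 := c1; have /rcvgP/(_ e e0) h2 := c2.
apply: (filterS _ (filterI (F := F) h1 h2)) => z [hz1 hz2]; exact: rnorm_pair_le.
Qed.

HB.instance Definition _ := Uniform_isComplete.Build (banach_prod X Y) prod_complete.

Lemma product_space : exists (Z : banach) (i1 : bop X Z) (i2 : bop Y Z) (p1 : bop Z X) (p2 : bop Z Y),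
  [/\ forall x, p1 (i1 x) = x, forall y, p2 (i2 y) = y, forall x, p2 (i1 x) = 0 &
      forall y, p1 (i2 y) = 0] /\
  [/\ opnorm p1 <= 1, opnorm p2 <= 1 & forall x y M, rnorm x <= M -> rnorm y <= M ->
     rnorm (i1 x + i2 y) <= M].
Proof.
have [|||i1 i1E _] := @bop_exists R k X (banach_prod X Y) (fun x => (x, 0)) 1; first 3 last.
have [|||i2 i2E _] := @bop_exists R k Y (banach_prod X Y) (fun y => (0, y)) 1; first 3 last.
have [|||p1 p1E p1n] := @bop_exists R k (banach_prod X Y) X fst 1; first 3 last.
have [|||p2 p2E p2n] := @bop_exists R k (banach_prod X Y) Y snd 1; first 3 last.
exists (banach_prod X Y), i1, i2, p1, p2.
split; first by split=> *; rewrite ?(p1E, p2E, i1E, i2E).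
split=> // x y M xM yM; rewrite i1E i2E; apply: rnorm_pair_le; by rewrite /= ?addr0 ?add0r.
all: first [ by [] | by move=> a x y; apply: injective_projections => //=; rewrite scaler0 addr0
  | by move=> z; rewrite mul1r; apply: rnorm_pair_le => //=; rewrite rnorm0 rnorm_ge0
  | by move=> z; rewrite mul1r; exact: rnorm_pair1
  | by move=> z; rewrite mul1r; exact: rnorm_pair2 ].
Qed.

End Products.

(** * Existence of admissible spaces *)

Section Admissible.
Variables (R : realType) (k : scalar_kind).
Local Notation K := (scalar_field R k).
Local Notation Kline := (scalar_line R k).
Local Notation banach := (completeNormedModType K).
Local Notation sre := (@scalar_re R k).
Local Notation sor := (@scalar_of_real R k).
Implicit Types X Y Z : banach.

(** [V] sends the unit vector of [l1] at a point of [C] to that point. Rounding the points of [C] to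
    a finite net changes [V] by at most [e] and gives finite rank, so [V] is compact. *)
Lemma compact_image_of_ball (E : banach) (C : set E) : compact C ->
  exists (W : banach) (V : bop W E), compact_operator W E V /\
    forall x, C x -> exists2 w, rnorm w <= 1 & V w = x.
Proof.
move=> Cc.
have Ct : totally_bounded C.
  by apply/precompact_totally_bounded/compact_precompact => //; exact: norm_hausdorff.
have [s1 s1P] := Ct 1 ltr01.
pose M := 1 + \sum_(y <- s1) rnorm y.
have M0 : 0 <= M by rewrite addr_ge0// sumr_ge0// => y _; exact: rnorm_ge0.
have CM (i : C) : rnorm (\val i : E) <= M.
  have [y ys iy] := s1P _ (set_valP i).
  rewrite -[\val i](subrK y) (le_trans (rnormD _ _))// lerD//.
  by rewrite (big_rem y)//= lerDl sumr_ge0// => z _; exact: rnorm_ge0.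
have [V VE VM] := l1_family M0 CM.
exists (l1 R k C), V; split; last first.
  move=> x Cx; have xC : x \in C by rewrite inE.
  by exists (l1_delta R k (SigSub xC : C)); [exact: rnorm_l1_delta | rewrite VE].
apply/compact_operator_limit => e e0; have [s sP] := Ct e e0.
have near (i : C) : exists j : 'I_(size s), rnorm (\val i - nth 0 s j) <= e.
  have [y ys iy] := sP _ (set_valP i).
  have h : (index y s < size s)%N by rewrite index_mem.
  by exists (Ordinal h); rewrite /= nth_index.
have [c cP] := choice near.
have hphi (j : 'I_(size s)) : exists f : dual (l1 R k C), forall i, f (l1_delta R k i) = if c i == j then (1 : K) else 0.
  have [||f fE _] := @l1_family R k C Kline (fun i => if c i == j then (1 : K) else 0) 1; last by exists f.
  - by [].
  - by move=> i; case: eqP => _; rewrite ?rnorm0 ?rnorm1.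
have [phi phiE] := choice hphi.
pose S : bop (l1 R k C) E := \sum_(j < size s) rank1 (phi j) (nth 0 s j).
have SE i : S (l1_delta R k i) = nth 0 s (c i).
  rewrite bop_suml (bigD1 (c i))//= phiE eqxx scale1r big1 ?addr0// => j ji.
  by rewrite phiE eq_sym (negbTE ji) scale0r.
exists S; first by apply/finite_rank_compact/finite_rank_sum => j _; exact: finite_rank_rank1.
have [D DE De] := l1_family (ltW e0) cP.
suff -> : V - S = D by [].
by apply: l1_ext => i; rewrite bopB VE SE DE.
Qed.

Section Interpolation.
Variables (W E : banach) (V : bop W E).

(* The [c0] version of the Davis-Figiel-Johnson-Pelczynski space between [W] and
   [E]: [kfun n] is a norm equivalent to that of [E], and [interp] consists of
   the vectors along which [kfun n] tends to [0], with the supremum norm. *)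
Definition kfun_set n (z : E) : set R :=
  [set 2^-1 ^+ n * rnorm w + 2 ^+ n * rnorm (z - V w) | w in setT].
Definition kfun n (z : E) : R := inf (kfun_set n z).

Let pow_ge0 n : 0 <= 2 ^+ n :> R. Proof. exact: exprn_ge0. Qed.
Let half_ge0 n : 0 <= 2^-1 ^+ n :> R. Proof. by rewrite exprn_ge0// invr_ge0. Qed.
Let half_gt0 n : 0 < 2^-1 ^+ n :> R. Proof. by rewrite exprn_gt0// invr_gt0. Qed.

Let kfun_lb n z : lbound (kfun_set n z) 0.
Proof. by move=> _ [w _ <-]; rewrite addr_ge0// mulr_ge0// rnorm_ge0. Qed.

Lemma kfun_le n z w : kfun n z <= 2^-1 ^+ n * rnorm w + 2 ^+ n * rnorm (z - V w).
Proof. by apply: ge_inf; [exists 0; exact: kfun_lb | exists w]. Qed.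

Lemma kfun_ge0 n z : 0 <= kfun n z.
Proof. apply: lb_le_inf => //; by exists (2^-1 ^+ n * rnorm (0 : W) + 2 ^+ n * rnorm (z - V 0)), 0. Qed.

Lemma kfun_adherent n z e : 0 < e ->
  exists w, 2^-1 ^+ n * rnorm w + 2 ^+ n * rnorm (z - V w) < kfun n z + e.
Proof.
move=> e0; have hi : has_inf (kfun_set n z).
  by split; [exists (2^-1 ^+ n * rnorm (0 : W) + 2 ^+ n * rnorm (z - V 0)), 0 | exists 0; exact: kfun_lb].
by have [_ [w _ <-] we] := inf_adherent e0 hi; exists w.
Qed.

Lemma kfunD n x y : kfun n (x + y) <= kfun n x + kfun n y.
Proof.
apply/ler_addgt0Pr => e e0; have e2 : 0 < e / 2 by rewrite divr_gt0.
have [u ux] := kfun_adherent n x e2; have [v vy] := kfun_adherent n y e2.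
rewrite (le_trans (kfun_le n _ (u + v)))// bopDr.
have h1 : 2^-1 ^+ n * rnorm (u + v) <= 2^-1 ^+ n * rnorm u + 2^-1 ^+ n * rnorm v.
  by rewrite -mulrDr ler_wpM2l// rnormD.
have h2 : 2 ^+ n * rnorm (x + y - (V u + V v)) <= 2 ^+ n * rnorm (x - V u) + 2 ^+ n * rnorm (y - V v).
  by rewrite -mulrDr ler_wpM2l// opprD addrACA rnormD.
lra.
Qed.

Lemma kfunZ n a x : kfun n (a *: x) <= sre `|a| * kfun n x.
Proof.
apply/ler_addgt0Pr => e e0; have a0 : 0 < sre `|a| + 1 by rewrite ltr_wpDl ?scalar_re_ge0.
have [u ux] := kfun_adherent n x (divr_gt0 e0 a0).
rewrite (le_trans (kfun_le n _ (a *: u)))// bopZr -scalerBr !rnormZ.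
rewrite [_ ^+ n * _]mulrCA [2 ^+ n * _]mulrCA -mulrDr.
rewrite (le_trans (ler_wpM2l _ (ltW ux))) ?scalar_re_ge0// mulrDr lerD2l mulrCA.
by rewrite ler_piMr ?(ltW e0)// ler_pdivrMr// mul1r lerDl.
Qed.

Lemma kfun_norm n x : kfun n x <= 2 ^+ n * rnorm x.
Proof. by rewrite (le_trans (kfun_le n x 0))// rnorm0 mulr0 add0r bop0r subr0. Qed.

Definition interp_set : set E := [set z | forall e, 0 < e -> exists N, forall n, (N <= n)%N -> kfun n z <= e].
Definition interp_norm (z : E) : R := sup (range (fun n => kfun n z)).

Lemma interp_norm_le z M : 0 <= M -> (forall n, kfun n z <= M) -> interp_norm z <= M.
Proof. by move=> M0 h; apply: sup_le_ge0 => // _ [n _ <-]. Qed.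

Lemma kfun_le_interp_norm z n : interp_set z -> kfun n z <= interp_norm z.
Proof.
move=> /(_ 1 ltr01)[N Nz]; apply: ub_le_sup; last by exists n.
exists (1 + 2 ^+ N * rnorm z) => _ [m _ <-].
have [Nm|mN] := leqP N m; first by rewrite (le_trans (Nz m Nm))// lerDl mulr_ge0 ?rnorm_ge0.
rewrite (le_trans (kfun_norm m z))// (le_trans (y := 2 ^+ N * rnorm z))// ?lerDr//.
by rewrite ler_wpM2r ?rnorm_ge0// ler_weXn2l ?ler1n// ltnW.
Qed.

Lemma interp_lin a x y : interp_set x -> interp_set y -> interp_set (a *: x + y).
Proof.
move=> Px Py e e0; pose M := sre `|a| + 1.
have M0 : 0 < M by rewrite ltr_wpDl ?scalar_re_ge0.
have [N1 h1] := Px _ (divr_gt0 (divr_gt0 e0 (ltr0Sn R 1)) M0).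
have [N2 h2] := Py _ (divr_gt0 e0 (ltr0Sn R 1)).
exists (maxn N1 N2) => n; rewrite geq_max => /andP[/h1 g1 /h2 g2].
rewrite (le_trans (kfunD _ _ _))// (splitr e) lerD// (le_trans (kfunZ _ _ _))//.
rewrite (le_trans (ler_wpM2l (scalar_re_ge0 (normr_ge0 a)) g1))// mulrCA ler_piMr//.
  by rewrite divr_ge0// ltW.
by rewrite ler_pdivrMr// mul1r lerDl.
Qed.

Lemma interp0 : interp_set 0.
Proof.
move=> e e0; exists 0%N => n _; rewrite (le_trans (kfun_norm _ _))// rnorm0 mulr0.
exact: ltW.
Qed.

Lemma interp_norm_ge0 z : 0 <= interp_norm z.
Proof. by apply: sup_ge0 => _ [n _ <-]; exact: kfun_ge0. Qed.

Lemma interp_normD x y : interp_set x -> interp_set y ->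
  interp_norm (x + y) <= interp_norm x + interp_norm y.
Proof.
move=> Px Py; apply: interp_norm_le => [|n]; first by rewrite addr_ge0 ?interp_norm_ge0.
by rewrite (le_trans (kfunD _ _ _))// lerD// kfun_le_interp_norm.
Qed.

Lemma interp_normZ a x : interp_set x -> interp_norm (a *: x) <= sre `|a| * interp_norm x.
Proof.
move=> Px; apply: interp_norm_le => [|n]; first by rewrite mulr_ge0 ?interp_norm_ge0 ?scalar_re_ge0.
by rewrite (le_trans (kfunZ _ _ _))// ler_wpM2l ?scalar_re_ge0// kfun_le_interp_norm.
Qed.

Lemma interp_dom : exists2 C, 0 <= C & forall x, interp_set x -> rnorm x <= C * interp_norm x.
Proof.
exists (opnorm V + 1) => [|x Px]; first by rewrite addr_ge0 ?opnorm_ge0.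
have C0 : 0 < opnorm V + 1 by rewrite ltr_wpDl ?opnorm_ge0.
apply/ler_addgt0Pr => e e0; have [w] := kfun_adherent 0 x (divr_gt0 e0 C0).
rewrite !expr0 !mul1r => wx.
have h := kfun_le_interp_norm 0 Px.
rewrite -[X in rnorm X](subrK (V w)) (le_trans (rnormD _ _))//.
have hV := opnormP V w.
rewrite (le_trans (y := (opnorm V + 1) * (rnorm w + rnorm (x - V w))))//.
  have := mulr_ge0 (opnorm_ge0 V) (rnorm_ge0 (x - V w)); have := rnorm_ge0 w.
  lra.
rewrite -[e](mulfVK (lt0r_neq0 C0)) [e / _ * _]mulrC -mulrDr ler_wpM2l ?(ltW C0)//.
lra.
Qed.

Lemma interp_complete (u : nat -> E) : (forall n, interp_set (u n)) ->
  (forall n, interp_norm (u n.+1 - u n) <= 2^-1 ^+ n) ->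
  exists2 x, interp_set x & forall e, 0 < e -> exists N, forall n, (N <= n)%N ->
    interp_norm (x - u n) <= e.
Proof.
move=> Pu un; have [C C0 hC] := interp_dom.
have PB x y : interp_set x -> interp_set y -> interp_set (x - y).
  by move=> Px Py; rewrite addrC -scaleN1r; exact: interp_lin.
have [|l ln] := @fast_cauchy R k E u C.
  by move=> n; rewrite (le_trans (hC _ _)) ?ler_wpM2l//; exact: PB.
have tail m q : forall n, kfun m (u (n + q)%N - u n) <= 2 * 2^-1 ^+ n.
  elim: q => [|q IH] n.
    rewrite addn0 subrr (le_trans (kfun_norm _ _))// rnorm0 mulr0 mulr_ge0//.
  have -> : u (n + q.+1)%N - u n = (u (n.+1 + q)%N - u n.+1) + (u n.+1 - u n).
    by rewrite addrA subrK addnS.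
  rewrite (le_trans (kfunD _ _ _))//; have := IH n.+1; rewrite exprS.
  have := kfun_le_interp_norm m (PB _ _ (Pu n.+1) (Pu n)).
  by move=> /le_trans/(_ (un n)); lra.
(* For fixed [m] the function [kfun m] is continuous for the norm of [E], so the estimate passes to
   the limit with a bound independent of [m]. *)
have key m n : kfun m (l - u n) <= 2 * 2^-1 ^+ n.
  apply/ler_addgt0Pr => e e0.
  have [q /(_ (n + q)%N (leq_addl _ _)) qe] := half_pow_small (2 ^+ m * (2 * C)) e0.
  have -> : l - u n = (l - u (n + q)%N) + (u (n + q)%N - u n) by rewrite addrA subrK.
  rewrite (le_trans (kfunD _ _ _))// addrC lerD//.
  rewrite (le_trans (kfun_norm _ _))// (le_trans _ qe)//.
  by rewrite -mulrA ler_wpM2l.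
exists l.
  move=> e e0; have e2 : 0 < e / 2 by rewrite divr_gt0.
  have [n /(_ n (leqnn n)) ne] := half_pow_small 2 e2.
  have [N Nu] := Pu n _ e2; exists N => m /Nu mu.
  rewrite -[l](subrK (u n)) (le_trans (kfunD _ _ _))// (splitr e) lerD//.
  exact: le_trans ne.
move=> e e0; have [N Ne] := half_pow_small 2 e0; exists N => n /Ne ne.
by apply: interp_norm_le => [|m]; [exact: ltW | exact: le_trans ne].
Qed.

Definition interp : renorming E := Renorming interp_lin interp0 interp_norm_ge0
  interp_normD interp_normZ interp_dom interp_complete.

Lemma interp_image w : interp_set (V w) /\ interp_norm (V w) <= rnorm w.
Proof.
have h n : kfun n (V w) <= 2^-1 ^+ n * rnorm w.
  by rewrite (le_trans (kfun_le n _ w))// subrr rnorm0 mulr0 addr0.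
split=> [e e0|].
  have [N Ne] := half_pow_small (rnorm w) e0; exists N => n /Ne; apply: le_trans.
  by rewrite mulrC.
apply: interp_norm_le => [|n]; first exact: rnorm_ge0.
rewrite (le_trans (h n))// ler_piMl ?rnorm_ge0// exprn_ile1 ?invr_ge0//.
by rewrite invf_le1// ler1n.
Qed.

(** A vector with [kfun n] at most 1 is, up to [2 * 2^-1 ^+ n], the image of a vector of norm at
    most [2 * 2 ^+ n]; for each [n] these images form a totally bounded set. *)
Lemma interp_totally_bounded : compact_operator W E V ->
  totally_bounded [set z | interp_set z /\ interp_norm z <= 1].
Proof.
move=> Vc; apply: totally_bounded_approx => e e0.
have [n /(_ n (leqnn n)) ne] := half_pow_small 2 e0.
exists [set V w | w in [set w | rnorm w <= 2 * 2 ^+ n]]; first exact: compact_operator_ball.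
move=> z [Pz z1]; have [w wz] := kfun_adherent n z ltr01.
have {}wz : 2^-1 ^+ n * rnorm w + 2 ^+ n * rnorm (z - V w) <= 2.
  by have := kfun_le_interp_norm n Pz; lra.
have a0 := mulr_ge0 (half_ge0 n) (rnorm_ge0 w).
have b0 := mulr_ge0 (pow_ge0 n) (rnorm_ge0 (z - V w)).
exists (V w).
  exists w => //=; rewrite -ler_pdivrMr ?exprn_gt0// -exprVn mulrC; lra.
rewrite (le_trans _ ne)// exprVn ler_pdivlMr ?exprn_gt0// mulrC; lra.
Qed.

Section hump.
Variables (g : dual (renormed interp)) (eps : R).
Hypothesis eps0 : 0 < eps.
Let val := @rn_val R k E interp.

(* Gliding hump: vectors small in [E] with [g z = eps] can be added up with
   almost disjoint humps, so their sums stay bounded for the interpolation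
   norm. *)
Lemma interp_hump : (forall d, 0 < d -> exists z, [/\ rnorm z <= 1, rnorm (val z) <= d & g z = sor eps]) ->
  forall r, exists u, rnorm u <= 2 - 2^-1 ^+ r /\ g u = sor (r%:R * eps).
Proof.
move=> h; elim=> [|r [u [u2 gu]]].
  exists 0; rewrite rnorm0 expr0 mul0r scalar_of_real0 bop0r; split => //; lra.
have Pu := rn_valP u; have eta0 := half_gt0 r.+1.
have [N Nu] := Pu _ eta0.
(* Below [N] the new vector has to be small for [kfun n], which is at most [2 ^+ n] times the norm
   of [E]; from [N] on the old one already is. *)
have d0 : 0 < 2^-1 ^+ r.+1 * 2^-1 ^+ N :> R by rewrite mulr_gt0.
have [z [z1 zd gz]] := h _ d0.
have Pz := rn_valP z.
have eta2 : 2^-1 ^+ r.+1 <= 2^-1 :> R.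
  by rewrite exprS ler_piMr ?invr_ge0// exprn_ile1 ?invr_ge0// invf_le1// ler1n.
exists (u + z); split; last first.
  by rewrite bopDr gu gz -scalar_of_realD -natr1 mulrDl mul1r.
rewrite rnorm_renormed in u2; rewrite rnorm_renormed in z1.
rewrite rnorm_renormed; apply: interp_norm_le => [|n]; first lra.
rewrite (le_trans (kfunD n (val u) (val z)))//.
have [Nn|nN] := leqP N n.
  have := Nu n Nn; have := kfun_le_interp_norm n Pz; rewrite /= in z1; lra.
have : kfun n (val z) <= 2^-1 ^+ r.+1.
  rewrite (le_trans (kfun_norm _ _))// (le_trans (ler_wpM2l (pow_ge0 n) zd))//.
  rewrite mulrCA ler_piMr// exprVn ler_pdivrMr ?exprn_gt0// mul1r.
  by rewrite ler_weXn2l ?ler1n// ltnW.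
have := kfun_le_interp_norm n Pu; rewrite /= in u2; rewrite !exprS; lra.
Qed.

(** Otherwise vectors that violate the inequality for [L = eps / d], normalized to have value [eps],
    are small in [E] and bounded in the interpolation norm; their gliding sums have norm at most 2
    and values beyond [2 * opnorm g], which is absurd. This estimate is what makes the functionals
    of [E] dense. *)
Lemma interp_functional : exists2 L, 0 <= L &
  forall z, rnorm (g z) <= L * rnorm (val z) + eps * rnorm z.
Proof.
apply: contrapT => nL.
have H d : 0 < d -> exists z, [/\ rnorm z <= 1, rnorm (val z) <= d & g z = sor eps].
  move=> d0; apply: contrapT => nz; apply: nL; exists (eps / d) => [|z].
    by rewrite divr_ge0// ltW.
  rewrite leNgt; apply/negP => gz.
  have gz0 : 0 < rnorm (g z).
    rewrite (le_lt_trans _ gz)// addr_ge0// mulr_ge0 ?rnorm_ge0 ?divr_ge0// ?ltW//.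
  apply: nz; pose a : K := sor eps / (g z : K).
  have an : sre `|a| = eps / rnorm (g z).
    by rewrite scalar_re_normM sre_normV sre_norm_sor gtr0_norm.
  have e1 := mulr_ge0 (ltW eps0) (rnorm_ge0 z).
  have e2 : 0 <= eps / d * rnorm (val z) by rewrite mulr_ge0 ?rnorm_ge0 ?divr_ge0// ltW.
  exists (a *: z); split.
  - rewrite rnormZ an mulrAC ler_pdivrMr// mul1r; lra.
  - have -> : val (a *: z) = a *: val z by [].
    rewrite rnormZ an mulrAC ler_pdivrMr// -ler_pdivrMl// mulrA [d^-1 * _]mulrC; lra.
  - rewrite bopZr -[_ *: _]/(_ * _) mulfVK//.
    by move: gz0; rewrite rnorm_gt0.
have [u [u2 gu]] := interp_hump H (Num.bound (2 * opnorm g / eps)).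
have : rnorm (g u) <= opnorm g * 2.
  rewrite (le_trans (opnormP _ _))// ler_wpM2l ?opnorm_ge0// (le_trans u2)// lerBlDr lerDl half_ge0//.
rewrite gu rnorm_line sre_norm_sor.
set b := (Num.bound _)%:R; have hb : 2 * opnorm g / eps < b.
  by apply: archi_boundP; rewrite divr_ge0 ?(ltW eps0)// mulr_ge0// opnorm_ge0.
have b0 : 0 <= b by rewrite /b ler0n.
clearbody b; clear u2 gu; rewrite ltr_pdivrMr// in hb; rewrite ger0_norm; first lra.
exact: mulr_ge0 b0 (ltW eps0).
Qed.

End hump.
End Interpolation.

Lemma admissible_exists (E : banach) (C : set E) : compact C ->
  exists (Z : banach) (i : bop Z E), admissible C i.
Proof.
move=> /compact_image_of_ball[W [V [Vc CV]]].
have [i iE] := renormed_inclusion (interp V).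
exists (renormed (interp V)), i; split.
- by move=> x y; rewrite !iE => /val_inj.
- apply/compact_operatorP; apply: totally_bounded_sub (interp_totally_bounded Vc).
  move=> _ [z /closed_unit_ballE z1 <-]; rewrite iE; split; first exact: (rn_valP z).
  by rewrite rnorm_renormed in z1.
- move=> x /CV[w w1 <-]; have [Pw Nw] := interp_image V w.
  have wP : V w \in rn_pred (interp V) by apply/rn_predP.
  exists (Renormed wP); last by rewrite iE.
  by apply/closed_unit_ballE; rewrite rnorm_renormed (le_trans Nw).
- move=> g e e0; have e4 : 0 < e / 4 by rewrite divr_gt0.
  have [L L0 gL] := interp_functional g e4.
  (* By the estimate [g] is bounded for a norm coming from the product of [E] and [Z]. After
     extension to the product, the part on [E] is the wanted functional and the part on [Z]
     contributes at most [2 * (e / 4)]. *)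
  have [P [i1 [i2 [p1 [p2 [[pi1 pi2 pi3 pi4] [p1n p2n n12]]]]]]] := product_space E (renormed (interp V)).
  pose j := sor L *: (i1 \bo i) + sor (e / 4) *: i2.
  have jn z : rnorm (g z) <= 2 * rnorm (j z).
    have h1 : L * rnorm (i z) <= rnorm (j z).
      have := rnorm_bop_le (j z) p1n; rewrite mul1r; apply: le_trans.
      by rewrite bopD !bopZ bopDr !bopZr bop_compE pi1 pi4 scaler0 addr0 rnormZr ger0_norm.
    have h2 : e / 4 * rnorm z <= rnorm (j z).
      have := rnorm_bop_le (j z) p2n; rewrite mul1r; apply: le_trans.
      by rewrite bopD !bopZ bopDr !bopZr bop_compE pi2 pi3 scaler0 add0r rnormZr gtr0_norm.
    have := gL z; rewrite -iE; lra.
  have [G GE Gn] := hahn_banach_dominated (ler0n R 2) jn.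
  exists (sor L *: (G \bo i1)) => z /closed_unit_ballE z1.
  rewrite -GE /j bopZ bop_compE bopD !bopZ bopDr !bopZr opprD addrA subrr add0r rnormN.
  rewrite -bopZr (le_lt_trans (rnorm_bop_le _ Gn))//.
  have : rnorm (sor (e / 4) *: i2 z) <= e / 4.
    rewrite rnormZr gtr0_norm// ler_piMr// ?(ltW e4)//.
    by have := n12 0 z 1; rewrite bop0r add0r; apply => //; rewrite rnorm0.
  lra.
Qed.
End Admissible.

(** * Quasi-normed operator ideals *)

Section Ideals.
Variables (R : realType) (k : scalar_kind).
Local Notation K := (scalar_field R k).
Local Notation Kline := (scalar_line R k).
Local Notation banach := (completeNormedModType K).
Local Notation sre := (@scalar_re R k).
Local Notation sor := (@scalar_of_real R k).
Implicit Types X Y Z : banach.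
Local Notation linf := (linf R k).
Variable A : operator_ideal R k.
Local Notation alpha := (ideal_norm A).

Lemma ideal_compl X Y Z (U : bop Y Z) (T : bop X Y) : ideal_class A T -> ideal_class A (U \bo T).
Proof. by move=> h; rewrite -(bop_comp1r (U \bo T)); exact: idealM. Qed.

Lemma ideal_compr X Y Z (T : bop Y Z) (V : bop X Y) : ideal_class A T -> ideal_class A (T \bo V).
Proof. by move=> h; rewrite -(bop_comp1l T); exact: idealM. Qed.

Lemma ideal_norm_compl X Y Z (U : bop Y Z) (T : bop X Y) : ideal_class A T ->
  alpha (U \bo T) <= opnorm U * alpha T.
Proof.
move=> h; rewrite -(bop_comp1r (U \bo T)) (le_trans (ideal_normM _ _ h))//.
by rewrite ler_piMr ?opnorm_id// mulr_ge0 ?opnorm_ge0 ?ideal_norm_ge0.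
Qed.

Lemma ideal_norm_compr X Y Z (T : bop Y Z) (V : bop X Y) : ideal_class A T ->
  alpha (T \bo V) <= alpha T * opnorm V.
Proof.
move=> h; rewrite -(bop_comp1l T) (le_trans (ideal_normM _ _ h))// -mulrA.
by rewrite bop_comp1l ler_piMl ?opnorm_id// mulr_ge0 ?opnorm_ge0 ?ideal_norm_ge0.
Qed.

Lemma ideal_norm_compl1 X Y Z (U : bop Y Z) (T : bop X Y) c : ideal_class A T ->
  opnorm U <= 1 -> alpha T <= c -> alpha (U \bo T) <= c.
Proof.
move=> h U1; apply: le_trans; rewrite (le_trans (ideal_norm_compl _ h))//.
by rewrite ler_piMl ?ideal_norm_ge0.
Qed.

Lemma ideal_norm_compr1 X Y Z (T : bop Y Z) (V : bop X Y) c : ideal_class A T ->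
  opnorm V <= 1 -> alpha T <= c -> alpha (T \bo V) <= c.
Proof.
move=> h U1; apply: le_trans; rewrite (le_trans (ideal_norm_compr _ h))//.
by rewrite ler_piMr ?ideal_norm_ge0.
Qed.

Lemma idealZ X Y a (T : bop X Y) : ideal_class A T -> ideal_class A (a *: T).
Proof. by move=> h; rewrite -(bop_comp1l T) -bop_compZl; exact: ideal_compl. Qed.

Lemma idealN X Y (T : bop X Y) : ideal_class A T -> ideal_class A (- T).
Proof. by move=> h; rewrite -scaleN1r; exact: idealZ. Qed.

Lemma ideal_normZ X Y a (T : bop X Y) : ideal_class A T -> alpha (a *: T) <= sre `|a| * alpha T.
Proof.
move=> h; rewrite -{1}(bop_comp1l T) -bop_compZl (le_trans (ideal_norm_compl _ h))//.
rewrite ler_wpM2r ?ideal_norm_ge0// opnormZ ler_piMr ?opnorm_id// scalar_re_ge0//.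
Qed.

Lemma ideal_normZr X Y (r : R) (T : bop X Y) : 0 <= r -> ideal_class A T ->
  alpha (sor r *: T) <= r * alpha T.
Proof. by move=> r0 h; rewrite (le_trans (ideal_normZ _ h))// sre_norm_sor ger0_norm. Qed.

Lemma ideal_normN X Y (T : bop X Y) : ideal_class A T -> alpha (- T) <= alpha T.
Proof.
move=> h; rewrite -scaleN1r (le_trans (ideal_normZ _ h))// normrN normr1.
by rewrite -(scalar_of_real1 R k) scalar_of_realK mul1r.
Qed.

Lemma ideal_finite_rank X Y (T : bop X Y) : finite_rank X Y T -> ideal_class A T.
Proof.
move=> /finite_rank_decomp[[n [g [v ->]]] _].
have r1 (f : dual X) (y : Y) : ideal_class A (rank1 f y).
  have [j jE _] := line_map y.
  have -> : rank1 f y = j \bo bop_id Kline \bo f by apply: bop_ext => x; rewrite rank1E !bop_compE jE.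
  exact/idealM/ideal_id.
elim/big_ind: _ => [|S U|i _]; [|exact: idealD | exact: r1].
have -> : (0 : bop X Y) = rank1 0 0 by apply: bop_ext => x; rewrite rank1E scaler0.
exact: r1.
Qed.

(** Compressing [T] to one dimension by [f] and [x] in the unit balls gives the scalar [f (T x)]
    times the identity, and the identity of the scalars has ideal norm 1; so [rnorm (f (T x))] is at
    most the ideal norm of [T]. *)
Lemma opnorm_le_ideal X Y (T : bop X Y) : ideal_class A T -> opnorm T <= alpha T.
Proof.
move=> h; apply: opnorm_le_ball => [|x x1]; first exact: ideal_norm_ge0.
apply: rnorm_le_dual => f f1.
have [j jE jn] := line_map x.
have [->|c0] := eqVneq (f (T x)) 0; first by rewrite rnorm0 ideal_norm_ge0.
pose c : K := f (T x).
have cE : f \bo T \bo j = c *: bop_id Kline.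
  apply: bop_ext => a; rewrite !bop_compE jE !bopZr bopZ bop_idE.
  exact: mulrC.
have AI : ideal_class A (c *: bop_id Kline) by exact/idealZ/ideal_id.
have : alpha (c^-1 *: (c *: bop_id Kline)) <= sre `|c^-1| * alpha (c *: bop_id Kline) by exact: ideal_normZ.
rewrite scalerA mulVf// scale1r ideal_norm_id sre_normV.
have cp : 0 < sre `|c| by rewrite -[sre _]/(rnorm (f (T x))) rnorm_gt0.
rewrite mulrC ler_pdivlMr// mul1r => /le_trans; apply.
rewrite -cE (le_trans (ideal_normM _ _ h))//.
rewrite (le_trans (y := 1 * alpha T * 1))//; last by rewrite mulr1 mul1r.
by rewrite ler_pM ?mulr_ge0 ?opnorm_ge0 ?ideal_norm_ge0//; [rewrite ler_wpM2r ?ideal_norm_ge0 | exact: le_trans jn x1].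
Qed.

(** Each addition costs a factor [kappa], so tails are summed from their far end: if the first term
    and the rest of a tail are both at most [(2 * kappa)^-1 ^+ n.+1], their sum is at most
    [2 * kappa] times this, that is [(2 * kappa)^-1 ^+ n]. Convergence for the operator norm is what
    identifies the sum later. *)
Lemma ideal_series (kappa : R) X Y (T_ : nat -> bop X Y) :
  1 <= kappa ->
  (forall (X Y : banach) (S T : bop X Y), ideal_class A S -> ideal_class A T ->
    alpha (S + T) <= kappa * (alpha S + alpha T)) ->
  (forall n, ideal_class A (T_ n)) -> (forall n, alpha (T_ n) <= (2 * kappa)^-1 ^+ n.+1) ->
  exists2 T, ideal_class A T & forall e, 0 < e -> exists N, forall n, (N <= n)%N ->
    opnorm (T - \sum_(i < n) T_ i) <= e.
Proof.
move=> k1 kD TA Tn; pose S n := \sum_(i < n) T_ i.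
have k0 : 0 < 2 * kappa by rewrite mulr_gt0// (lt_le_trans ltr01).
have SA n : ideal_class A (S n).
  rewrite /S; elim/big_ind: _ => [|U V|i _]; [|exact: idealD | exact: TA].
  exact/ideal_finite_rank/finite_rank0.
have alpha0 : alpha (0 : bop X Y) <= 0.
  have h : ideal_class A (0 : bop X Y) by exact/ideal_finite_rank/finite_rank0.
  by have := ideal_normZr (lexx 0) h; rewrite scaler0 mul0r.
have tail p : forall n, alpha (S (n + p)%N - S n) <= (2 * kappa)^-1 ^+ n /\
    ideal_class A (S (n + p)%N - S n).
  elim: p => [|p IH] n.
    rewrite addn0 subrr; split; last exact/ideal_finite_rank/finite_rank0.
    by rewrite (le_trans alpha0)// exprn_ge0// invr_ge0 ltW.
  have E : S (n + p.+1)%N - S n = T_ n + (S (n.+1 + p)%N - S n.+1).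
    rewrite addrCA addnS addSn; congr (_ + _).
    by rewrite /S big_ord_recr /= opprD addrCA subrr addr0.
  have [IH1 IH2] := IH n.+1.
  rewrite E; split; last exact: idealD.
  rewrite (le_trans (kD _ _ _ _ (TA n) IH2))//.
  rewrite (le_trans (ler_wpM2l _ (lerD (Tn n) IH1))) ?(le_trans ler01)//.
  have -> x : kappa * (x + x) = 2 * kappa * x by ring.
  by rewrite exprS mulVKf ?gt_eqF.
have small e : 0 < e -> exists N, forall n, (N <= n)%N -> (2 * kappa)^-1 ^+ n <= e.
  move=> e0; have [N Ne] := half_pow_small 1 e0; exists N => n /Ne; rewrite mul1r; apply: le_trans.
  rewrite lerXn2r ?nnegrE ?invr_ge0 ?(ltW k0)// lef_pV2 ?posrE// ler_peMr//.
have [|T AT Tl] := @ideal_complete _ _ A _ _ S SA.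
  move=> e e0; have e2 : 0 < e / 2 by rewrite divr_gt0.
  have [N Ne] := small _ e2; exists N => m n Nm Nn.
  wlog mn : m n Nm Nn / (n <= m)%N.
    move=> h; have [nm|mn] := leqP n m; first exact: h.
    rewrite -opprB (le_lt_trans (ideal_normN _))//; last exact/h/ltnW.
    by apply: idealD; [exact: SA | exact/idealN/SA].
  rewrite -(subnKC mn) (le_lt_trans (tail _ _).1)// (le_lt_trans (Ne n Nn))//.
  by rewrite ltr_pdivrMr// ltr_pMr ?ltr1n.
exists T => // e /Tl[N Ne]; exists N => n /Ne/ltW; apply: le_trans.
rewrite -opnormN opprB; apply: opnorm_le_ideal; apply: idealD; [exact: SA | exact: idealN].
Qed.

(** Spaces of bounded families being injective, the canonical embedding of [Y] factors through [j].
    Injectivity of the ideal is thus available for every operator that is bounded below. *)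
Lemma ideal_injective X Y Z (j : bop Y Z) (C : R) (T : bop X Y) : injective_ideal A -> 0 <= C ->
  (forall y, rnorm y <= C * rnorm (j y)) -> ideal_class A (j \bo T) -> ideal_class A T.
Proof.
move=> Ainj C0 jC AjT.
have <- : class_inj A X Y T = ideal_class A T := congr1 (@^~ T) (Ainj X Y).
rewrite /class_inj /=.
have [r <- _] := linf_extension (linf_embedding Y) C0 jC.
by rewrite -bop_compA; exact: ideal_compl.
Qed.

(* [T] factors through the span of the first [m] unit vectors of [linf nat]: the
   coordinates [g i] carry the norm [M], and [a] carries the ideal norm [c]. The
   predicate [good] keeps track of functionals that are evaluations at vectors,
   so that such a factorization can be transposed. *)
Definition finitely_factored Y (G : Type) (good : set (dual Y)) (c M : R) (T : bop Y (linf G)) :=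
  exists m (g : nat -> dual Y) (a : bop (linf nat) (linf G)),
    [/\ ideal_class A a, alpha a <= c, forall i, (i < m)%N -> good (g i) /\ opnorm (g i) <= M &
        forall y, T y = \sum_(i < m) (g i y : K) *: a (linf_delta R k i)].

Lemma finitely_factoredN Y G good c M (T : bop Y (linf G)) :
  finitely_factored good c M T -> finitely_factored good c M (- T).
Proof.
move=> [m [g [a [Aa ac gM TE]]]]; exists m, g, (- a); split => //; first exact: idealN.
  exact: le_trans (ideal_normN Aa) ac.
by move=> y; rewrite bopNl TE -sumrN; apply: eq_bigr => i _; rewrite bopNl scalerN.
Qed.

(** The two lists of functionals are concatenated. Their common bound [M] is unaffected since
    coordinates carry a supremum norm; only the ideal norms are added, at the price of [kappa]. *)
Lemma finitely_factoredD kappa Y G good c1 c2 M (T1 T2 : bop Y (linf G)) : 0 <= kappa ->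
  (forall (X Y : banach) (S T : bop X Y), ideal_class A S -> ideal_class A T ->
    alpha (S + T) <= kappa * (alpha S + alpha T)) ->
  finitely_factored good c1 M T1 -> finitely_factored good c2 M T2 ->
  finitely_factored good (kappa * (c1 + c2)) M (T1 + T2).
Proof.
move=> k0 kD [m1 [g1 [a1 [Aa1 ac1 gM1 TE1]]]] [m2 [g2 [a2 [Aa2 ac2 gM2 TE2]]]].
pose p1 := @linf_reindex R k nat nat (fun i => if (i < m1)%N then Some i else None).
pose p2 := @linf_reindex R k nat nat (fun i => Some (m1 + i)%N).
exists (m1 + m2)%N, (fun i => if (i < m1)%N then g1 i else g2 (i - m1)%N), (a1 \bo p1 + a2 \bo p2).
have A1 : ideal_class A (a1 \bo p1) by exact: ideal_compr.
have A2 : ideal_class A (a2 \bo p2) by exact: ideal_compr.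
split; first exact: idealD.
- rewrite (le_trans (kD _ _ _ _ A1 A2))// ler_wpM2l// lerD//;
    by apply: ideal_norm_compr1 => //; exact: opnorm_reindex.
- move=> i im; case: ltnP => [/gM1//|mi]; apply: gM2.
  by rewrite ltn_subLR.
- have aE v : (a1 \bo p1 + a2 \bo p2) v = a1 (p1 v) + a2 (p2 v) by [].
  move: aE; move: (a1 \bo p1 + a2 \bo p2) => a aE.
  move=> y; rewrite bopD TE1 TE2 big_split_ord /=; congr (_ + _); apply: eq_bigr => i _.
    rewrite ltn_ord aE (_ : p1 _ = linf_delta R k i); last first.
      apply: linf_ext => j; rewrite linf_reindexE !linf_deltaE; case: ltnP => //.
      by case: eqP => // ->; rewrite leqNgt ltn_ord.
    rewrite (_ : p2 _ = 0) ?bop0r ?addr0//; apply: linf_ext => j.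
    rewrite linf_reindexE linf_deltaE; case: eqP => // ji.
    by have := ltn_ord i; rewrite -ji ltnNge leq_addr.
  rewrite ltnNge leq_addr /= addKn aE (_ : p2 _ = linf_delta R k i); last first.
    by apply: linf_ext => j; rewrite linf_reindexE !linf_deltaE eqn_add2l.
  rewrite (_ : p1 _ = 0) ?bop0r ?add0r//; apply: linf_ext => j.
  rewrite linf_reindexE; case: ltnP => // jm; rewrite linf_deltaE; case: eqP => // ji.
  by move: jm; rewrite ji ltnNge leq_addr.
Qed.

End Ideals.

(** * Factorization of finite rank operators through finite dimensional spaces *)

Section FiniteFactorization.
Variables (R : realType) (k : scalar_kind).
Local Notation K := (scalar_field R k).
Local Notation banach := (completeNormedModType K).
Local Notation sor := (@scalar_of_real R k).
Implicit Types X Y Z : banach.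
Local Notation linf := (linf R k).
Variable A : operator_ideal R k.
Local Notation alpha := (ideal_norm A).
Variable kappa : R.
Hypothesis kappa1 : 1 <= kappa.
Hypothesis kappaD : forall (X Y : banach) (S T : bop X Y),
  ideal_class A S -> ideal_class A T -> alpha (S + T) <= kappa * (alpha S + alpha T).

Let kappa0 : 0 <= kappa. Proof. exact: le_trans kappa1. Qed.

(* [a] is a finite rank operator with generalized inverse [s], so
   [a b = a (e r b) + a s (a (b - e r b))], and the second summand is small. *)
Lemma finitely_factored_comp Y (G H : Type) (good : set (dual Y)) (a : bop (linf G) (linf H))
    (b : bop Y (linf G)) c M : 0 < c -> 0 < M ->
  ideal_class A a -> finite_rank _ _ a -> alpha a <= c ->
  compact_operator Y (linf G) b -> opnorm b <= M -> (forall f : dual (linf G), good (f \bo b)) ->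
  finitely_factored A good (kappa * (c + c)) M (a \bo b).
Proof.
move=> c0 M0 Aa aF ac bc bM bgood.
have [_ [s /finite_rank_decomp[[d [psi [v sE]]] _] asa]] := finite_rank_decomp aF.
pose a' : bop (linf nat) (linf H) := \sum_(l < d) rank1 (linf_ev R k (val l)) (a (v l)).
have Aa' : ideal_class A a'.
  by apply/ideal_finite_rank/finite_rank_sum => l _; exact: finite_rank_rank1.
pose t := alpha a' / c + 1.
have t0 : 0 < t by rewrite ltr_wpDl// divr_ge0 ?ideal_norm_ge0// ltW.
pose Psi := \sum_(l < d) opnorm (psi l).
have Psi0 : 0 <= Psi by apply: sumr_ge0 => l _; exact: opnorm_ge0.
pose B := t * Psi * opnorm a.
have B0 : 0 <= B by rewrite !mulr_ge0 ?opnorm_ge0// ltW.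
(* Scaling by [t] moves the uncontrolled ideal norm of [a'] to the functionals, whose norms are then
   at most [B] times the error of the approximation. As [B] is fixed beforehand, the error can be
   chosen to absorb it. *)
have eta0 : 0 < M / (B + 1) by rewrite divr_gt0// ltr_wpDl.
have [m [r [e [r1 e1 rm eb]]]] := linf_approximation bc eta0.
pose rho := a \bo (b - e \bo r \bo b).
have -> : a \bo b = a \bo e \bo r \bo b + rho.
  by rewrite /rho bop_compBr !bop_compA addrC subrK.
apply: finitely_factoredD => //.
- exists m, (fun i => linf_ev R k i \bo r \bo b), (a \bo e); split.
  + exact: ideal_compr.
  + exact: ideal_norm_compr1.
  + move=> i _; split; first exact: bgood.
    rewrite (le_trans (opnorm_comp _ _))// (le_trans _ bM)// ler_piMl ?opnorm_ge0//.
    rewrite (le_trans (opnorm_comp _ _))// -[leRHS]mulr1.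
    by rewrite ler_pM ?opnorm_ge0 ?opnorm_linf_ev.
  + move=> y; rewrite !bop_compE {1}(linf_truncE (rm (b y))) !bop_sumr.
    by apply: eq_bigr => i _; rewrite !bopZr !bop_compE.
- exists d, (fun l => if insub l : option 'I_d is Some j then sor t *: (psi j \bo rho) else 0),
    (sor t^-1 *: a'); split.
  + exact: idealZ.
  + rewrite (le_trans (ideal_normZr _ Aa')) ?invr_ge0 ?(ltW t0)//.
    rewrite mulrC ler_pdivrMr// /t mulrDr mulr1 mulrCA mulfV ?gt_eqF// mulr1.
    by rewrite lerDl ltW.
  + move=> i id; rewrite insubT /=; split.
      have := bgood (sor t *: (psi (Ordinal id) \bo a \bo (bop_id _ - e \bo r))).
      by congr good; exact: bop_ext.
    rewrite opnormZ sre_norm_sor gtr0_norm//.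
    rewrite (le_trans (y := B * (M / (B + 1))))//; last first.
      by rewrite mulrCA ler_piMr ?(ltW M0)// ler_pdivrMr ?ltr_wpDl// mul1r lerDl.
    rewrite {1}/B -!mulrA ler_wpM2l ?(ltW t0)// (le_trans (opnorm_comp _ _))//.
    rewrite ler_pM ?opnorm_ge0//.
      by rewrite /Psi (bigD1 (Ordinal id))//= lerDl sumr_ge0// => l _; exact: opnorm_ge0.
    by rewrite (le_trans (opnorm_comp _ _))// ler_wpM2l ?opnorm_ge0.
  + move=> y; have -> : rho y = a (s (rho y)).
      by rewrite /rho bop_compE -[in LHS]asa !bop_compE.
    rewrite sE bop_suml bop_sumr; apply: eq_bigr => l _.
    rewrite valK bopZ bopZr bopZ bop_compE.
    have -> : a' (linf_delta R k l) = a (v l).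
      rewrite bop_suml (bigD1 l)// rank1E linf_evE linf_deltaE eqxx scale1r big1 ?Monoid.mulm1//.
      move=> j /andP[_ jl]; rewrite rank1E linf_evE linf_deltaE; case: eqP => [h|_]; last by rewrite scale0r.
      by case/eqP: jl; exact/val_inj.
    rewrite scalerA; congr (_ *: _).
    rewrite -[_ *: _]/(_ * _) mulrAC -scalar_of_realM mulfV ?gt_eqF// scalar_of_real1.
    by rewrite mul1r.
Qed.

(** [P] is a projection onto the range of [T], of unknown norm. Adding the correction
    [P - e \bo r \bo P], of norm at most 1, to the contraction [e \bo r] gives an operator that
    fixes this range. *)
Lemma finite_rank_left_unit Y (G : Type) (T : bop Y (linf G)) : finite_rank _ _ T ->
  exists S : bop (linf G) (linf G), [/\ finite_rank _ _ S, opnorm S <= 2 & S \bo T = T].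
Proof.
move=> TF; have [_ [s sF TsT]] := finite_rank_decomp TF.
pose P := T \bo s; have PF : finite_rank _ _ P by exact: finite_rank_compr.
have [m [r [e [r1 e1 rm eP]]]] := linf_approximation (finite_rank_compact PF) (ltr01 : 0 < 1 :> R).
have QF : finite_rank _ _ (e \bo r).
  by apply: finite_rank_compl; exact: linf_trunc_finite_rank rm.
exists (e \bo r + (P - e \bo r \bo P)); split.
- by apply: finite_rankD => //; apply: finite_rankB => //; exact: finite_rank_compl.
- rewrite (le_trans (opnormD _ _))// (_ : 2 = 1 + 1)// lerD//.
  rewrite (le_trans (opnorm_comp _ _))// -[leRHS]mulr1.
  by rewrite ler_pM ?opnorm_ge0.
- rewrite bop_compDl bop_compBl -(bop_compA _ P T) TsT -bop_compA.
  by rewrite addrCA subrr addr0.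
Qed.

Definition approximately_factored Y (H : Type) (good : set (dual Y)) (c M : R) (T : bop Y (linf H)) :=
  exists (G : Type) (a : bop (linf G) (linf H)) (b : bop Y (linf G)),
    [/\ ideal_class A a /\ alpha a <= c, compact_operator _ _ b /\ opnorm b <= M,
        forall f : dual (linf G), good (f \bo b) & T = a \bo b].

(** Each of the two operators may have infinite rank. Composing on the left with a finite rank
    operator that fixes the range of the difference makes both ideal factors finite rank, after
    which they are treated separately. The left unit doubles [c], each factorization gives
    [kappa * (2 * c + 2 * c)], and their difference accounts for the last factor [2 * kappa]. *)
Lemma finite_rank_difference Y (H : Type) (good : set (dual Y)) c M (T1 T2 : bop Y (linf H)) :
  0 < c -> 0 < M -> approximately_factored good c M T1 -> approximately_factored good c M T2 ->
  finite_rank _ _ (T1 - T2) ->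
  finitely_factored A good (8 * kappa ^+ 2 * c) M (T1 - T2).
Proof.
move=> c0 M0 [G1 [a1 [b1 [[Aa1 ac1] [bc1 bM1] g1 E1]]]] [G2 [a2 [b2 [[Aa2 ac2] [bc2 bM2] g2 E2]]]] TF.
have [S [SF S2 ST]] := finite_rank_left_unit TF.
rewrite -ST bop_compBr E1 E2 !bop_compA.
have h G (a : bop (linf G) (linf H)) b : ideal_class A a -> alpha a <= c ->
    compact_operator Y (linf G) b -> opnorm b <= M -> (forall f : dual (linf G), good (f \bo b)) ->
    finitely_factored A good (kappa * (2 * c + 2 * c)) M (S \bo a \bo b).
  move=> Aa ac bc bM bg; apply: finitely_factored_comp => //.
  - by rewrite mulr_gt0.
  - exact: ideal_compl.
  - exact: finite_rank_compr.
  - rewrite (le_trans (ideal_norm_compl _ Aa))// ler_pM ?opnorm_ge0 ?ideal_norm_ge0//.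
have -> : 8 * kappa ^+ 2 * c = kappa * (kappa * (2 * c + 2 * c) + kappa * (2 * c + 2 * c)) by ring.
apply: finitely_factoredD => //; first exact: h.
by apply: finitely_factoredN; exact: h.
Qed.

(** An increment is the difference of two consecutive errors, to which [finite_rank_difference]
    applies; dividing by [8 * kappa ^+ 2] beforehand compensates its constant. The first error is
    [U] itself and is not small: its ideal factor is scaled down to the required bound and [M] takes
    up the rest. *)
Lemma telescoping Y (H : Type) (good : set (dual Y)) (P : set (bop Y (linf H))) (U : bop Y (linf H))
    (c : nat -> R) : (forall n, 0 < c n) ->
  P 0 -> P `<=` finite_rank _ _ ->
  (exists c M, approximately_factored good c M U) ->
  (forall e, 0 < e -> exists2 V, P V & approximately_factored good e e (U - V)) ->
  exists (U_ : nat -> bop Y (linf H)) (M : R),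
    [/\ U_ 0%N = 0, forall n, P (U_ n),
        forall n, finitely_factored A good (c n) (M * 2^-1 ^+ n) (U_ n.+1 - U_ n) &
        forall n, opnorm (U - U_ n.+1) <= 2^-1 ^+ n].
Proof.
move=> cpos P0 PF [c1 [M1 [G [a [b [[Aa ac] [bc bM] bg E]]]]]] h.
pose c' n := c n / (8 * kappa ^+ 2).
have k8 : 0 < 8 * kappa ^+ 2 by rewrite mulr_gt0// exprn_gt0// (lt_le_trans ltr01).
have c'0 n : 0 < c' n by rewrite divr_gt0.
pose t := alpha a / c' 0%N + 1.
have t0 : 0 < t by rewrite ltr_wpDl// divr_ge0 ?ideal_norm_ge0// ltW.
pose M := t * opnorm b + 1.
have M1' : 1 <= M by rewrite lerDr mulr_ge0 ?opnorm_ge0// ltW.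
have M0 : 0 < M by rewrite (lt_le_trans ltr01).
have half0 n : 0 < 2^-1 ^+ n :> R by rewrite exprn_gt0 ?invr_gt0.
have h0 : approximately_factored good (c' 0%N) M U.
  exists G, (sor t^-1 *: a), (sor t *: b); split.
  - split; first exact: idealZ.
    rewrite (le_trans (ideal_normZr _ Aa)) ?invr_ge0 ?(ltW t0)//.
    rewrite mulrC ler_pdivrMr// /t mulrDr mulr1 mulrCA mulfV ?gt_eqF// mulr1.
    by rewrite lerDl ltW.
  - split; first exact: compact_operatorZ.
    by rewrite opnormZ sre_norm_sor gtr0_norm// lerDl.
  - by move=> f; rewrite bop_compZr -bop_compZl; exact: bg.
  - rewrite bop_compZr bop_compZl scalerA -scalar_of_realM mulfV ?gt_eqF//.
    by rewrite scalar_of_real1 scale1r.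
(* The error [U - V n] occurs in two consecutive increments and has to meet the bounds of both. *)
pose d n := Num.min (Num.min (c' n) (c' n.+1)) (2^-1 ^+ n.+1).
have d0 n : 0 < d n by rewrite !lt_min c'0 c'0 half0.
have h' n : exists V, P V /\ approximately_factored good (d n) (d n) (U - V).
  by have [V PV hV] := h _ (d0 n); exists V.
have [V VP] := choice h'.
have le_af c2 c3 M2 M3 T : c2 <= c3 -> M2 <= M3 -> approximately_factored good c2 M2 T ->
    approximately_factored (H := H) good c3 M3 T.
  move=> cc MM [G' [a' [b' [[? ?] [? ?] ? ?]]]]; exists G', a', b'.
  by split => //; split => //; [exact: le_trans cc | exact: le_trans MM].
pose U_ n := if n is n'.+1 then V n' else 0.
have PU n : P (U_ n) by case: n => [//|n]; exact: (VP n).1.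
have dc n : d n <= c' n by rewrite !ge_min lexx.
have dc1 n : d n <= c' n.+1 by rewrite !ge_min lexx orbT.
have dh n : d n <= 2^-1 ^+ n.+1 by rewrite ge_min lexx orbT.
have Mh n : 2^-1 ^+ n <= M * 2^-1 ^+ n by rewrite ler_peMl// ltW.
have hn n : approximately_factored good (c' n) (M * 2^-1 ^+ n) (U - U_ n).
  case: n => [|n]; first by rewrite expr0 mulr1 subr0.
  by apply: le_af (VP n).2 => //; exact: le_trans (dh n) (Mh _).
exists U_, M; split=> // n.
  have -> : U_ n.+1 - U_ n = (U - U_ n) - (U - U_ n.+1).
    by rewrite opprB [RHS]addrC addrA subrK.
  have -> : c n = 8 * kappa ^+ 2 * c' n by rewrite mulrC mulfVK// gt_eqF.
  apply: finite_rank_difference => //; first by rewrite mulr_gt0.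
    apply: le_af (VP n).2 => //; rewrite (le_trans (dh n))// (le_trans _ (Mh n))//.
    by rewrite exprS ler_piMl ?(ltW (half0 _))// invf_le1// ler1n.
  have -> : U - U_ n - (U - U_ n.+1) = U_ n.+1 - U_ n.
    by rewrite opprB [LHS]addrC addrA subrK.
  by apply: finite_rankB; exact: PF.
have [G' [a' [b' [[Aa' a'd] [_ b'd] _ ->]]]] := (VP n).2.
have h1 : 2^-1 ^+ n.+1 <= 1 :> R by rewrite exprn_ile1 ?invr_ge0// invf_le1// ler1n.
rewrite (le_trans (opnorm_comp _ _))// (le_trans (y := 1 * 2^-1 ^+ n.+1))//.
  rewrite ler_pM ?opnorm_ge0//; last exact: le_trans (dh n).
  by rewrite (le_trans (opnorm_le_ideal Aa'))// (le_trans a'd)// (le_trans (dh n)).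
by rewrite mul1r exprS ler_piMl ?(ltW (half0 _))// invf_le1// ler1n.
Qed.

End FiniteFactorization.

(** * Summation in the minimal kernel *)

Section Liftings.
Variables (R : realType) (k : scalar_kind).
Local Notation K := (scalar_field R k).
Local Notation banach := (completeNormedModType K).
Implicit Types X Y Z : banach.
Local Notation linf := (linf R k).

Lemma kernel_space X Z (I : Type) (S : I -> bop X Z) :
  exists (D : banach) (j : bop D X),
    (forall d, rnorm (j d) = rnorm d) /\
    (forall x, (forall i, S i x = 0) <-> exists d, j d = x).
Proof.
apply: closed_subspace => [i|a x y hx hy i|x hx i]; first exact: bop0r.
  by rewrite bopDr bopZr hx hy scaler0 addr0.
apply: limit_unique => e e0; rewrite subr0.
have M0 : 0 < opnorm (S i) + 1 by rewrite ltr_wpDl ?opnorm_ge0.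
have [y hy xy] := hx _ (divr_gt0 e0 M0).
rewrite -[S i x]subr0 -(hy i) -bopBr (le_trans (opnormP _ _))//.
rewrite (le_trans (ler_wpM2l (opnorm_ge0 _) xy))//.
by rewrite mulrCA ler_piMr ?(ltW e0)// ler_pdivrMr// mul1r lerDl.
Qed.

Lemma isometric_inj X Y (j : bop X Y) : (forall x, rnorm (j x) = rnorm x) -> injective j.
Proof.
move=> ji x y jxy; apply/eqP; rewrite -subr_eq0 -rnorm_eq0 -ji bopBr jxy subrr.
by rewrite rnorm0.
Qed.

Lemma isometric_lift D X Z (j : bop D X) (h : bop Z X) :
  (forall d, rnorm (j d) = rnorm d) -> (forall z, exists d, j d = h z) ->
  exists2 h' : bop Z D, j \bo h' = h & opnorm h' <= opnorm h.
Proof.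
move=> ji hj; have [f fE] := choice hj.
have [|||h' h'E h'n] := @bop_exists R k Z D f (opnorm h).
- move=> a x y; apply: (isometric_inj ji).
  by rewrite bopDr bopZr !fE bopDr bopZr.
- exact: opnorm_ge0.
- by move=> z; rewrite -ji fE; exact: opnormP.
by exists h' => //; apply: bop_ext => z; rewrite bop_compE h'E fE.
Qed.

Lemma quotient_lift X Y Z (p : bop X Z) (h : bop X Y) :
  (forall z, exists2 x, p x = z & rnorm x <= 2 * rnorm z) ->
  (forall x, p x = 0 -> h x = 0) ->
  exists2 h' : bop Z Y, h' \bo p = h & opnorm h' <= 2 * opnorm h.
Proof.
move=> ps ph.
have hs z : exists x, p x = z /\ rnorm x <= 2 * rnorm z by have [x ? ?] := ps z; exists x.
have [s sP] := choice hs.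
have hE x y : p x = p y -> h x = h y.
  move=> pxy; apply/eqP; rewrite -subr_eq0 -bopBr; apply/eqP/ph.
  by rewrite bopBr pxy subrr.
have [|||h' h'E h'n] := @bop_exists R k Z Y (h \o s) (2 * opnorm h).
- move=> a x y /=; rewrite -bopZr -bopDr; apply: hE.
  by rewrite bopDr bopZr !(sP _).1.
- by rewrite mulr_ge0 ?opnorm_ge0.
- move=> z /=; rewrite (le_trans (opnormP _ _))// [2 * _]mulrC -mulrA.
  by rewrite ler_wpM2l ?opnorm_ge0// (sP z).2.
by exists h' => //; apply: bop_ext => x; rewrite bop_compE h'E /=; apply: hE; rewrite (sP _).1.
Qed.

(** The vectors spanning the range of [j \bo T] lie in [Z]; a generalized inverse [s] of this
    operator brings them back, since [T = T \bo s \bo (j \bo T)]. *)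
Lemma finite_rank_injective X Y Z (j : bop Y Z) (T : bop X Y) :
  injective j -> finite_rank X Z (j \bo T) -> finite_rank X Y T.
Proof.
move=> ji TF; have [_ [s _ sE]] := finite_rank_decomp TF.
have -> : T = (T \bo s) \bo (j \bo T).
  by apply: bop_ext => x; apply: ji; rewrite -[in LHS](bop_compE j) -[in LHS]sE.
exact: finite_rank_compl.
Qed.

Lemma finite_rank_surjective X Y Z (p : bop X Y) (T : bop Y Z) :
  (forall y, exists x, p x = y) -> finite_rank X Z (T \bo p) -> finite_rank Y Z T.
Proof.
by move=> ps [n [v h]]; exists n, v => y; have [x <-] := ps y; exact: h.
Qed.

(** Families indexed by [nat * G] serve as the countable [linf] sum of copies of [linf G], with the
    usual injections and projections of the summands. *)
Definition block_in (G : Type) (n : nat) : bop (linf G) (linf (nat * G)) :=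
  linf_reindex R k (fun p => if p.1 == n then Some p.2 else None).
Definition block_out (G : Type) (n : nat) : bop (linf (nat * G)) (linf G) :=
  linf_reindex R k (fun g => Some (n, g)).

Lemma block_inE G n v p : block_in G n v p = if p.1 == n then v p.2 else 0.
Proof. by rewrite linf_reindexE; case: ifP. Qed.

Lemma block_outE G n v g : block_out G n v g = v (n, g).
Proof. by []. Qed.

Lemma block_outK G n m v : block_out G n (block_in G m v) = if n == m then v else 0.
Proof. by apply: linf_ext => g; rewrite block_outE block_inE /=; case: eqP. Qed.

Lemma pick_summand (V : zmodType) N n (v : nat -> V) : (n < N)%N ->
  \sum_(i < N) (if n == i then v i else 0) = v n.
Proof.
move=> nN; rewrite (bigD1 (Ordinal nN))//= eqxx big1 ?addr0// => i /eqP h.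
by case: eqP => // ni; case: h; apply/val_inj.
Qed.

End Liftings.

Section Summation.
Variables (R : realType) (k : scalar_kind).
Local Notation K := (scalar_field R k).
Local Notation banach := (completeNormedModType K).
Local Notation sor := (@scalar_of_real R k).
Implicit Types X Y Z : banach.
Local Notation linf := (linf R k).
Local Notation l1 := (l1 R k).
Local Notation block_in := (block_in R k).
Local Notation block_out := (block_out R k).
Variable A : operator_ideal R k.
Local Notation alpha := (ideal_norm A).
Hypothesis Ainj : injective_ideal A.
Variable kappa : R.
Hypothesis kappa1 : 1 <= kappa.
Hypothesis kappaD : forall (X Y : banach) (S T : bop X Y),
  ideal_class A S -> ideal_class A T -> alpha (S + T) <= kappa * (alpha S + alpha T).

Let kappa0 : 0 < kappa. Proof. exact: lt_le_trans kappa1. Qed.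
Let half_gt0 n : 0 < 2^-1 ^+ n :> R. Proof. by rewrite exprn_gt0// invr_gt0. Qed.

(* The first factor makes series converge for the quasi-norm of [A]; the second
   pays for moving a factor [2 ^+ n] from one operator to its neighbours. *)
Definition weight n : R := (2 * kappa)^-1 ^+ n.+1 * 2^-1 ^+ n.

Lemma weight_gt0 n : 0 < weight n.
Proof. by rewrite mulr_gt0// exprn_gt0// invr_gt0 mulr_gt0. Qed.

Lemma scaled_weight X Y (a : bop X Y) n : ideal_class A a -> alpha a <= weight n ->
  alpha (sor (2 ^+ n) *: a) <= (2 * kappa)^-1 ^+ n.+1.
Proof.
move=> Aa aw; have p0 : 0 <= 2 ^+ n :> R by exact: exprn_ge0.
apply: (le_trans (ideal_normZr p0 Aa)); apply: (le_trans (ler_wpM2l p0 aw)).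
by rewrite /weight mulrCA -exprMn mulfV ?pnatr_eq0// expr1n mulr1.
Qed.

(** The factorization is [u \bo V \bo w]: [w] collects the small functionals, [V] is block-diagonal
    with the ideal factors as blocks, and [u] sums the blocks after bringing each back to [X]. *)
Lemma sum_in_class_min X Y (G : Type) (j : bop X (linf G)) (T : bop Y X) (T_ : nat -> bop Y X)
    (good : set (dual Y)) (M : R) :
  (forall x, rnorm (j x) = rnorm x) -> T_ 0%N = 0 ->
  (forall y e, 0 < e -> exists N, forall n, (N <= n)%N -> rnorm (T y - T_ n y) <= e) ->
  (forall n, finitely_factored A good (weight n) (M * 2^-1 ^+ n) (j \bo (T_ n.+1 - T_ n))) ->
  class_min A Y X T.
Proof.
move=> ji T0 Tlim ff; have jinj := isometric_inj ji.
pose D n := T_ n.+1 - T_ n.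
have TD n : T_ n = \sum_(i < n) D i.
  by elim: n => [|n IH]; [rewrite big_ord0 | rewrite big_ord_recr /= -IH addrC subrK].
(* The factor [2 ^+ n] put on the ideal factor will be undone by [2^-1 ^+ n] in [u], whose series
   needs a decay of its own. *)
have data n : exists p : bop (linf nat) (linf G) * bop Y (linf nat),
    [/\ ideal_class A p.1, alpha p.1 <= (2 * kappa)^-1 ^+ n.+1, finite_rank _ _ p.2,
        opnorm p.2 <= `|M| * 2^-1 ^+ n & p.1 \bo p.2 = sor (2 ^+ n) *: (j \bo D n)].
  have [m [g [a [Aa aw gM DE]]]] := ff n.
  have Mn0 : 0 <= `|M| * 2^-1 ^+ n by rewrite mulr_ge0// ltW.
  have [i|f fE fM] := @linf_family R k Y nat (fun i => if (i < m)%N then g i else 0) _ Mn0.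
    case: ltnP => im; last by rewrite opnorm0.
    by rewrite (le_trans (gM i im).2)// ler_wpM2r ?(ltW (half_gt0 _))// ler_norm.
  have ftr y i : (m <= i)%N -> f y i = 0 by move=> mi; rewrite fE ltnNge mi.
  exists (sor (2 ^+ n) *: a, f); split => //=.
  - exact: idealZ.
  - exact: scaled_weight.
  - exact: linf_trunc_finite_rank ftr.
  - apply: bop_ext => y; rewrite bop_compE !bopZ DE; congr (_ *: _).
    rewrite (linf_truncE (ftr y)) bop_sumr; apply: eq_bigr => i _.
    by rewrite bopZr fE ltn_ord.
have [af afP] := choice data.
pose a n := (af n).1; pose f n := (af n).2.
have Aa n : ideal_class A (a n) by case: (afP n).
have aw n : alpha (a n) <= (2 * kappa)^-1 ^+ n.+1 by case: (afP n).
have fF n : finite_rank _ _ (f n) by case: (afP n).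
have fM n : opnorm (f n) <= `|M| * 2^-1 ^+ n by case: (afP n).
have afE n y : a n (f n y) = sor (2 ^+ n) *: j (D n y).
  by have [_ _ _ _] := afP n => /(congr1 (fun S : bop _ _ => S y)).
have DF n : finite_rank _ _ (D n).
  apply: (finite_rank_injective jinj).
  have -> : j \bo D n = sor (2 ^+ n)^-1 *: (a n \bo f n).
    apply: bop_ext => y; rewrite bopZ !bop_compE afE scalerA -scalar_of_realM mulVf ?expf_neq0 ?pnatr_eq0//.
    by rewrite scalar_of_real1 scale1r.
  by apply: finite_rankZ; exact: finite_rank_compl.
(* [P n] inverts [j] on the range of [D n]; its norm is not controlled. *)
have hP n : exists P : bop (linf G) X, finite_rank _ _ P /\ forall y, P (j (D n y)) = D n y.
  have [_ [s sF sE]] := finite_rank_decomp (finite_rank_compl j (DF n)).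
  exists (D n \bo s); split; first exact: finite_rank_compl.
  by move=> y; apply: jinj; rewrite -[in RHS](bop_compE j) -[in RHS]sE.
have [P PP] := choice hP.
have [|n|Vt AVt Vlim] := ideal_series (T_ := fun n => block_in G n \bo a n \bo block_out nat n) kappa1 kappaD.
- by move=> n; apply: idealM.
- apply: ideal_norm_compr1; [exact: ideal_compl | exact: opnorm_reindex|].
  by apply: ideal_norm_compl1 => //; exact: opnorm_reindex.
have VtE n v : block_out G n (Vt v) = a n (block_out nat n v).
  apply: limit_unique => e e0.
  have M0 : 0 < rnorm v + 1 by rewrite ltr_wpDl ?rnorm_ge0.
  have [N /(_ (maxn N n.+1) (leq_maxl _ _))] := Vlim _ (divr_gt0 e0 M0).
  set S := \sum_(i < _) _ => VS.
  have -> : a n (block_out nat n v) = block_out G n (S v).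
    rewrite bop_suml bop_sumr.
    rewrite (eq_bigr (fun i : 'I_(maxn N n.+1) => if n == i then a i (block_out nat i v) else 0)).
      by rewrite (@pick_summand _ _ _ (fun i => a i (block_out nat i v))) ?leq_maxr.
    by move=> i _; rewrite !bop_compE block_outK.
  rewrite -bopBr (le_trans (rnorm_bop_le _ (opnorm_reindex _ _ _)))// mul1r -bopB.
  rewrite (le_trans (opnormP _ _))// (le_trans (ler_wpM2r (rnorm_ge0 _) VS))//.
  by rewrite mulrAC ler_pdivrMr// ler_wpM2l ?(ltW e0)// lerDl.
(* In the common kernel of the [S n] every block is fixed by [j \bo P n], so [P n] preserves its
   norm there because [j] is isometric. [LL] is the part of the domain that [Vt] maps into this
   kernel. *)
pose S n := block_out G n - j \bo P n \bo block_out G n.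
have SE n v : S n v = 0 <-> block_out G n v = j (P n (block_out G n v)).
  by rewrite bopB; split=> [/eqP|->]; [rewrite subr_eq0 => /eqP | rewrite subrr].
have [MM [jM [jMi jMP]]] := kernel_space S.
have [LL [jL [jLi jLP]]] := kernel_space (fun n => S n \bo Vt).
have [z|V VE _] := isometric_lift (h := Vt \bo jL) jMi.
  by apply/(jMP _).1 => n; have := (jLP (jL z)).2 => /(_ (ex_intro _ z erefl) n).
have AV : ideal_class A V.
  apply: (ideal_injective (j := jM) (C := 1)) => //; first by move=> y; rewrite mul1r jMi.
  by rewrite VE; exact: ideal_compr.
have hw n : exists w : bop Y LL, [/\ finite_rank _ _ w, opnorm w <= `|M| * 2^-1 ^+ n &
    jL \bo w = block_in nat n \bo f n].
  (* [Vt] sends these vectors to [2 ^+ n] times [j (D n y)] in block [n], which [j \bo P n]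
     fixes. *)
  have [y|w wE wn] := isometric_lift (h := block_in nat n \bo f n) jLi.
    apply/(jLP _).1 => i; apply/SE; rewrite VtE !bop_compE block_outK.
    case: eqP => [->|_]; last by rewrite !bop0r.
    by rewrite afE bopZr (PP n).2 bopZr.
  exists w; split => //.
    apply: (finite_rank_injective (isometric_inj jLi)); rewrite wE; exact: finite_rank_compl.
  rewrite (le_trans wn)// (le_trans (opnorm_comp _ _))// (le_trans _ (fM n))//.
  by rewrite ler_piMl ?opnorm_ge0// opnorm_reindex.
have [w_ wP] := choice hw.
have [||w wA wlim] := @approximable_series R k Y LL w_ `|M|.
- by move=> n; apply: finite_rank_approximable; case: (wP n).
- by move=> n; case: (wP n).
have wE n y : block_out nat n (jL (w y)) = f n y.
  apply: limit_unique => e e0.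
  have [N /(_ (maxn N n.+1) (leq_maxl _ _)) Ne] := half_pow_small (2 * `|M| * rnorm y) e0.
  have := wlim (maxn N n.+1); set S' := \sum_(i < _) _ => wS.
  have -> : f n y = block_out nat n (jL (S' y)).
    rewrite bop_suml !bop_sumr.
    rewrite (eq_bigr (fun i : 'I_(maxn N n.+1) => if n == i then f i y else 0)).
      by rewrite (@pick_summand _ _ _ (fun i => f i y)) ?leq_maxr.
    move=> i _; rewrite -(bop_compE jL); have [_ _ ->] := wP i.
    by rewrite bop_compE block_outK.
  rewrite -bopBr (le_trans (rnorm_bop_le _ (opnorm_reindex _ _ _)))// mul1r -bopBr jLi -bopB.
  by rewrite (le_trans (opnormP _ _))// (le_trans (ler_wpM2r (rnorm_ge0 _) wS))// mulrAC.
pose u_ n := sor (2^-1 ^+ n) *: (P n \bo block_out G n \bo jM).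
have [||u uA ulim] := @approximable_series R k MM X u_ 1.
- move=> n; apply/finite_rank_approximable/finite_rankZ.
  by do 2!apply: finite_rank_compr; exact: (PP n).1.
- move=> n; rewrite opnormZ sre_norm_sor gtr0_norm// mul1r ler_piMr ?(ltW (half_gt0 n))//.
  apply: opnorm_le => // z; rewrite mul1r !bop_compE -ji.
  have [/SE <-] : S n (jM z) = 0 /\ True by split => //; exact: ((jMP (jM z)).2 (ex_intro _ z erefl)).
  by rewrite (le_trans (rnorm_bop_le _ (opnorm_reindex _ _ _)))// mul1r jMi.
exists MM, u, (V \bo w); split => //; first by exists LL, V, w.
apply: bop_ext => y; apply: limit_unique => e e0.
have e2 : 0 < e / 2 by rewrite divr_gt0.
have [N1 N1e] := Tlim y _ e2.
have [N2 N2e] := half_pow_small (2 * 1 * rnorm (V (w y))) e2.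
have {}N1e := N1e (maxn N1 N2) (leq_maxl _ _).
have {}N2e := N2e (maxn N1 N2) (leq_maxr _ _).
move: (maxn N1 N2) N1e N2e => N N1e N2e.
rewrite (le_trans (rnorm_dist _ (T_ N y) _))// (splitr e) lerD// rnormB.
have -> : T_ N y = (\sum_(i < N) u_ i) (V (w y)).
  rewrite TD !bop_suml; apply: eq_bigr => i _.
  rewrite bopZ !bop_compE -(bop_compE jM) VE bop_compE VtE wE afE bopZr (PP i).2.
  by rewrite scalerA -scalar_of_realM -exprMn mulVf ?pnatr_eq0// expr1n scalar_of_real1 scale1r.
rewrite !bop_compE -bopB (le_trans (opnormP _ _))//.
by rewrite (le_trans (ler_wpM2r (rnorm_ge0 _) (ulim N)))// mulrAC.
Qed.

End Summation.

(** * Summation in the dual minimal kernel *)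

Section DualSummation.
Variables (R : realType) (k : scalar_kind).
Local Notation K := (scalar_field R k).
Local Notation Kline := (scalar_line R k).
Local Notation banach := (completeNormedModType K).
Local Notation sre := (@scalar_re R k).
Local Notation sor := (@scalar_of_real R k).
Implicit Types X Y Z : banach.
Local Notation linf := (linf R k).
Local Notation l1 := (l1 R k).
Local Notation ld := (l1_delta R k).
Local Notation block_in := (block_in R k).
Local Notation block_out := (block_out R k).
Variable A : operator_ideal R k.
Local Notation alpha := (ideal_norm A).
Hypothesis Ainj : injective_ideal A.
Variable kappa : R.
Hypothesis kappa1 : 1 <= kappa.
Hypothesis kappaD : forall (X Y : banach) (S T : bop X Y),
  ideal_class A S -> ideal_class A T -> alpha (S + T) <= kappa * (alpha S + alpha T).

Let kappa0 : 0 < kappa. Proof. exact: lt_le_trans kappa1. Qed.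
Let half_gt0 n : 0 < 2^-1 ^+ n :> R. Proof. by rewrite exprn_gt0// invr_gt0. Qed.

(** Testing [f] on the combination of unit vectors with the conjugate phases of its values, a vector
    of norm at most 1, produces the sum of their moduli. *)
Lemma l1_norm_of_functional (f : dual (linf nat)) m :
  \sum_(i < m) rnorm (f (linf_delta R k i)) <= opnorm f.
Proof.
pose z i : K := f (linf_delta R k i).
pose th i : K := if z i == 0 then 0 else `|z i| / z i.
have thz i : th i * z i = `|z i|.
  by rewrite /th; case: eqP => [->|/eqP zi]; rewrite ?mulr0 ?normr0// mulfVK.
have th1 i : sre `|th i| <= 1.
  rewrite /th; case: eqP => [_|/eqP zi]; first by rewrite -[sre _]/(rnorm (0 : Kline)) rnorm0.
  rewrite normrM normfV normr_id mulfV ?normr_eq0//.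
  by rewrite -(scalar_of_real1 R k) scalar_of_realK.
pose v : linf nat := \sum_(i < m) th i *: linf_delta R k i.
have v1 : rnorm v <= 1.
  apply: linf_le => // g; rewrite linf_sum.
  have [gm|mg] := ltnP g m; last first.
    rewrite big1 ?rnorm0// => i _; rewrite linfZ linf_deltaE; case: eqP => [gi|_]; last by rewrite scaler0.
    by move: mg; rewrite gi leqNgt ltn_ord.
  rewrite (bigD1 (Ordinal gm))// linfZ linf_deltaE eqxx big1 ?Monoid.mulm1.
    by rewrite -[_ *: _]/(_ * _) mulr1 rnorm_line; exact: th1.
  move=> i /andP[_ /eqP ig]; rewrite linfZ linf_deltaE; case: eqP => [gi|_]; last by rewrite scaler0.
  by case: ig; apply/val_inj.
have fv : f v = sor (\sum_(i < m) rnorm (f (linf_delta R k i))).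
  rewrite bop_sumr (big_morph _ (@scalar_of_realD R k) (scalar_of_real0 R k)).
  by apply: eq_bigr => i _; rewrite bopZr -[_ *: _]/(_ * _) rnormE -/(z i) thz.
have := opnormP f v; rewrite fv rnorm_line sre_norm_sor ger0_norm.
  by move=> /le_trans; apply; rewrite ler_piMr ?opnorm_ge0.
by apply: sumr_ge0 => i _; exact: rnorm_ge0.
Qed.

(* Predual of [sum_in_class_min]: the two intermediate spaces are quotients of
   [l1] sums, and the middle operator is an inclusion of kernels. *)
Lemma sum_in_dual_class_min X Y (G : choiceType) (q : bop (l1 G) X) (T : bop X Y)
    (T_ : nat -> bop X Y) (j : bop (dual X) (linf G)) (M : R) :
  (forall x, exists2 w, q w = x & rnorm w <= 2 * rnorm x) ->
  (forall f g, j f g = f (q (ld g))) -> T_ 0%N = 0 ->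
  (forall x e, 0 < e -> exists N, forall n, (N <= n)%N -> rnorm (T x - T_ n x) <= e) ->
  (forall n, finitely_factored A (range (bidual_embedding Y)) (weight kappa n) (M * 2^-1 ^+ n)
     (j \bo adjoint (T_ n.+1 - T_ n))) ->
  class_min (class_dual A) X Y T.
Proof.
move=> qs jE T0 Tlim ff; pose D n := T_ n.+1 - T_ n.
have TD n : T_ n = \sum_(i < n) D i.
  by elim: n => [|n IH]; [rewrite big_ord0 | rewrite big_ord_recr /= -IH addrC subrK].
have data n : exists p : nat * (nat -> Y) * bop (linf nat) (linf G),
    [/\ ideal_class A p.2, alpha p.2 <= (2 * kappa)^-1 ^+ n.+1,
        forall i, rnorm (p.1.2 i) <= `|M| * (2^-1 ^+ n * 2^-1 ^+ n) &
        forall g, D n (q (ld g)) = \sum_(i < p.1.1) ((p.2 (linf_delta R k i) g : K) *: p.1.2 i)].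
  have [m [h [a [Aa aw hM DE]]]] := ff n.
  have hy i : exists y : Y, ((i < m)%N -> bidual_embedding Y y = h i) /\ rnorm y <= `|M| * 2^-1 ^+ n.
    have [im|_] := ltnP i m; last by exists 0; rewrite rnorm0 mulr_ge0// ltW.
    have [[y _ yh] hn] := hM i im; exists y; split => //.
    by rewrite -rnorm_bidual yh rnorm_bop (le_trans hn)// ler_wpM2r ?ler_norm// ltW.
  have [y yP] := choice hy.
  (* The bound on the vectors becomes a multiple of [4^-n]: one power of 2 will pay for the factor
     [2 ^+ n] in [ut], the other makes its series converge. *)
  exists (m, (fun i => sor (2^-1 ^+ n) *: y i), sor (2 ^+ n) *: a); split => /=.
  - exact: idealZ.
  - exact: scaled_weight.
  - move=> i; rewrite rnormZr ger0_norm ?(ltW (half_gt0 _))// mulrA mulrC ler_wpM2r ?(ltW (half_gt0 _))//.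
    exact: (yP i).2.
  - move=> g; apply: dual_separates => f.
    have -> : f (D n (q (ld g))) = (\sum_(i < m) (h i f : K) *: a (linf_delta R k i)) g.
      by rewrite -(DE f) bop_compE jE.
    rewrite linf_sum bop_sumr; apply: eq_bigr => i _.
    rewrite !linfZ !bopZr -(yP i).1// bidual_embeddingE.
    rewrite -![_ *: _]/(_ * _) mulrACA -scalar_of_realM -exprMn mulfV ?pnatr_eq0//.
    by rewrite expr1n scalar_of_real1 mul1r mulrC.
have [dt dtP] := choice data.
pose m n := (dt n).1.1; pose a n := (dt n).2.
pose y n i := if (i < m n)%N then (dt n).1.2 i else 0.
have Aa n : ideal_class A (a n) by case: (dtP n).
have aw n : alpha (a n) <= (2 * kappa)^-1 ^+ n.+1 by case: (dtP n).
have yM n i : rnorm (y n i) <= `|M| * (2^-1 ^+ n * 2^-1 ^+ n).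
  rewrite /y; case: ifP => _; last by rewrite rnorm0 !mulr_ge0// ltW.
  by case: (dtP n).
have DE n g : D n (q (ld g)) = \sum_(i < m n) ((a n (linf_delta R k i) g : K) *: y n i).
  have [_ _ _ ->] := dtP n; apply: eq_bigr => i _.
  by rewrite /y ltn_ord.
have h2le1 n : 2^-1 ^+ n <= 1 :> R by rewrite exprn_ile1 ?invr_ge0// invf_le1// ler1n.
have yM' n i : rnorm (y n i) <= `|M|.
  rewrite (le_trans (yM n i))// ler_piMr// -[leRHS]mulr1.
  by rewrite ler_pM ?(ltW (half_gt0 _)).
(* [qL] records all the [h n] at once, through the embedding of [Y], so that its kernel is their
   common kernel; on the quotient [L] each [h n] becomes an operator [u n]. *)
have [p|qL qLE _] := @l1_family R k (nat * nat)%type (linf (nat * closed_unit_ball (dual Y)))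
  (fun p => block_in _ p.1 (linf_embedding Y (y p.1 p.2))) `|M| (normr_ge0 M).
  rewrite (le_trans (rnorm_bop_le _ (opnorm_reindex _ _ _)))// mul1r.
  by rewrite rnorm_linf_embedding.
have hh n : exists h : bop (l1 (nat * nat)%type) Y,
    (forall p, h (ld p) = if p.1 == n then y p.1 p.2 else 0) /\
    opnorm h <= `|M| * (2^-1 ^+ n * 2^-1 ^+ n).
  have [|p|h hE hM] := @l1_family R k (nat * nat)%type Y (fun p => if p.1 == n then y p.1 p.2 else 0)
    (`|M| * (2^-1 ^+ n * 2^-1 ^+ n)); last by exists h.
  - by rewrite !mulr_ge0// ltW.
  - by case: eqP => [->//|_]; rewrite rnorm0 !mulr_ge0// ltW.
have [h hP] := choice hh.
have hF n : finite_rank _ _ (h n).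
  have hc (i : 'I_(m n)) : exists c : dual (l1 (nat * nat)%type),
      forall p, c (ld p) = if p == (n, val i) then (1 : K) else 0.
    have [p|c cE _] := @l1_family R k (nat * nat)%type Kline (fun p => if p == (n, val i) then (1 : K) else 0) 1 ler01.
      by case: eqP => _; rewrite ?rnorm0 ?rnorm1.
    by exists c.
  have [c cE] := choice hc.
  have -> : h n = \sum_(i < m n) rank1 (c i) (y n i).
    apply: l1_ext => -[n' i]; rewrite (hP n).1 [LHS]/= bop_suml.
    under eq_bigr => l _ do rewrite rank1E cE xpair_eqE.
    case: eqP => [->|_]; last by rewrite big1// => l _; rewrite scale0r.
    have [im|mi] := ltnP i (m n).
      rewrite (bigD1 (Ordinal im))//= eqxx scale1r big1 ?addr0// => l li.
      case: eqP => [il|_]; last by rewrite scale0r.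
      by case/eqP: li; apply/val_inj.
    rewrite /y ltnNge mi big1// => l _; case: eqP => [il|_]; last by rewrite scale0r.
    by move: mi; rewrite il leqNgt ltn_ord.
  by apply: finite_rank_sum => i _; exact: finite_rank_rank1.
have hqL n w : linf_embedding Y (h n w) = block_out _ n (qL w).
  rewrite -!bop_compE; congr (_ w).
  congr bop_fun; apply: l1_ext => p; rewrite !bop_compE (hP n).1 qLE block_outK eq_sym.
  by case: eqP => // _; rewrite bop0r.
have iYinj := isometric_inj (@rnorm_linf_embedding R k Y).
have [L [pL [pL1 pLker pLs]]] := quotient_space qL.
have hu n : exists u : bop L Y, u \bo pL = h n /\ opnorm u <= 2 * opnorm (h n).
  have [w pw|u uE un] := quotient_lift (h := h n) pLs; last by exists u.
  by apply: iYinj; rewrite hqL ((pLker w).1 pw) !bop0r.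
have [u uP] := choice hu.
have a1 n : opnorm (a n) <= 1.
  rewrite (le_trans (opnorm_le_ideal (Aa n)))// (le_trans (aw n))//.
  rewrite exprn_ile1 ?invr_ge0 ?mulr_ge0 ?(ltW kappa0)// invf_le1 ?mulr_gt0//.
  by rewrite -[leLHS]mulr1 ler_pM// ler1n.
(* The transpose of the block-diagonal operator with blocks [a n]: a unit vector goes to a row of
   coefficients, whose sum is controlled by the norm of a functional on [linf nat]. *)
have [p|at_ atE _] := @l1_family R k (nat * G)%type (l1 (nat * nat)%type)
  (fun p => \sum_(i < m p.1) (a p.1 (linf_delta R k i) p.2 : K) *: ld (p.1, val i)) 1 ler01.
  rewrite (le_trans (rnorm_sum _ _ _))//.
  rewrite (le_trans (y := opnorm (linf_ev R k p.2 \bo a p.1)))//; last first.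
    by rewrite (le_trans (opnorm_comp _ _))// -[leRHS]mulr1 ler_pM ?opnorm_ge0// opnorm_linf_ev.
  rewrite (le_trans _ (l1_norm_of_functional _ (m p.1)))//; apply: ler_sum => i _.
  by rewrite rnorm_scale ler_piMr ?rnorm_ge0// rnorm_l1_delta.
have [Q [pQ [pQ1 pQker pQs]]] := quotient_space (pL \bo at_).
have [x px|v vE _] := quotient_lift (h := pL \bo at_) pQs; first exact/pQker.
have hl1 n : exists2 i : bop (l1 G) (l1 (nat * G)%type), (forall g, i (ld g) = ld (n, g)) & opnorm i <= 1.
  by apply: l1_family => // g; exact: rnorm_l1_delta.
have atin n (i : bop (l1 G) (l1 (nat * G)%type)) : (forall g, i (ld g) = ld (n, g)) ->
    forall l w, h l (at_ (i w)) = if l == n then D n (q w) else 0.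
  move=> iE l w.
  have -> : (if l == n then D n (q w) else 0) = (if l == n then D n \bo q else 0) w by case: eqP.
  rewrite -!bop_compE; congr (_ w); congr bop_fun; apply: l1_ext => g; rewrite !bop_compE iE atE bop_sumr /=.
  under eq_bigr => c _ do rewrite bopZr (hP l).1 /= eq_sym.
  case: eqP => _; first by rewrite bop_compE DE.
  by rewrite big1// => c _; rewrite scaler0.
have hw n : exists w : bop X Q, [/\ finite_rank _ _ w, opnorm w <= 2 &
    forall l x, u l (v (w x)) = if l == n then D n x else 0].
  have [i iE i1] := hl1 n.
  (* Dividing by the kernel of [pL \bo at_], and not only of [at_], makes the image of [i x] in [Q]
     depend on [D n (q x)] alone. This gives the descent to [X] and also the finite rank of [w]. *)
  have kerD x : D n (q x) = 0 -> pQ (i x) = 0.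
    move=> Dx; apply/pQker/pLker.
    apply: linf_ext => -[l b].
    have := congr1 (fun v : linf _ => v b) (hqL l (at_ (i x))).
    by rewrite (atin n i iE) block_outE => <-; case: eqP => [_|_]; rewrite ?Dx bop0r.
  have [x qx|w wE wn] := quotient_lift (h := pQ \bo i) qs.
    by rewrite bop_compE kerD// qx bop0r.
  have wuE l x : u l (v (w x)) = if l == n then D n x else 0.
    have [x' <- _] := qs x; rewrite -(bop_compE w) wE bop_compE -(bop_compE v) vE bop_compE.
    by rewrite -(bop_compE (u l)) (uP l).1 (atin n).
  exists w; split => //.
    have DF : finite_rank _ _ (D n).
      apply: (finite_rank_surjective (p := q)); first by move=> x; have [x' ? _] := qs x; exists x'.
      have -> : D n \bo q = h n \bo at_ \bo i.
        by apply: bop_ext => x; rewrite !bop_compE (atin n i iE) eqxx.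
      by do 2!apply: finite_rank_compr.
    have [_ [s sF sE]] := finite_rank_decomp DF.
    have -> : w = w \bo s \bo D n; last exact: finite_rank_compl.
    apply: bop_ext => x; apply/eqP; rewrite -subr_eq0 !bop_compE -bopBr.
    have [x' x'E _] := qs (x - s (D n x)); rewrite -x'E -(bop_compE w) wE bop_compE kerD//.
    by rewrite x'E bopBr -[in X in X - _]sE !bop_compE subrr.
  rewrite (le_trans wn)// -[leRHS]mulr1 ler_wpM2l// (le_trans (opnorm_comp _ _))//.
  by rewrite -[leRHS]mulr1 ler_pM ?opnorm_ge0.
have [w_ wP] := choice hw.
have [||w wA wlim] := @approximable_series R k X Q (fun n => sor (2^-1 ^+ n) *: w_ n) 2.
- by move=> n; apply/finite_rank_approximable/finite_rankZ; case: (wP n).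
- move=> n; rewrite opnormZ sre_norm_sor gtr0_norm// mulrC ler_wpM2r ?(ltW (half_gt0 _))//.
  by case: (wP n).
have [||ut utA utlim] := @approximable_series R k L Y (fun n => sor (2 ^+ n) *: u n) (2 * `|M|).
- move=> n; apply/finite_rank_approximable/finite_rankZ.
  apply: (finite_rank_surjective (p := pL)); first by move=> z; have [x ? _] := pLs z; exists x.
  by rewrite (uP n).1.
- move=> n; rewrite opnormZ sre_norm_sor ger0_norm ?exprn_ge0//.
  have h1 := le_trans (uP n).2 (ler_wpM2l (ler0n _ 2) (hP n).2).
  rewrite (le_trans (ler_wpM2l (exprn_ge0 n (ler0n _ 2)) h1))//.
  rewrite le_eqVlt; apply/orP; left; apply/eqP.
  have E2 (p r c : R) : p * (2 * (c * (r * r))) = p * r * (2 * c * r) by ring.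
  by rewrite E2 -exprMn mulfV ?pnatr_eq0// expr1n mul1r.
have uvw n x : u n (v (w x)) = sor (2^-1 ^+ n) *: D n x.
  apply: limit_unique => e e0.
  pose B := opnorm (u n) * opnorm v.
  have [N /(_ (maxn N n.+1) (leq_maxl _ _)) Ne] := half_pow_small (B * (2 * 2 * rnorm x)) e0.
  have := wlim (maxn N n.+1); set S := \sum_(i < _) _ => wS.
  have -> : sor (2^-1 ^+ n) *: D n x = u n (v (S x)).
    rewrite bop_suml !bop_sumr.
    rewrite (eq_bigr (fun i : 'I_(maxn N n.+1) => if n == i then sor (2^-1 ^+ i) *: D i x else 0)).
      by rewrite (@pick_summand _ _ _ (fun i => sor (2^-1 ^+ i) *: D i x)) ?leq_maxr.
    move=> i _; rewrite bopZ !bopZr; have [_ _ ->] := wP i.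
    by case: eqP => // _; rewrite scaler0.
  rewrite -!bopBr -bopB (le_trans (opnormP _ _))// (le_trans (ler_wpM2l (opnorm_ge0 _) (opnormP _ _)))//.
  rewrite mulrA (le_trans _ Ne)// -!mulrA !ler_wpM2l ?opnorm_ge0// mulrA mulrC.
  rewrite (le_trans (opnormP _ _))//.
  rewrite (le_trans (ler_wpM2r (rnorm_ge0 _) wS))// mulrAC mulrC.
  by rewrite !mulrA.
exists L, ut, (v \bo w); split => //; last first.
  apply: bop_ext => x; apply: limit_unique => e e0.
  have e2 : 0 < e / 2 by rewrite divr_gt0.
  have [N1 N1e] := Tlim x _ e2.
  have [N2 N2e] := half_pow_small (2 * (2 * `|M|) * rnorm (v (w x))) e2.
  have {}N1e := N1e (maxn N1 N2) (leq_maxl _ _).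
  have {}N2e := N2e (maxn N1 N2) (leq_maxr _ _).
  move: (maxn N1 N2) N1e N2e => N N1e N2e.
  rewrite (le_trans (rnorm_dist _ (T_ N x) _))// (splitr e) lerD// rnormB.
  have -> : T_ N x = (\sum_(i < N) sor (2 ^+ i) *: u i) (v (w x)).
    rewrite TD !bop_suml; apply: eq_bigr => i _.
    rewrite bopZ uvw scalerA -scalar_of_realM -exprMn mulfV ?pnatr_eq0//.
    by rewrite expr1n scalar_of_real1 scale1r.
  rewrite !bop_compE -bopB (le_trans (opnormP _ _))//.
  by rewrite (le_trans (ler_wpM2r (rnorm_ge0 _) (utlim N)))// mulrAC.
exists Q, v, w; split => //; rewrite /class_dual /=.
have [kap kapE kap1] := @l1_pairing R k (nat * G)%type.
(* [t n] reads the values of a functional at the unit vectors of block [n], so [a n \bo t n] is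
   block [n] of the adjoint of [at_]. *)
have ht n : exists2 t : bop (dual (l1 (nat * nat)%type)) (linf nat),
    (forall f i, t f i = if (i < m n)%N then f (ld (n, i)) else 0) & opnorm t <= 1.
  have [i|t tE t1] := @linf_family R k (dual (l1 (nat * nat)%type)) nat
      (fun i => if (i < m n)%N then bidual_embedding _ (ld (n, i)) else 0) 1 ler01.
    case: ifP => _; last by rewrite opnorm0.
    by rewrite -rnorm_bop rnorm_bidual rnorm_l1_delta.
  by exists t => // f i; rewrite tE; case: ifP => // _; rewrite bidual_embeddingE.
have ht' n : exists t : bop (dual (l1 (nat * nat)%type)) (linf nat),
    (forall f i, t f i = if (i < m n)%N then f (ld (n, i)) else 0) /\ opnorm t <= 1.
  by have [t ? ?] := ht n; exists t.
have [t tP] := choice ht'.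
have [n|n|S AS Slim] := ideal_series (T_ := fun n => kap \bo block_in G n \bo (a n \bo t n)) kappa1 kappaD.
- by apply/ideal_compl/ideal_compr.
- apply: ideal_norm_compl1; first exact: ideal_compr.
    by rewrite (le_trans (opnorm_comp _ _))// -[leRHS]mulr1 ler_pM ?opnorm_ge0// opnorm_reindex.
  by apply: ideal_norm_compr1 => //; exact: (tP n).2.
have atS : adjoint at_ = S.
  apply: bop_ext => f; apply: l1_ext => -[n g]; apply: limit_unique => e e0.
  have M0 : 0 < rnorm f + 1 by rewrite ltr_wpDl ?rnorm_ge0.
  have [N /(_ (maxn N n.+1) (leq_maxl _ _))] := Slim _ (divr_gt0 e0 M0).
  set S' := \sum_(i < _) _ => SS.
  have -> : adjoint at_ f (ld (n, g)) = S' f (ld (n, g)).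
    rewrite !bop_suml.
    rewrite (eq_bigr (fun i : 'I_(maxn N n.+1) => if n == i then a i (t i f) g else 0)); last first.
      by move=> i _; rewrite !bop_compE kapE block_inE.
    rewrite (@pick_summand _ _ _ (fun i => a i (t i f) g)) ?leq_maxr//.
    rewrite -[LHS]/(f (at_ (ld (n, g)))) atE bop_sumr /=.
    have ttr i : (m n <= i)%N -> t n f i = 0 by move=> mi; rewrite (tP n).1 ltnNge mi.
    rewrite {1}(linf_truncE ttr) bop_sumr linf_sum; apply: eq_bigr => i _.
    by rewrite !bopZr linfZ (tP n).1 ltn_ord -![_ *: _]/(_ * _) mulrC.
  rewrite rnormB -!bopB (le_trans (opnormP _ _))// (le_trans (ler_wpM2l (opnorm_ge0 _) (rnorm_l1_delta _ _ _)))//.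
  rewrite mulr1 -rnorm_bop (le_trans (opnormP _ _))// (le_trans (ler_wpM2r (rnorm_ge0 _) SS))//.
  by rewrite mulrAC ler_pdivrMr// ler_wpM2l ?(ltW e0)// lerDl.
(* Vectors of [Q] lift through [pQ] with factor 2, hence the adjoint of [pQ] is bounded below, and
   injectivity transfers membership from the adjoint of [at_] to that of [v]. *)
apply: (ideal_injective (j := adjoint pQ) (C := 2)) => //.
  move=> f; rewrite !rnorm_bop; apply: opnorm_le => [|z]; first by rewrite mulr_ge0 ?opnorm_ge0.
  have [x <- xz] := pQs z.
  rewrite (le_trans (opnormP (adjoint pQ f) x))// (le_trans (ler_wpM2l (opnorm_ge0 _) xz))//.
  by rewrite mulrA [_ * 2]mulrC.
have -> : adjoint pQ \bo adjoint v = S \bo adjoint pL.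
  apply: bop_ext => f; apply: bop_ext => x; rewrite -atS.
  rewrite -[LHS]/(f (v (pQ x))) -[RHS]/(f (pL (at_ x))).
  by rewrite -(bop_compE v) vE.
exact: ideal_compr.
Qed.

End DualSummation.

(** * Consequences of the approximation property *)

Section ApproximationProperty.
Variables (R : realType) (k : scalar_kind).
Local Notation K := (scalar_field R k).
Local Notation banach := (completeNormedModType K).
Local Notation sor := (@scalar_of_real R k).
Implicit Types X Y Z : banach.
Local Notation linf := (linf R k).
Variable A : operator_ideal R k.
Local Notation alpha := (ideal_norm A).

Lemma comp_compact_norm_ge0 X Y (T : bop X Y) : 0 <= comp_compact_norm A T.
Proof.
rewrite /comp_compact_norm; set S := [set r | _].
have [->|/set0P S0] := eqVneq S set0; first by rewrite inf0.
apply: lb_le_inf => // _ [Z [T1 [T2 [AT1 _ _ ->]]]].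
by rewrite mulr_ge0 ?opnorm_ge0 ?ideal_norm_ge0.
Qed.

Lemma comp_compact_norm_le X Y Z (T1 : bop Z Y) (T2 : bop X Z) :
  ideal_class A T1 -> compact_operator X Z T2 ->
  comp_compact_norm A (T1 \bo T2) <= alpha T1 * opnorm T2.
Proof.
move=> AT1 cT2; apply: ge_inf; last by exists Z, T1, T2.
by exists 0 => _ [Z' [S1 [S2 [AS1 _ _ ->]]]]; rewrite mulr_ge0 ?opnorm_ge0 ?ideal_norm_ge0.
Qed.

(** The assumed factorization rules out the empty set, whose infimum is 0 by convention and would
    give no factors. *)
Lemma comp_compact_norm_lt X Y (T : bop X Y) e :
  (exists Z (T1 : bop Z Y) (T2 : bop X Z), [/\ ideal_class A T1, compact_operator X Z T2 & T = T1 \bo T2]) ->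
  comp_compact_norm A T < e ->
  exists Z (T1 : bop Z Y) (T2 : bop X Z),
    [/\ ideal_class A T1, compact_operator X Z T2, T = T1 \bo T2 & alpha T1 * opnorm T2 < e].
Proof.
move=> [Z [T1 [T2 [AT1 cT2 TE]]]] /inf_lt[].
  by exists (alpha T1 * opnorm T2), Z, T1, T2.
by move=> _ [Z' [S1 [S2 [AS1 cS2 SE ->]]]] h; exists Z', S1, S2.
Qed.

Lemma lambda_seminorm_le X Y Z (C : set X) (i : bop Z X) (T : bop X Y) :
  admissible C i -> lambda_seminorm A C T <= comp_compact_norm A (T \bo i).
Proof.
move=> Ci; apply: ge_inf; last by exists Z, i.
by exists 0 => _ [Z' [i' [_ ->]]]; exact: comp_compact_norm_ge0.
Qed.

(** The existence of an admissible space keeps the infimum from being taken over the empty set, and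
    compactness of its inclusion does the same for the composition norm. *)
Lemma lambda_seminorm_lt X Y (C : set X) (T : bop X Y) e : compact C -> ideal_class A T ->
  lambda_seminorm A C T < e ->
  exists Z (i : bop Z X), admissible C i /\
    exists Z' (T1 : bop Z' Y) (T2 : bop Z Z'),
    [/\ ideal_class A T1, compact_operator Z Z' T2, T \bo i = T1 \bo T2 & alpha T1 * opnorm T2 < e].
Proof.
move=> cC AT /inf_lt[].
  have [Z [i Ci]] := admissible_exists cC.
  by exists (comp_compact_norm A (T \bo i)), Z, i.
move=> _ [Z [i [Ci ->]]] h; exists Z, i; split => //.
apply: comp_compact_norm_lt h; exists X, T, i; split => //.
by case: Ci.
Qed.

Lemma balanced_scaling X Y Z (T1 : bop Z Y) (T2 : bop X Z) e : 0 < e ->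
  ideal_class A T1 -> compact_operator X Z T2 -> alpha T1 * opnorm T2 < e * e ->
  exists (S1 : bop Z Y) (S2 : bop X Z), [/\ ideal_class A S1, compact_operator X Z S2,
    T1 \bo T2 = S1 \bo S2 & alpha S1 <= e /\ opnorm S2 <= e].
Proof.
move=> e0 AT1 cT2 h; have a0 := ideal_norm_ge0 AT1.
have [t [t0 h1 h2]] : exists t, [/\ 0 < t, alpha T1 <= t * e & t * opnorm T2 <= e].
  move: a0; rewrite le_eqVlt => /orP[/eqP a0|a0].
    exists (e / (opnorm T2 + 1)); have d0 : 0 < opnorm T2 + 1 by rewrite ltr_wpDl ?opnorm_ge0.
    split; [exact: divr_gt0|by rewrite -a0 mulr_ge0 ?(ltW e0)// divr_ge0 ?ltW|].
    by rewrite mulrAC ler_pdivrMr// ler_wpM2l ?(ltW e0)// lerDl.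
  exists (alpha T1 / e); split; [exact: divr_gt0 | by rewrite mulfVK ?gt_eqF|].
  by rewrite mulrAC ler_pdivrMr// ltW.
exists (sor t^-1 *: T1), (sor t *: T2); split.
- exact: idealZ.
- exact: compact_operatorZ.
- rewrite bop_compZr bop_compZl scalerA -scalar_of_realM mulfV ?gt_eqF//.
  by rewrite scalar_of_real1 scale1r.
- split; last by rewrite opnormZ sre_norm_sor gtr0_norm.
  rewrite (le_trans (ideal_normZr _ AT1)) ?invr_ge0 ?(ltW t0)//.
  by rewrite mulrC ler_pdivrMr// mulrC.
Qed.

Lemma injective_factor Y Z X (i : bop Z X) (V : bop Y X) : injective i ->
  (forall y, rnorm y <= 1 -> exists2 z, rnorm z <= 1 & i z = V y) ->
  exists2 w : bop Y Z, i \bo w = V & opnorm w <= 1.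
Proof.
move=> ii h.
have h1 y : exists z, i z = V y /\ rnorm z <= rnorm y.
  have [->|y0] := eqVneq y 0; first by exists 0; rewrite !bop0r !rnorm0; split.
  have yp : 0 < rnorm y by rewrite rnorm_gt0.
  have [x x1 yx] := scale_unit yp (lexx (rnorm y)).
  have [z z1 iz] := h x x1; exists (sor (rnorm y) *: z).
  rewrite bopZr iz -bopZr -yx rnormZr gtr0_norm//; split => //.
  by rewrite ler_piMr// ltW.
have [w wP] := choice h1.
have [|||W WE W1] := @bop_exists R k Y Z w 1; last first.
  by exists W => //; apply: bop_ext => y; rewrite bop_compE WE (wP y).1.
- by move=> y; rewrite mul1r (wP y).2.
- by [].
- by move=> a x y; apply: ii; rewrite bopDr bopZr !(wP _).1 bopDr bopZr.
Qed.

(* The closure of the range of the adjoint of [W]. *)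
Definition functionals_through Y Z (W : bop Y Z) : set (dual Y) :=
  [set f | forall e, 0 < e -> exists d : dual Z, opnorm (f - d \bo W) <= e].

Hypothesis Ainj : injective_ideal A.
Hypothesis Aext : linf_extension_property A.

(** The extension property replaces the arbitrary space [Z] by a space of bounded families without
    increasing the ideal norm, which is what makes finite rank approximation of the second factor
    possible. *)
Lemma extend_factor Y Z (H : Type) (p : bop Z (linf H)) (W : bop Y Z) :
  ideal_class A p -> compact_operator Y Z W ->
  approximately_factored A (functionals_through W) (alpha p) (opnorm W) (p \bo W).
Proof.
move=> Ap Wc; have [a [Aa pE an]] := Aext Ap.
exists _, a, (linf_embedding Z \bo W); split.
- by split => //; rewrite an.
- split; first exact: compact_operator_compl.
  rewrite (le_trans (opnorm_comp _ _))// ler_piMl ?opnorm_ge0//.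
  exact: opnorm_linf_embedding.
- move=> f e e0; exists (f \bo linf_embedding Z).
  by rewrite bop_compA subrr opnorm0 ltW.
- by rewrite {1}pE bop_compA.
Qed.

(* The approximation property is applied to the restriction [S] of [p] to the
   subspace that [p] maps into [j X]. Density of the functionals of [E] in the
   dual of an admissible space makes the factors of the error compatible with
   [W]. *)
Lemma approximate_factorization X Y Z (H : Type) (j : bop X (linf H)) (T : bop Y X)
    (p : bop Z (linf H)) (W : bop Y Z) e :
  (forall x, rnorm (j x) = rnorm x) -> approximation_property A X ->
  ideal_class A p -> compact_operator Y Z W -> j \bo T = p \bo W -> 0 < e ->
  exists2 F : bop Z X, finite_rank Z X F &
    approximately_factored A (functionals_through W) e e (j \bo T - j \bo (F \bo W)).
Proof.
move=> ji AP Ap Wc jT e0; have jinj := isometric_inj ji.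
have jTE y : j (T y) = p (W y) by rewrite -(bop_compE j) jT.
have [| | |D [i0 [i0i i0P]]] := @closed_subspace R k Z [set z | exists x, j x = p z].
- by exists 0; rewrite !bop0r.
- by move=> a x y /= [u ju] [v jv]; exists (a *: u + v); rewrite !bopDr !bopZr ju jv.
- move=> z /= hz; apply: closed_range => // d d0.
  have M0 : 0 < opnorm p + 1 by rewrite ltr_wpDl ?opnorm_ge0.
  have [y [x jx] zy] := hz _ (divr_gt0 d0 M0); exists x.
  rewrite jx -bopBr (le_trans (opnormP _ _))// (le_trans (ler_wpM2l (opnorm_ge0 _) zy))//.
  by rewrite mulrCA ler_piMr ?(ltW d0)// ler_pdivrMr// mul1r lerDl.
have [d|S SE _] := isometric_lift (h := p \bo i0) ji; first by apply/(i0P (i0 d)).2; exists d.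
have AS : ideal_class A S.
  apply: (ideal_injective (j := j) (C := 1)) => //; first by move=> y; rewrite mul1r ji.
  by rewrite SE; exact: ideal_compr.
have [y|W' W'E _] := isometric_lift (h := W) i0i; first by apply/(i0P (W y)).1; exists (T y).
have TE : T = S \bo W'.
  apply: bop_ext => y; apply: jinj; rewrite jTE -W'E -(bop_compE p) bop_compA -SE.
  by rewrite !bop_compE.
have W'c : compact_operator Y D W'.
  apply/compact_operatorP/(totally_bounded_isometry i0i).
  move/compact_operatorP: Wc; apply: totally_bounded_sub => _ [_ [y By <-] <-].
  by exists y => //; rewrite -W'E.
pose C := closure (W' @` closed_unit_ball Y).
have Cc : compact C by rewrite -precompactE; exact: W'c.
have ee0 : 0 < e * e by rewrite mulr_gt0.
have [|F' [F'F [AF' /(_ C (mem_head _ _)) F'e]]] := AP D S AS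
  [set S' | ideal_class A S' /\ {in [:: C], forall C, lambda_seminorm A C (S' - S) < e * e}].
  by exists ([:: C], e * e) => //=; split=> // C'; rewrite inE => /eqP->.
have AFS : ideal_class A (F' - S) by apply: idealD => //; exact: idealN.
have [Z1 [i [[iinj ic Ci idense] [Z2 [T1 [T2 [AT1 T2c FSi T12]]]]]]] := lambda_seminorm_lt Cc AFS F'e.
have [S1 [S2 [AS1 cS2 S12 [S1e S2e]]]] := balanced_scaling e0 AT1 T2c T12.
(* The compact set was chosen as the closure of the image of the ball, so that [W'] factors through
   every admissible space for it. *)
have [y y1|w wE w1] := injective_factor (V := W') iinj.
  have CW : C (W' y) by apply: subset_closure; exists y => //; apply/closed_unit_ballE.
  by have [z /closed_unit_ballE z1 iz] := Ci _ CW; exists z.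
have [[n [g [x F'E]]] _] := finite_rank_decomp F'F.
(* [F'] acts on [D] only; extending its functionals to [Z] gives an operator [F] with
   [F \bo W = F' \bo W'], and the error sees [F] through this composition alone. *)
have hg l : exists g' : dual Z, forall d, g' (i0 d) = g l d.
  by have [d|g' ? _] := @hahn_banach R k D Z i0 1 (g l) ler01; [rewrite mul1r i0i | exists g'].
have [g' g'E] := choice hg.
pose F : bop Z X := \sum_(l < n) rank1 (g' l) (x l).
have FE d : F (i0 d) = F' d.
  by rewrite F'E !bop_suml; apply: eq_bigr => l _; rewrite !rank1E g'E.
exists F; first by apply: finite_rank_sum => l _; exact: finite_rank_rank1.
have WE y : W y = i0 (W' y) by rewrite -W'E.
have iwE y : i (w y) = W' y by rewrite -wE.
have -> : j \bo T - j \bo (F \bo W) = (j \bo S1) \bo (- (S2 \bo w)).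
  have S12E z : S1 (S2 z) = F' (i z) - S (i z) by rewrite -(bop_compE S1) -S12 -FSi.
  apply: bop_ext => y; rewrite bopB !bop_compE bopNl !bop_compE !bopNr S12E iwE -bopBr.
  by rewrite WE FE TE -[RHS]bopNr opprB.
have Aj : ideal_class A (j \bo S1) by exact: ideal_compl.
have cSw : compact_operator _ _ (- (S2 \bo w)) by apply/compact_operatorN/compact_operator_compr.
have [G [a [b [[Aa an] [bc bn] bg ->]]]] := extend_factor Aj cSw.
exists G, a, b; split => //.
- split => //; rewrite (le_trans an)//; apply: ideal_norm_compl1 => //.
  by apply: opnorm_le => // x0; rewrite mul1r ji.
- split => //; rewrite (le_trans bn)// opnormN (le_trans (opnorm_comp _ _))//.
  by rewrite (le_trans _ S2e)// ler_piMr ?opnorm_ge0.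
(* A functional of the new factorization acts through [S2 \bo w], hence through [w]. Density
   approximates the functional on [Z1] by one on [D], and the Hahn-Banach theorem extends that to
   [Z]. *)
move=> f d d0; have d2 : 0 < d / 2 by rewrite divr_gt0.
have [h hh] := bg f _ d2.
have [h' h'h] := idense (- (h \bo S2)) _ d2.
have [d'|h'' h''E _] := @hahn_banach R k D Z i0 1 h' ler01; first by rewrite mul1r i0i.
exists h''; rewrite -rnorm_bop (le_trans (rnorm_dist _ (h \bo - (S2 \bo w)) _))// !rnorm_bop.
rewrite (splitr d) lerD//; apply: opnorm_le_ball => [|y y1]; first exact: ltW.
have wy : closed_unit_ball Z1 (w y).
  by apply/closed_unit_ballE; rewrite (le_trans (rnorm_bop_le _ w1))// mul1r.
have -> : (h \bo - (S2 \bo w) - h'' \bo W) y = - (h' (i (w y)) - (- (h \bo S2)) (w y)).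
  by rewrite bopB bopNl !bop_compE bopNl bopNr !bop_compE WE h''E iwE opprK opprD addrC.
by rewrite rnormN ltW ?h'h.
Qed.

End ApproximationProperty.

(** * The approximation property and the injective hull *)

Section MinimalKernel.
Variables (R : realType) (k : scalar_kind).
Local Notation K := (scalar_field R k).
Local Notation banach := (completeNormedModType K).
Local Notation sor := (@scalar_of_real R k).
Implicit Types X Y Z : banach.
Local Notation linf := (linf R k).
Local Notation l1 := (l1 R k).
Variable A : operator_ideal R k.
Local Notation alpha := (ideal_norm A).
Hypothesis Ainj : injective_ideal A.
Hypothesis Aext : linf_extension_property A.
Variable kappa : R.
Hypothesis kappa1 : 1 <= kappa.
Hypothesis kappaD : forall (X Y : banach) (S T : bop X Y),
  ideal_class A S -> ideal_class A T -> alpha (S + T) <= kappa * (alpha S + alpha T).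

Let kappa0 : 0 < kappa. Proof. exact: lt_le_trans kappa1. Qed.

Lemma compact_union (T : topologicalType) (s : seq (set T)) :
  {in s, forall C, compact C} -> compact [set y | exists2 C, C \in s & C y].
Proof.
elim: s => [|C s IH] h.
  by rewrite (_ : [set y | _] = set0); [exact: compact0 | rewrite -subset0 => y []].
have -> : [set y | exists2 C', C' \in C :: s & C' y] = C `|` [set y | exists2 C', C' \in s & C' y].
  apply/seteqP; split=> [y [C']|y [Cy|[C' C's C'y]]].
  - by rewrite inE => /orP[/eqP->|C's] C'y; [left | right; exists C'].
  - by exists C => //; rewrite mem_head.
  - by exists C' => //; rewrite inE C's orbT.
apply: compactU; first by apply: h; rewrite mem_head.
by apply: IH => C' C's; apply: h; rewrite inE C's orbT.
Qed.

(** One admissible space for the union of the finitely many compact sets handles all seminorms at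
    once. The error consists of [(u - u') \bo v \bo w] and of the change of the functionals from [g]
    to [f]; a product space combines both into a single factorization through an operator of [A] and
    a compact one. *)
Lemma approximation_property_of_min X :
  (forall Y Z (T : bop Y X) (i : bop Z Y), ideal_class A T -> compact_operator Z Y i ->
     class_min A Z X (T \bo i)) ->
  approximation_property A X.
Proof.
move=> hmin Y T AT U [[s eps] /= [sc eps0] sU].
have [Z [i Ci]] := admissible_exists (compact_union sc).
have Cs C : C \in s -> admissible C i.
  move=> Cin; case: Ci => ii ic iC id; split => // y Cy; by apply: iC; exists C.
have [iinj ic _ idense] := Ci.
have [H2 [u [_ [uA [H1 [v [w [Av wA ->]]]] TiE]]]] := hmin Y Z T i AT ic.
have [P [i1 [i2 [p1 [p2 [[pi11 pi22 pi21 pi12] [p1n p2n n12]]]]]]] := product_space H1 (linf nat).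
pose Mw := opnorm w + 1; have Mw0 : 0 < Mw by rewrite ltr_wpDl ?opnorm_ge0.
(* The two parts of the ideal factor are bounded by [eta] each and the compact factor by [Mw], which
   leaves [kappa * (eta + eta) * Mw = eps / 2]. *)
pose eta := eps / (4 * kappa * Mw).
have eta0 : 0 < eta by rewrite divr_gt0// !mulr_gt0.
have d1 : 0 < eta / (alpha v + 1) by rewrite divr_gt0// ltr_wpDl ?ideal_norm_ge0.
have [u' u'F uu'] := (approximableP u).1 uA _ d1.
have [[n [g [x gx]]] _] := finite_rank_decomp (finite_rank_compr (v \bo w) u'F).
pose a2 : bop (linf nat) X := \sum_(l < n) rank1 (linf_ev R k (val l)) (x l).
have Aa2 : ideal_class A a2.
  by apply/ideal_finite_rank/finite_rank_sum => l _; exact: finite_rank_rank1.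
(* The vectors [x] are fixed before the functionals are approximated, so the ideal norm of [a2] may
   be scaled away and the accuracy [Mw / t] chosen accordingly. *)
pose t := (alpha a2 + 1) / eta.
have t0 : 0 < t by rewrite divr_gt0// ltr_wpDl ?ideal_norm_ge0.
have d2 : 0 < Mw / t by rewrite divr_gt0.
have [f fP] := choice (fun l : 'I_n => idense (g l) _ d2).
pose F : bop Y X := \sum_(l < n) rank1 (f l) (x l).
have FF : finite_rank Y X F by apply: finite_rank_sum => l _; exact: finite_rank_rank1.
pose hfun (l : nat) : dual Z := if insub l : option 'I_n is Some l' then sor t *: (f l' \bo i - g l') else 0.
have [l|h hE hn] := @linf_family R k Z nat hfun Mw (ltW Mw0).
  rewrite /hfun; case: insubP => [l' _ _|_]; last by rewrite opnorm0 ltW.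
  rewrite opnormZ sre_norm_sor gtr0_norm// mulrC -ler_pdivlMr//.
  apply: opnorm_le_ball => [|z z1]; first exact: ltW.
  by rewrite bopB ltW// fP//; apply/closed_unit_ballE.
have hF : finite_rank Z (linf nat) h.
  apply: (@linf_trunc_finite_rank _ _ _ _ n) => z l nl; rewrite hE /hfun insubF//.
  by rewrite ltnNge nl.
pose b := i1 \bo w + i2 \bo h.
have bM : opnorm b <= Mw.
  apply: opnorm_le_ball => [|z z1]; first exact: ltW.
  rewrite bopD !bop_compE; apply: n12.
    rewrite (le_trans (y := opnorm w))//; last by rewrite lerDl.
    by rewrite (le_trans (opnormP _ _))// ler_piMr ?opnorm_ge0.
  by rewrite (le_trans (rnorm_bop_le _ hn))// ler_piMr ?(ltW Mw0).
have bc : compact_operator _ _ b.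
  apply: compact_operatorD; apply: compact_operator_compl; first exact: approximable_compact.
  exact: finite_rank_compact.
pose a := - ((u - u') \bo v) \bo p1 + (sor t^-1 *: a2) \bo p2.
have A1 : ideal_class A (- ((u - u') \bo v) \bo p1).
  by apply/ideal_compr/idealN/ideal_compl.
have A2 : ideal_class A ((sor t^-1 *: a2) \bo p2) by apply/ideal_compr/idealZ.
have Aa : ideal_class A a by exact: idealD.
have an : alpha a <= kappa * (eta + eta).
  rewrite (le_trans (kappaD A1 A2))// ler_wpM2l ?(ltW kappa0)// lerD//.
    apply: ideal_norm_compr1 => //; first by apply/idealN/ideal_compl.
    have Auv : ideal_class A ((u - u') \bo v) by exact: ideal_compl.
    rewrite (le_trans (ideal_normN Auv))// (le_trans (ideal_norm_compl _ Av))//.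
    rewrite (le_trans (ler_wpM2r (ideal_norm_ge0 Av) uu'))// mulrAC ler_pdivrMr.
      by rewrite ler_wpM2l ?(ltW eta0)// lerDl.
    by rewrite ltr_wpDl ?ideal_norm_ge0.
  apply: ideal_norm_compr1 => //; first exact: idealZ.
  rewrite (le_trans (ideal_normZr _ Aa2)) ?invr_ge0 ?(ltW t0)//.
  rewrite /t invf_div mulrAC ler_pdivrMr ?ltr_wpDl ?ideal_norm_ge0//.
  by rewrite ler_wpM2l ?(ltW eta0)// lerDl.
have TFE : (F - T) \bo i = a \bo b.
  apply: bop_ext => z; pose B := i1 (w z) + i2 (h z).
  have -> : (a \bo b) z = - (u (v (p1 B)) - u' (v (p1 B))) + sor t^-1 *: a2 (p2 B) by [].
  have -> : p1 B = w z by rewrite bopDr pi11 pi12 addr0.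
  have -> : p2 B = h z by rewrite bopDr pi22 pi21 add0r.
  rewrite [LHS]bop_compE bopB.
  have -> : u (v (w z)) = T (i z) by have /(congr1 (fun S : bop _ _ => S z)) := TiE.
  have -> : u' (v (w z)) = \sum_(l < n) (g l z : K) *: x l.
    rewrite -[LHS]/((u' \bo (v \bo w)) z) gx bop_suml.
    by apply: eq_bigr => l _; rewrite rank1E.
  have -> : sor t^-1 *: a2 (h z) = \sum_(l < n) ((f l (i z) : K) - (g l z : K)) *: x l.
    rewrite /a2 bop_suml scaler_sumr; apply: eq_bigr => l _.
    rewrite rank1E linf_evE hE /hfun valK bopZ bopB bop_compE.
    rewrite -[_ *: (_ - _)]/(_ * _) scalerA mulrA -scalar_of_realM mulVf ?gt_eqF//.
    by rewrite scalar_of_real1 mul1r.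
  under [X in _ = _ + X]eq_bigr do rewrite scalerBl.
  rewrite sumrB opprB [RHS]addrC addrA subrK; congr (_ - _).
  by rewrite /F bop_suml; apply: eq_bigr => l _; rewrite rank1E.
exists F; split => //; apply: sU; split; first exact: ideal_finite_rank.
move=> C Cin; rewrite (le_lt_trans (lambda_seminorm_le _ _ (Cs C Cin)))//.
rewrite TFE (le_lt_trans (comp_compact_norm_le Aa bc))//.
rewrite (le_lt_trans (ler_pM (ideal_norm_ge0 Aa) (opnorm_ge0 _) an bM))//.
have -> : kappa * (eta + eta) * Mw = eps / 2.
  by rewrite /eta; field; rewrite !gt_eqF.
by rewrite ltr_pdivrMr// ltr_pMr ?ltr1n.
Qed.

(** Here the finite rank approximants come from the metric approximation property of [linf G]. The
    error is small in its compact factor alone, and the scale [t] shares this with the ideal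
    factor. *)
Lemma compact_linf_telescoping Y (G H : Type) (a : bop (linf G) (linf H)) (b : bop Y (linf G))
    (c : nat -> R) : (forall n, 0 < c n) -> ideal_class A a -> compact_operator Y (linf G) b ->
  exists (U_ : nat -> bop Y (linf H)) (M : R),
    [/\ U_ 0%N = 0,
        forall n, finitely_factored A setT (c n) (M * 2^-1 ^+ n) (U_ n.+1 - U_ n) &
        forall n, opnorm (a \bo b - U_ n.+1) <= 2^-1 ^+ n].
Proof.
move=> c0 Aa bc.
have [||||U_ [M [U0 _ Uf Ul]]] := @telescoping R k A kappa kappa1 kappaD Y H setT
  [set V | finite_rank _ _ V] (a \bo b) c c0; last by exists U_, M.
- exact: finite_rank0.
- by [].
- by exists (alpha a), (opnorm b), G, a, b.
move=> e e0; pose t := alpha a / e + 1.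
have t0 : 0 < t by rewrite ltr_wpDl// divr_ge0 ?ideal_norm_ge0// ltW.
have [m [r [i [_ _ rm h]]]] := linf_approximation bc (divr_gt0 e0 t0).
exists (a \bo (i \bo r \bo b)).
  by apply/finite_rank_compl/finite_rank_compr/finite_rank_compl; exact: linf_trunc_finite_rank rm.
exists G, (sor t^-1 *: a), (sor t *: (b - i \bo r \bo b)); split => //.
- split; first exact: idealZ.
  rewrite (le_trans (ideal_normZr _ Aa)) ?invr_ge0 ?(ltW t0)//.
  by rewrite mulrC ler_pdivrMr// /t mulrDr mulr1 mulrCA mulfV ?gt_eqF// mulr1 lerDl ltW.
- split; last by rewrite opnormZ sre_norm_sor gtr0_norm// mulrC -ler_pdivlMr.
  apply/compact_operatorZ/compact_operatorD => //.
  exact/compact_operatorN/compact_operator_compl.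
- rewrite bop_compZr bop_compZl scalerA -scalar_of_realM mulfV ?gt_eqF//.
  by rewrite scalar_of_real1 scale1r bop_compBr.
Qed.

Lemma compact_linf_class_min Y (G H : Type) (a : bop (linf G) (linf H)) (b : bop Y (linf G)) :
  ideal_class A a -> compact_operator Y (linf G) b -> class_min A Y (linf H) (a \bo b).
Proof.
move=> Aa bc.
have [U_ [M [U0 Uf Ul]]] := compact_linf_telescoping (weight_gt0 kappa1) Aa bc.
apply: (sum_in_class_min Ainj kappa1 kappaD (j := bop_id _) (T_ := U_) (good := setT) (M := M)).
- by move=> x; rewrite bop_idE.
- exact: U0.
- move=> y e e0; have [N Ne] := half_pow_small (rnorm y) e0.
  exists N.+1 => -[//|n] /Ne; apply: le_trans.
  by rewrite -bopB (le_trans (opnormP _ _))// mulrC ler_wpM2l ?rnorm_ge0.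
- by move=> n; rewrite bop_comp1l.
Qed.

Lemma class_min_inj Y X (T : bop Y X) :
  class_min A Y X T -> class_inj (class_min A) Y X T.
Proof.
move=> [H2 [u [V [uA VA ->]]]]; exists H2, (linf_embedding X \bo u), V; split => //.
  exact: approximable_compl.
exact: bop_compA.
Qed.

Lemma primal_part X : approximation_property A X <->
  forall Y, class_inj (class_min A) Y X = class_min A Y X.
Proof.
split=> [AP Y|hY].
  apply/seteqP; split=> T; last exact: class_min_inj.
  move=> [H2 [u [_ [uA [H1 [v [w [Av wA ->]]]] TE]]]].
  have Ap : ideal_class A (u \bo v) by exact: ideal_compl.
  have wc := approximable_compact wA.
  have jT : linf_embedding X \bo T = (u \bo v) \bo w by rewrite TE bop_compA.
  have ji := @rnorm_linf_embedding R k X; have jinj := isometric_inj ji.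
  have [||||U_ [M [U0 UP Uf Ul]]] := @telescoping R k A kappa kappa1 kappaD Y _
    (functionals_through w)
    [set V | exists2 F : bop H1 X, finite_rank _ _ F & V = linf_embedding X \bo (F \bo w)]
    (linf_embedding X \bo T) (weight kappa) (weight_gt0 kappa1).
  - by exists 0; [exact: finite_rank0 | apply: bop_ext => y; rewrite !bop_compE bop0r].
  - by move=> _ [F FF ->]; apply/finite_rank_compl/finite_rank_compr.
  - exists (alpha (u \bo v)), (opnorm w); rewrite jT; exact: extend_factor.
  - move=> e e0; have [F FF h] := approximate_factorization Ainj Aext ji AP Ap wc jT e0.
    by exists (linf_embedding X \bo (F \bo w)) => //; exists F.
  have hT n : exists F : bop Y X, U_ n = linf_embedding X \bo F.
    by have [F _ ->] := UP n; exists (F \bo w).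
  have [T_ TP] := choice hT.
  apply: (sum_in_class_min Ainj kappa1 kappaD (j := linf_embedding X) (T_ := T_)
    (good := functionals_through w) (M := M)).
  - exact: ji.
  - apply: bop_ext => y; apply: jinj; rewrite -(bop_compE (linf_embedding X)) -TP U0.
    by rewrite bop0r.
  - move=> y e e0; have [N Ne] := half_pow_small (rnorm y) e0.
    exists N.+1 => -[//|n] /Ne; apply: le_trans.
    rewrite -ji bopBr -!(bop_compE (linf_embedding X)) -TP -bopB (le_trans (opnormP _ _))//.
    by rewrite mulrC ler_wpM2l ?rnorm_ge0.
  - by move=> n; rewrite bop_compBr -!TP.
apply: approximation_property_of_min => Y Z T i AT ic.
rewrite -hY /class_inj /=.
(* After the extension, the embedded operator is [a] composed with the compact
   [linf_embedding Y \bo i], so the middle space has become a space of bounded families. *)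
have [a [Aa aE _]] := Aext (ideal_compl (linf_embedding X) AT).
rewrite bop_compA aE -bop_compA.
by apply: compact_linf_class_min => //; exact: compact_operator_compl.
Qed.

End MinimalKernel.

(** * The approximation property of the dual and the surjective hull *)

Section DualPart.
Variables (R : realType) (k : scalar_kind).
Local Notation K := (scalar_field R k).
Local Notation banach := (completeNormedModType K).
Local Notation sor := (@scalar_of_real R k).
Implicit Types X Y Z : banach.
Local Notation linf := (linf R k).
Local Notation l1 := (l1 R k).
Local Notation ld := (l1_delta R k).
Variable A : operator_ideal R k.
Local Notation alpha := (ideal_norm A).
Hypothesis Ainj : injective_ideal A.
Hypothesis Aext : linf_extension_property A.
Variable kappa : R.
Hypothesis kappa1 : 1 <= kappa.
Hypothesis kappaD : forall (X Y : banach) (S T : bop X Y),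
  ideal_class A S -> ideal_class A T -> alpha (S + T) <= kappa * (alpha S + alpha T).

Lemma opnorm_adjoint X Y (T : bop X Y) : opnorm (adjoint T) <= opnorm T.
Proof.
apply: opnorm_le => [|f]; first exact: opnorm_ge0.
by rewrite rnorm_bop [leRHS]mulrC rnorm_bop; exact: opnorm_comp.
Qed.

Lemma adjointE X Y (T : bop X Y) f x : adjoint T f x = f (T x).
Proof. by []. Qed.

Lemma adjointB X Y (S T : bop X Y) : adjoint (S - T) = adjoint S - adjoint T.
Proof. by apply: bop_ext => f; rewrite bopB; apply: bop_ext => x; rewrite bopB !adjointE bopB bopBr. Qed.

Lemma adjoint_finite_sum X Y n (g : 'I_n -> dual X) (y : 'I_n -> Y) f :
  adjoint (\sum_(i < n) rank1 (g i) (y i)) f = \sum_(i < n) (f (y i) : K) *: g i.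
Proof.
apply: bop_ext => x; rewrite adjointE !bop_suml bop_sumr; apply: eq_bigr => i _.
by rewrite rank1E bopZr bopZ -![_ *: _]/(_ * _) mulrC.
Qed.

Lemma finite_rank_adjoint X Y (T : bop X Y) : finite_rank X Y T -> finite_rank _ _ (adjoint T).
Proof.
move=> /finite_rank_decomp[[n [g [y ->]]] _]; exists n, g => f.
by exists (fun i => f (y i)); rewrite adjoint_finite_sum.
Qed.

Lemma approximable_adjoint X Y (T : bop X Y) : approximable X Y T -> approximable _ _ (adjoint T).
Proof.
move=> /approximableP h; apply/approximableP => e e0; have [S SF Se] := h e e0.
exists (adjoint S); first exact: finite_rank_adjoint.
by rewrite -adjointB (le_trans (opnorm_adjoint _)).
Qed.

(** For a finite rank [S] with terms [rank1 (g i) (y i)], the functional [d \bo adjoint S] is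
    evaluation at the vector with coefficients [d (g i)] on the [y i]. Evaluations form a closed
    set, which settles the limit. *)
Lemma approximable_adjoint_functional X Y (u : bop X Y) (d : dual (dual X)) :
  approximable X Y u -> range (bidual_embedding Y) (d \bo adjoint u).
Proof.
move=> /approximableP uA.
suff [y yE] : exists y, bidual_embedding Y y = d \bo adjoint u by exists y.
apply: closed_range => [y|e e0]; first exact: rnorm_bidual.
have M0 : 0 < opnorm d + 1 by rewrite ltr_wpDl ?opnorm_ge0.
have [S /finite_rank_decomp[[n [g [y SE]]] _] Se] := uA _ (divr_gt0 e0 M0).
exists (\sum_(i < n) (d (g i) : K) *: y i).
have -> : bidual_embedding Y (\sum_(i < n) (d (g i) : K) *: y i) = d \bo adjoint S.
  apply: bop_ext => f; rewrite bidual_embeddingE bop_compE SE adjoint_finite_sum !bop_sumr.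
  by apply: eq_bigr => i _; rewrite !bopZr -![_ *: _]/(_ * _) mulrC.
rewrite -bop_compBr -adjointB rnorm_bop (le_trans (opnorm_comp _ _))//.
rewrite (le_trans (ler_wpM2l (opnorm_ge0 _) (le_trans (opnorm_adjoint _) Se)))//.
by rewrite mulrCA ler_piMr ?(ltW e0)// ler_pdivrMr// mul1r lerDl.
Qed.

Lemma functionals_through_adjoint X Y (u : bop X Y) (f : dual (dual Y)) :
  approximable X Y u -> functionals_through (adjoint u) f -> range (bidual_embedding Y) f.
Proof.
move=> uA h; suff [y yE] : exists y, bidual_embedding Y y = f by exists y.
apply: closed_range => [y|e e0]; first exact: rnorm_bidual.
have [d hd] := h e e0; have [y _ yE] := approximable_adjoint_functional d uA.
by exists y; rewrite yE rnorm_bop.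
Qed.

Lemma l1_coordinates (I : choiceType) : exists2 j : bop (dual (l1 I)) (linf I),
  (forall f i, j f i = f (ld i)) & opnorm j <= 1.
Proof.
have [i|j jE j1] := @linf_family R k (dual (l1 I)) I (fun i => bidual_embedding _ (ld i)) 1 ler01.
  by rewrite -rnorm_bop rnorm_bidual rnorm_l1_delta.
by exists j => // f i; rewrite jE bidual_embeddingE.
Qed.

Lemma l1_quotient_lift X (x : X) :
  exists2 w, l1_quotient X w = x & rnorm w <= 2 * rnorm x.
Proof.
have [->|x0] := eqVneq x 0; first by exists 0; rewrite ?bop0r// !rnorm0 mulr0.
have xp : 0 < rnorm x by rewrite rnorm_gt0.
have [b b1 xb] := scale_unit xp (lexx (rnorm x)).
have bB : b \in closed_unit_ball X by rewrite inE; apply/closed_unit_ballE.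
exists (sor (rnorm x) *: ld (SigSub bB : closed_unit_ball X)).
  by rewrite bopZr l1_quotient_delta.
rewrite rnormZr gtr0_norm// mulrC ler_wpM2r ?(ltW xp)//.
by rewrite (le_trans (rnorm_l1_delta _ _ _))// ler1n.
Qed.

(** The dual is embedded by its values on the ball of [X], not of the bidual: this embedding is the
    transpose of the canonical quotient map, so that the surjective hull becomes visible on
    adjoints. *)
Lemma dual_in_linf X : exists2 j : bop (dual X) (linf (closed_unit_ball X)),
  (forall f b, j f b = f (l1_quotient X (ld b))) & forall f, rnorm (j f) = rnorm f.
Proof.
have [E EE E1] := l1_coordinates (closed_unit_ball X).
have jn : opnorm (E \bo adjoint (l1_quotient X)) <= 1.
  rewrite (le_trans (opnorm_comp _ _))// -[leRHS]mulr1 ler_pM ?opnorm_ge0//.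
  exact: le_trans (opnorm_adjoint _) (opnorm_l1_quotient _).
exists (E \bo adjoint (l1_quotient X)); first by move=> f b; rewrite bop_compE EE.
move=> f; apply/le_anti/andP; split; first by rewrite (le_trans (rnorm_bop_le _ jn))// mul1r.
rewrite [leLHS]rnorm_bop; apply: opnorm_le_ball => [|x x1]; first exact: rnorm_ge0.
have xB : x \in closed_unit_ball X by rewrite inE; apply/closed_unit_ballE.
pose b : closed_unit_ball X := SigSub xB.
have -> : f x = (E \bo adjoint (l1_quotient X)) f b.
  by rewrite bop_compE EE adjointE l1_quotient_delta.
exact: linf_coord_le.
Qed.

Lemma approximately_factored_sub Y (H : Type) (good good' : set (dual Y)) c M (T : bop Y (linf H)) :
  good `<=` good' -> approximately_factored A good c M T -> approximately_factored A good' c M T.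
Proof.
move=> gg [G [a [b [? ? bg ?]]]]; exists G, a, b; split => // f; exact/gg/bg.
Qed.

Lemma dual_class_min_sur X Y (T : bop X Y) :
  class_min (class_dual A) X Y T -> class_sur (class_min (class_dual A)) X Y T.
Proof.
move=> [H2 [u [_ [uA [H1 [v [w [Av wA ->]]]] ->]]]].
exists H2, u, (v \bo (w \bo l1_quotient X)); split => //.
  by exists H1, v, (w \bo l1_quotient X); split => //; exact: approximable_compr.
by rewrite !bop_compA.
Qed.

Lemma dual_class_min_of_ap X Y (T : bop X Y) : approximation_property A (dual X) ->
  class_sur (class_min (class_dual A)) X Y T -> class_min (class_dual A) X Y T.
Proof.
move=> AP [H2 [u [_ [uA [H1 [v [w [Av wA ->]]]] TE]]]].
have [E EE E1] := l1_coordinates (closed_unit_ball X).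
have [j jE ji] := dual_in_linf X; have jinj := isometric_inj ji.
pose p := E \bo adjoint w \bo adjoint v.
have Ap : ideal_class A p by exact: ideal_compl.
have uc : compact_operator _ _ (adjoint u) by exact/approximable_compact/approximable_adjoint.
have jT : j \bo adjoint T = p \bo adjoint u.
  apply: bop_ext => f; apply: linf_ext => b.
  rewrite bop_compE jE adjointE !bop_compE EE !adjointE; congr (f _).
  by have /(congr1 (fun S : bop _ _ => S (ld b))) := TE.
have good_sub : functionals_through (adjoint u) `<=` range (bidual_embedding Y).
  by move=> f; exact: functionals_through_adjoint.
(* Only approximants that are adjoints can be transposed back to operators from [X] to [Y], hence
   the extra condition on them. *)
have [||||U_ [M [U0 UP Uf Ul]]] := @telescoping R k A kappa kappa1 kappaD (dual Y) _
  (range (bidual_embedding Y))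
  [set V | finite_rank _ _ V /\ exists G : bop X Y, V = j \bo adjoint G]
  (j \bo adjoint T) (weight kappa) (weight_gt0 kappa1).
- split; first exact: finite_rank0.
  exists 0; apply: bop_ext => f; apply: linf_ext => b.
  by rewrite bop_compE jE adjointE bop0r.
- by move=> V [].
- exists (alpha p), (opnorm (adjoint u)); rewrite jT.
  by apply: (approximately_factored_sub good_sub); exact: extend_factor.
- move=> e e0; have [F FF h] := approximate_factorization Ainj Aext ji AP Ap uc jT e0.
  exists (j \bo (F \bo adjoint u)); last exact: approximately_factored_sub h.
  split; first by apply/finite_rank_compl/finite_rank_compr.
  have [[n [d [x FE]]] _] := finite_rank_decomp FF.
  (* [u] is approximable, so the functionals of [F \bo adjoint u] are evaluations at points of [Y];
     this makes that operator an adjoint. *)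
  have hy l : exists y, bidual_embedding Y y = d l \bo adjoint u.
    by have [y _ yE] := approximable_adjoint_functional (d l) uA; exists y.
  have [y yE] := choice hy.
  exists (\sum_(l < n) rank1 (x l) (y l)); congr (_ \bo _); apply: bop_ext => f.
  rewrite adjoint_finite_sum bop_compE FE bop_suml; apply: eq_bigr => l _.
  by rewrite rank1E -(bop_compE (d l)) -yE bidual_embeddingE.
have hT n : exists G : bop X Y, U_ n = j \bo adjoint G by have [_ ?] := UP n.
have [T_ TP] := choice hT.
apply: (sum_in_dual_class_min Ainj kappa1 kappaD (q := l1_quotient X) (T_ := T_) (j := j) (M := M)).
- exact: l1_quotient_lift.
- exact: jE.
- apply: bop_ext => x; apply: dual_separates => f.
  have : adjoint (T_ 0%N) f = 0.
    by apply: jinj; rewrite -(bop_compE j) -TP U0 bop0r.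
  by move=> /(congr1 (fun g : dual X => g x)); rewrite adjointE bop0r.
- move=> x e e0; have [N Ne] := half_pow_small (rnorm x) e0.
  exists N.+1 => -[//|n] /Ne; apply: le_trans; apply: rnorm_le_dual => f f1.
  rewrite -bopB -adjointE (le_trans (opnormP _ _))// mulrC ler_wpM2l ?rnorm_ge0//.
  rewrite -rnorm_bop -ji adjointB bopB bopBr -!(bop_compE j) -TP -bopB.
  rewrite (le_trans (rnorm_bop_le _ (Ul n)))// ler_piMr ?exprn_ge0 ?invr_ge0//.
  by rewrite rnorm_bop.
- by move=> n; rewrite adjointB bop_compBr -!TP.
Qed.

(** [T] is the transpose of [a \bo b], restricted from functionals on [linf I] to those carried by
    [l1 I]. Telescoping [a \bo b] and transposing the increments yields functionals that are
    evaluations at elements of the dual of [Z]. *)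
Lemma transpose_in_dual_class_min Z (G : Type) (I : choiceType) (a : bop (linf G) (linf I))
    (b : bop Z (linf G)) (T : bop (l1 I) (dual Z)) :
  ideal_class A a -> compact_operator Z (linf G) b ->
  (forall g z, T (ld g) z = a (b z) g) -> class_min (class_dual A) _ _ T.
Proof.
move=> Aa bc TE.
have [U_ [M [U0 Uf Ul]]] := compact_linf_telescoping kappa1 kappaD (weight_gt0 kappa1) Aa bc.
have [E EE E1] := l1_coordinates I.
have [g|rho rhoE rho1] := @l1_family R k I (dual (linf I)) (fun g => linf_ev R k g) 1 ler01.
  by rewrite rnorm_bop; exact: opnorm_linf_ev.
pose T_ n := adjoint (U_ n) \bo rho.
have TrE : T = adjoint (a \bo b) \bo rho.
  by apply: l1_ext => g; apply: bop_ext => z; rewrite TE bop_compE rhoE.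
apply: (sum_in_dual_class_min Ainj kappa1 kappaD (q := bop_id _) (T_ := T_) (j := E) (M := M)).
- by move=> w; exists w; rewrite ?bop_idE// mulr_natl mulr2n lerDl rnorm_ge0.
- by move=> f g; rewrite EE.
- by rewrite /T_ U0; apply: l1_ext => g; apply: bop_ext => z; rewrite -[LHS]/(rho (ld g) 0) bop0r.
- move=> w e e0; have [N Ne] := half_pow_small (rnorm w) e0.
  exists N.+1 => -[//|n] /Ne; apply: le_trans.
  rewrite TrE -bopB -bop_compBl -adjointB (le_trans (opnormP _ _))// mulrC ler_wpM2l ?rnorm_ge0//.
  rewrite (le_trans (opnorm_comp _ _))// (le_trans (ler_pM (opnorm_ge0 _) (opnorm_ge0 _)
    (le_trans (opnorm_adjoint _) (Ul n)) rho1))//.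
  by rewrite mulr1.
- move=> n; have [m [g [c [Ac cw gM UE]]]] := Uf n.
  exists m, (fun i => bidual_embedding (dual Z) (g i)), c; split => //.
    by move=> i im; split; [exists (g i) | rewrite -rnorm_bop rnorm_bidual rnorm_bop; exact: (gM i im).2].
  move=> psi; apply: linf_ext => x; rewrite bop_compE EE adjointE.
  have -> : (T_ n.+1 - T_ n) (ld x) = \sum_(i < m) (c (linf_delta R k i) x : K) *: g i.
    rewrite /T_ -bop_compBl -adjointB bop_compE rhoE; apply: bop_ext => z.
    rewrite adjointE linf_evE UE linf_sum bop_suml; apply: eq_bigr => i _.
    by rewrite linfZ bopZ -![_ *: _]/(_ * _) mulrC.
  rewrite bop_sumr linf_sum; apply: eq_bigr => i _.
  by rewrite bopZr linfZ bidual_embeddingE -![_ *: _]/(_ * _) mulrC.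
Qed.

Lemma dual_part X : approximation_property A (dual X) <->
  forall Y, class_sur (class_min (class_dual A)) X Y = class_min (class_dual A) X Y.
Proof.
split=> [AP Y|hY].
  by apply/seteqP; split=> T; [exact: dual_class_min_of_ap | exact: dual_class_min_sur].
apply: (approximation_property_of_min kappa1 kappaD) => Y Z T i AT ic.
(* The hypothesis concerns operators out of [X], whereas [T] maps into its dual; [S] is the adjoint
   of [T \bo i] restricted to [X]. *)
pose S := adjoint (T \bo i) \bo bidual_embedding X.
have SE x z : S x z = T (i z) x.
  by rewrite -[LHS]/(bidual_embedding X x (T (i z))) bidual_embeddingE.
have [j jE ji] := dual_in_linf X.
have [a [Aa aE _]] := Aext (ideal_compl j AT).
have : class_min (class_dual A) X (dual Z) S.
  rewrite -hY /class_sur /=.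
  apply: (transpose_in_dual_class_min (b := linf_embedding Y \bo i) Aa).
    exact: compact_operator_compl.
  move=> g z; rewrite -[LHS]/(S (l1_quotient X (ld g)) z) SE -jE -(bop_compE j) aE.
  by [].
move=> [H2 [u [_ [uA [H1 [v [w [Av wA ->]]]] SuE]]]].
(* Taking adjoints of the factors of [S] and restricting to [Z] recovers [T \bo i]; the middle
   adjoint is in [A] by the definition of the dual ideal. *)
exists (dual H1), (adjoint w), (adjoint v \bo (adjoint u \bo bidual_embedding Z)); split.
- exact: approximable_adjoint.
- exists (dual H2), (adjoint v), (adjoint u \bo bidual_embedding Z); split => //.
  exact/approximable_compr/approximable_adjoint.
- apply: bop_ext => z; apply: bop_ext => x.
  rewrite -[RHS]/(bidual_embedding Z z (u (v (w x)))) bidual_embeddingE -[LHS]/(T (i z) x) -SE.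
  by have /(congr1 (fun S : bop _ _ => S x)) -> := SuE.
Qed.

End DualPart.

Theorem corollary6p6 (R : realType) (k : scalar_kind)
    (A : operator_ideal R k)
    (A_injective : injective_ideal A)
    (A_linf_extension : linf_extension_property A)
    (X : completeNormedModType (scalar_field R k)) :
  (approximation_property A X <->
     forall Y : completeNormedModType (scalar_field R k),
       class_inj (class_min A) Y X = class_min A Y X) /\
  (approximation_property A (dual X) <->
     forall Y : completeNormedModType (scalar_field R k),
       class_sur (class_min (class_dual A)) X Y = class_min (class_dual A) X Y).
Proof.
have [kappa kappa1 kappaD] := ideal_normD A; split.
  exact: (primal_part A_injective A_linf_extension kappa1).
exact: (dual_part A_injective A_linf_extension kappa1).
Qed.
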